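(* Let $n>k\ge 1$ be coprime integers, $\ell\ge 1$, and let $C_1,\dots,C_\ell$ be pairwise distinct nonzero complex numbers. Let $Y^\circ=\{xy\prod_{i=1}^{\ell}(y^k-C_ix^n)=0\}\subset\mathbb{C}^2$, $S=\{0,C_1,\dots,C_\ell,\infty\}\subset\mathbb{P}^1$, and let $\gamma:\mathbb{C}^2\setminus Y^\circ\to\mathbb{P}^1\setminus S$, $\gamma(x,y)=(y^k:x^n)$ (i.e. $y^k/x^n$). Fix $\varepsilon\in\mathbb{C}^*$, and let $\Sigma^\varepsilon$ be the category of local systems on $\mathbb{C}^2\setminus Y^\circ$ whose monodromy along the fibers of $\gamma$ (that is, along $\delta$) is the scalar $\varepsilon\cdot\mathrm{Id}$. For $\mathcal{L}\in\Sigma^\varepsilon$ let $\underline{\mathcal{L}}$ be the unique local system on $\mathbb{P}^1\setminus S$ such that $\mathcal{K}_\varepsilon^{\otimes -1}\otimes\mathcal{L}\simeq\gamma^{-1}\underline{\mathcal{L}}$. Then the functor $\mathcal{L}\mapsto\underline{\mathcal{L}}$ is an equivalence of categories from $\Sigma^\varepsilon$ to the category of local systems on $\mathbb{P}^1\setminus S$, and $\mathcal{L}$ is irreducible [respectively rigid, semi-rigid] if and only if $\underline{\mathcal{L}}$ is irreducible [respectively rigid, semi-rigid].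
   Context: Local systems are locally constant sheaves of finite-dimensional complex vector spaces. Fix integers $r,s$ with $rn=ks+1$. Turbine with shaft. Put $Y_0=\{y=0\}$, $Y_i=\{y^k=C_ix^n\}$ for $1\le i\le\ell$. Let $D_{\rho_1},D_{\rho_2}$ be closed discs in $\mathbb{C}$ centered at $0$ with suitable radii $0<\rho_1\ll\rho_2$; $N_\infty=\partial D_{\rho_1}\times D_{\rho_2}$ is a solid torus in the topological 3-sphere $\partial(D_{\rho_1}\times D_{\rho_2})$. Let $N_0,\dots,N_\ell$ be pairwise disjoint thin closed tubular neighbourhoods, contained in the interior of $N_\infty$, of the knots $K_i=Y_i\cap\partial(D_{\rho_1}\times D_{\rho_2})$. The turbine with shaft is $T^*=T^*_{n,k,\ell}=N_\infty\setminus\bigcup_{i=0}^{\ell}\mathrm{int}(N_i)$; it is a deformation retract of $\mathbb{C}^2\setminus Y^\circ$, and its boundary is the union of the tori $\partial N_i$, $i=0,1,\dots,\ell,\infty$. For each $i$ let $\alpha_i$ (null-homologous in $N_i$) and $\beta_i$ (homologous to the core of $N_i$, with linking number $0$ with it) be the standard meridian and parallel of $\partial N_i$. For $i=0,\infty$ put $\delta=\alpha_i^n\beta_i^k$ (the two elements coincide in $\pi_1(T^* )$) and $\omega_i=\alpha_i^s\beta_i^r$, so $\alpha_i=\delta^r\omega_i^{-k}$. Then $\pi_1(T^* )=\langle\alpha_1,\dots,\alpha_\ell,\omega_0,\omega_\infty:\alpha_1\cdots\alpha_\ell\omega_\infty=\omega_0\rangle\times\langle\delta\rangle$ with $\langle\delta\rangle$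 infinite cyclic; $\pi_1(\partial N_i)$ is generated by $\omega_i,\delta$ for $i=0,\infty$ and by $\alpha_i,\delta$ for $1\le i\le\ell$. The homotopy class of each fiber of $\gamma$ is given by $\delta$. $\mathcal{K}_\varepsilon$ is the rank one local system on $\mathbb{C}^2\setminus Y^\circ$ whose monodromy sends $\delta\mapsto\varepsilon$ and $\alpha_1,\dots,\alpha_\ell,\omega_0\mapsto 1$. Rigidity on $\mathbb{C}^2\setminus Y^\circ$: local systems on $\mathbb{C}^2\setminus Y^\circ$ are identified with their restrictions to $T^*$. The local data of a local system $\mathcal{L}$ on $T^*$ is $\mathcal{L}|_{\partial T^*}$, i.e. the collection of isomorphism classes of $\mathcal{L}|_{\partial N_i}$, $i=0,\dots,\ell,\infty$. $\mathcal{L}$ is rigid if every local system on $T^*$ with local data isomorphic to that of $\mathcal{L}$ is isomorphic to $\mathcal{L}$; it is semi-rigid if there are only finitely many isomorphism classes of local systems on $T^*$ with local data isomorphic to that of $\mathcal{L}$. Rigidity on $\mathbb{P}^1\setminus S$: choose disjoint closed discs $\widetilde{D}_i$ around the points of $S$. The local data of $\mathcal{F}$ is the collection of local systems $\mathcal{F}|_{\partial\widetilde{D}_i}$. $\mathcal{F}$ is rigid [semi-rigid] if its isomorphism class is determined by its local data [if there are only finitely many isomorphism classes of local systems on $\mathbb{P}^1\setminus S$ with local data isomorphic to that of $\mathcal{F}$]. *)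

(* Defs.v *)
From HB Require Import structures.
From mathcomp Require Import all_boot all_order all_algebra.
From mathcomp Require Import all_classical all_reals all_analysis.
From mathcomp Require Import complex.

Set Implicit Arguments.
Unset Strict Implicit.
Unset Printing Implicit Defensive.

Import Order.TTheory GRing.Theory Num.Theory.
Import numFieldNormedType.Exports.

Local Open Scope classical_set_scope.
Local Open Scope ring_scope.

Record category := Category {
  obj :> Type;
  hom : obj -> obj -> Type;
  idm : forall A, hom A A;
  comp : forall A B D, hom B D -> hom A B -> hom A D;
  comp_idl : forall A B (f : hom A B), comp (idm B) f = f;
  comp_idr : forall A B (f : hom A B), comp f (idm A) = f;
  comp_assoc : forall A B D E (h : hom D E) (g : hom B D) (f : hom A B),
    comp h (comp g f) = comp (comp h g) f }.
Arguments hom {c}.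
Arguments idm {c}.
Arguments comp {c A B D}.

Definition isomorphic (Ca : category) (A B : Ca) : Prop :=
  exists (f : hom A B) (g : hom B A), comp g f = idm A /\ comp f g = idm B.

Record functor (Ca Da : category) := Functor {
  fobj :> Ca -> Da;
  fmor : forall A B : Ca, hom A B -> hom (fobj A) (fobj B);
  fmor_id : forall A, fmor (idm A) = idm (fobj A);
  fmor_comp : forall A B D (g : hom B D) (f : hom A B),
    fmor (comp g f) = comp (fmor g) (fmor f) }.
Arguments fmor {Ca Da} _ {A B}.

Definition functor_id (Ca : category) : functor Ca Ca :=
  @Functor Ca Ca id (fun _ _ f => f)
    (fun _ => erefl) (fun _ _ _ _ _ => erefl).

Lemma functor_comp_id (C1 C2 C3 : category) (G : functor C2 C3)
  (F : functor C1 C2) (A : C1) : fmor G (fmor F (idm A)) = idm (G (F A)).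
Proof. by rewrite !fmor_id. Qed.

Lemma functor_comp_comp (C1 C2 C3 : category) (G : functor C2 C3)
  (F : functor C1 C2) (A B D : C1) (g : hom B D) (f : hom A B) :
  fmor G (fmor F (comp g f)) = comp (fmor G (fmor F g)) (fmor G (fmor F f)).
Proof. by rewrite !fmor_comp. Qed.

Definition functor_comp (C1 C2 C3 : category) (G : functor C2 C3)
    (F : functor C1 C2) : functor C1 C3 :=
  @Functor C1 C3 (fun A => G (F A)) (fun A B f => fmor G (fmor F f))
    (functor_comp_id G F) (functor_comp_comp G F).

Definition nat_isomorphic (Ca Da : category) (F G : functor Ca Da) : Prop :=
  exists (a : forall A, hom (F A) (G A)) (b : forall A, hom (G A) (F A)),
    [/\ forall A, comp (b A) (a A) = idm (F A),
        forall A, comp (a A) (b A) = idm (G A)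
      & forall A B (f : hom A B), comp (a B) (fmor F f) = comp (fmor G f) (a A)].

Definition is_equivalence (Ca Da : category) (F : functor Ca Da) : Prop :=
  exists G : functor Da Ca,
    nat_isomorphic (functor_comp G F) (functor_id Ca) /\
    nat_isomorphic (functor_comp F G) (functor_id Da).

Definition full_subcategory (Ca : category) (P : Ca -> Prop) : category :=
  @Category {A : Ca | P A} (fun A B => hom (sval A) (sval B))
    (fun A => idm (sval A)) (fun _ _ _ g f => comp g f)
    (fun _ _ f => comp_idl f) (fun _ _ f => comp_idr f)
    (fun _ _ _ _ h g f => comp_assoc h g f).

Definition sub_inclusion (Ca : category) (P : Ca -> Prop) :
    functor (full_subcategory P) Ca :=
  @Functor (full_subcategory P) Ca sval (fun _ _ f => f)
    (fun _ => erefl) (fun _ _ _ _ _ => erefl).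

Section TensorSpace.
Variables (F : fieldType) (V W : vectType F).

(* Finite-dimensional model of the tensor product: V (x) W = Hom(V^*, W). *)
Definition dualsp : vectType F := 'Hom(V, F^o).
Definition tensorsp : vectType F := 'Hom(dualsp, W).

Definition pure_fun (v : V) (w : W) (f : dualsp) : W := (f v : F) *: w.

Lemma pure_fun_linear v w : linear (pure_fun v w).
Proof.
move=> a f g; rewrite /pure_fun; rewrite add_lfunE scale_lfunE scalerDl.
by rewrite -scalerA.
Qed.

HB.instance Definition _ v w :=
  GRing.isLinear.Build F dualsp W *:%R (pure_fun v w) (pure_fun_linear v w).

Definition pure (v : V) (w : W) : tensorsp := linfun (pure_fun v w).

Lemma pureE v w (f : dualsp) : pure v w f = (f v : F) *: w.
Proof. by rewrite lfunE. Qed.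

End TensorSpace.

Section LfunTools.
Variables (F : fieldType).

Section PostComp.
Variables (A B D : vectType F) (f : 'Hom(B, D)).
Definition postcomp_fun (T : 'Hom(A, B)) : 'Hom(A, D) := (f \o T)%VF.
Lemma postcomp_linear : linear postcomp_fun.
Proof.
move=> a g h; apply/lfunP => x.
by rewrite /postcomp_fun comp_lfunE !add_lfunE !scale_lfunE !comp_lfunE linearP.
Qed.
HB.instance Definition _ := GRing.isLinear.Build F _ _ *:%R postcomp_fun postcomp_linear.
Definition postcomp : 'Hom('Hom(A, B), 'Hom(A, D)) := linfun postcomp_fun.
Lemma postcompE T : postcomp T = (f \o T)%VF.
Proof. by rewrite lfunE. Qed.
End PostComp.

Section PreComp.
Variables (A B D : vectType F) (f : 'Hom(A, B)).
Definition precomp_fun (T : 'Hom(B, D)) : 'Hom(A, D) := (T \o f)%VF.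
Lemma precomp_linear : linear precomp_fun.
Proof. 
move=> a g h; apply/lfunP => x.
by rewrite /precomp_fun add_lfunE scale_lfunE !comp_lfunE add_lfunE scale_lfunE.
Qed.
HB.instance Definition _ := GRing.isLinear.Build F _ _ *:%R precomp_fun precomp_linear.
Definition precomp : 'Hom('Hom(B, D), 'Hom(A, D)) := linfun precomp_fun.
Lemma precompE T : precomp T = (T \o f)%VF.
Proof. by rewrite lfunE. Qed.
End PreComp.

End LfunTools.

Section LfunBij.
Variables (F : fieldType) (A B : vectType F) (f : 'Hom(A, B)).
Hypothesis bf : bijective f.

Lemma lfun_bij_Vf : (f^-1 \o f = \1)%VF.
Proof. by apply: lker0_compVf; apply/lker0P; exact: bij_inj. Qed.

Lemma lfun_bij_fV : (f \o f^-1 = \1)%VF.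
Proof.
apply/lfunP => u; case: (bf) => g fgK gfK.
by rewrite -[u]gfK -comp_lfunE -comp_lfunA lfun_bij_Vf comp_lfun1r id_lfunE.
Qed.

End LfunBij.

Section LfunBijOps.
Variables (F : fieldType) (A B D : vectType F) (f : 'Hom(A, B)).

Lemma postcomp_bij : bijective f -> bijective (@postcomp F D A B f).
Proof.
move=> bf; exists (postcomp D f^-1) => T;
  rewrite !postcompE comp_lfunA ?(lfun_bij_Vf bf) ?(lfun_bij_fV bf);
  by rewrite comp_lfun1l.
Qed.

Lemma precomp_bij : bijective f -> bijective (@precomp F A B D f).
Proof.
move=> bf; exists (precomp D f^-1) => T;
  rewrite !precompE -comp_lfunA ?(lfun_bij_Vf bf) ?(lfun_bij_fV bf);
  by rewrite comp_lfun1r.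
Qed.

End LfunBijOps.

Section TensorMap.
Variables (F : fieldType) (V V' W W' : vectType F).
Variables (f : 'Hom(V, V')) (g : 'Hom(W, W')).

Definition tensor_map : 'Hom(tensorsp V W, tensorsp V' W') :=
  (postcomp (dualsp V') g \o precomp W (precomp F^o f))%VF.

Lemma tensor_mapE (T : tensorsp V W) :
  tensor_map T = (g \o T \o precomp F^o f)%VF.
Proof. by rewrite /tensor_map comp_lfunE postcompE precompE comp_lfunA. Qed.

Lemma tensor_map_pure v w : tensor_map (pure v w) = pure (f v) (g w).
Proof.
apply/lfunP => h.
by rewrite tensor_mapE !comp_lfunE !pureE linearZ precompE comp_lfunE.
Qed.

Lemma tensor_map_sum m (v : 'I_m -> V) (w : 'I_m -> W) :
  tensor_map (\sum_i pure (v i) (w i)) = \sum_i pure (f (v i)) (g (w i)).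
Proof.
by rewrite linear_sum; apply: eq_bigr => i _; exact: tensor_map_pure.
Qed.

Lemma tensor_map_bij : bijective f -> bijective g -> bijective tensor_map.
Proof.
move=> bf bg.
apply: (@eq_bij _ _ (postcomp (dualsp V') g \o precomp W (precomp F^o f))).
  by apply: bij_comp; [exact: postcomp_bij|exact/precomp_bij/precomp_bij].
by move=> T; rewrite /tensor_map comp_lfunE.
Qed.

End TensorMap.

Lemma pure_span (F : fieldType) (V W : vectType F) (T : tensorsp V W) :
  exists m (v : 'I_m -> V) (w : 'I_m -> W), T = \sum_i pure (v i) (w i).
Proof.
pose e := vbasis {:V}; pose d i : dualsp V := linfun (coord e i : V -> F^o).
exists (\dim {:V}), (fun i => e`_i), (fun i => T (d i)).
apply/lfunP => h; rewrite sum_lfunE.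
have Eh : h = \sum_(i < \dim {:V}) (h e`_i : F) *: d i.
  apply/lfunP => v; rewrite sum_lfunE [in LHS](coord_vbasis (memvf v)).
  rewrite linear_sum; apply: eq_bigr => i _.
  by rewrite linearZ scale_lfunE lfunE /= /GRing.scale /= mulrC.
rewrite [in LHS]Eh linear_sum; apply: eq_bigr => i _.
by rewrite linearZ pureE.
Qed.

Definition Cx (R : realType) : numClosedFieldType := R[i].

(* A sheaf is presented by its espace etale: a family of stalks together with,
   for each open U, the functions x |-> s x in stalk x that are sections over
   U.  Only the values of s on U matter.  [ls_triv] says that near every point
   the sheaf is isomorphic to the constant sheaf with stalk V, whose sections
   are the locally constant V-valued functions; in particular the sections
   over U form a vector space and their germs at x are the elements of
   [stalk x]. *)
Record local_system (R : realType) (X : topologicalType) := LocalSystem {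
  stalk : X -> vectType (Cx R);
  sec : set X -> (forall x, stalk x) -> Prop;
  sec_restrict : forall (U V : set X) s t, open U -> open V -> V `<=` U ->
    sec U s -> (forall x, V x -> t x = s x) -> sec V t;
  sec_glue : forall (U : set X) s, open U ->
    (forall x, U x -> exists V, [/\ open V, V x, V `<=` U & sec V s]) ->
    sec U s;
  ls_triv : forall x, exists (U : set X) (V : vectType (Cx R))
      (phi : forall y, 'Hom(V, stalk y)),
    [/\ open U, U x, forall y, U y -> bijective (phi y)
      & forall (W : set X) s, open W -> W `<=` U ->
          (sec W s <->
           forall y, W y -> exists v, \forall z \near y, s z = phi z v)] }.

Section LocalSystems.
Variables (R : realType).
Local Notation C := (Cx R).

Section Morphisms.
Variable X : topologicalType.

Record ls_hom (L M : local_system R X) := LsHom {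
  mor :> forall x, 'Hom(stalk L x, stalk M x);
  mor_sec : forall (U : set X) s, open U -> sec U s ->
    sec U (fun x => mor x (s x)) }.

Lemma ls_hom_eq (L M : local_system R X) (f g : ls_hom L M) :
  (forall x, f x = g x) -> f = g.
Proof.
case: f g => [f Hf] [g Hg] /= fg.
have E : f = g by apply: functional_extensionality_dep.
by subst g; congr LsHom; exact: Prop_irrelevance.
Qed.

Lemma ls_id_sec (L : local_system R X) (U : set X) (s : forall x, stalk L x) :
  open U -> sec U s -> sec U (fun x => (\1%VF : 'End(stalk L x)) (s x)).
Proof.
move=> oU /(sec_restrict oU oU (@subset_refl _ _)); apply=> x _.
by rewrite id_lfunE.
Qed.

Definition ls_id (L : local_system R X) : ls_hom L L := LsHom (@ls_id_sec L).

Lemma ls_comp_sec (L M N : local_system R X) (g : ls_hom M N) (f : ls_hom L M)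
  (U : set X) (s : forall x, stalk L x) :
  open U -> sec U s -> sec U (fun x => (g x \o f x)%VF (s x)).
Proof.
move=> oU /(mor_sec f oU)/(mor_sec g oU).
by move/(sec_restrict oU oU (@subset_refl _ _)); apply=> x _; rewrite comp_lfunE.
Qed.

Definition ls_comp (L M N : local_system R X) (g : ls_hom M N)
  (f : ls_hom L M) : ls_hom L N := LsHom (@ls_comp_sec L M N g f).

Lemma ls_comp_idl L M (f : ls_hom L M) : ls_comp (ls_id M) f = f.
Proof. by apply: ls_hom_eq => x /=; rewrite comp_lfun1l. Qed.

Lemma ls_comp_idr L M (f : ls_hom L M) : ls_comp f (ls_id L) = f.
Proof. by apply: ls_hom_eq => x /=; rewrite comp_lfun1r. Qed.

Lemma ls_comp_assoc L M N P (h : ls_hom N P) (g : ls_hom M N)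
  (f : ls_hom L M) : ls_comp h (ls_comp g f) = ls_comp (ls_comp h g) f.
Proof. by apply: ls_hom_eq => x /=; rewrite comp_lfunA. Qed.

Definition LS : category :=
  Category ls_comp_idl ls_comp_idr ls_comp_assoc.

End Morphisms.

(* A subobject is a morphism that is injective on stalks. *)
Definition irreducible (X : topologicalType) (L : local_system R X) : Prop :=
  (exists x, \dim {:stalk L x} != 0%N) /\
  forall (M : local_system R X) (f : ls_hom M L),
    (forall x, injective (f x)) ->
    (forall x, \dim {:stalk M x} = 0%N) \/ (forall x, bijective (f x)).

Definition rank_one (X : topologicalType) (L : local_system R X) : Prop :=
  forall x, \dim {:stalk L x} = 1%N.

Section SecLemmas.
Variables (X : topologicalType) (L : local_system R X).

Lemma sec_sub (U V : set X) (s : forall x, stalk L x) :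
  open U -> open V -> V `<=` U -> sec U s -> sec V s.
Proof. by move=> oU oV VU /(sec_restrict oU oV VU); apply. Qed.

Lemma sec_ext (U : set X) (s t : forall x, stalk L x) :
  open U -> (forall x, U x -> t x = s x) -> sec U s -> sec U t.
Proof. by move=> oU e /(sec_restrict oU oU (@subset_refl _ _)); apply. Qed.

End SecLemmas.

Section AlongMap.
Variables (X Y : topologicalType) (f : X -> Y) (L : local_system R Y).

(* Sections over U of the inverse image f^{-1}L. *)
Definition along (U : set X) (s : forall x, stalk L (f x)) : Prop :=
  forall x, U x -> exists (V : set Y) (t : forall y, stalk L y),
    [/\ open V, V (f x), sec V t & \forall z \near x, s z = t (f z)].

Lemma along_restrict (U V : set X) s t : open U -> open V -> V `<=` U ->
  along U s -> (forall x, V x -> t x = s x) -> along V t.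
Proof.
move=> oU oV VU sU tsV x Vx; have [W [u [oW Wx su st]]] := sU x (VU _ Vx).
exists W, u; split=> //; have Vn : nbhs x V by apply: open_nbhs_nbhs.
by near=> z; rewrite tsV; [near: z|near: z].
Unshelve. all: by end_near. Qed.

Lemma along_glue (U : set X) s : open U ->
  (forall x, U x -> exists V, [/\ open V, V x, V `<=` U & along V s]) ->
  along U s.
Proof. by move=> oU H x /H[V [oV Vx _ /(_ x Vx)]]. Qed.

Hypothesis cf : continuous f.

Lemma along_triv x : exists (U : set X) (V : vectType C)
    (phi : forall y, 'Hom(V, stalk L (f y))),
  [/\ open U, U x, forall y, U y -> bijective (phi y)
    & forall (W : set X) s, open W -> W `<=` U ->
      (along W s <->
       forall y, W y -> exists v, \forall z \near y, s z = phi z v)].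
Proof.
have [U [V [phi [oU Ux phib trivU]]]] := ls_triv L (f x).
have opre A : open A -> open (f @^-1` A).
  by move=> oA; apply: open_comp => // y _; exact: cf.
exists (f @^-1` U), V, (fun y => phi (f y)); split => //.
- exact: opre.
- by move=> y /phib.
- move=> W s oW WU; split.
  + move=> sW y Wy; have [A [t [oA Ay sA st]]] := sW y Wy.
    have sAU : sec (A `&` U) t by apply: sec_sub sA; [exact: oA|exact: openI|move=> ? []].
    have AUU : A `&` U `<=` U by move=> ? [].
    have AUy : (A `&` U) (f y) by split=> //; exact: WU.
    have [v tv] := (trivU _ _ (openI oA oU) AUU).1 sAU (f y) AUy.
    have tv' : \forall z \near y, t (f z) = phi (f z) v
      by exact: cf tv.
    by exists v; near=> z; transitivity (t (f z)); near: z.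
  + move=> sW y Wy; have [v sv] := sW y Wy.
    exists U, (fun y => phi y v); split => //; first exact: WU.
    by apply: (trivU U _ oU _).2 => // u Uu; exists v; apply: nearW.
Unshelve. all: by end_near. Qed.

Definition pullback : local_system R X :=
  LocalSystem along_restrict along_glue along_triv.

End AlongMap.

Section PullbackFunctor.
Variables (X Y : topologicalType) (f : X -> Y) (cf : continuous f).

Lemma pullback_mor_sec (L M : local_system R Y) (g : ls_hom L M)
  (U : set X) (s : forall x, stalk (pullback L cf) x) :
  open U -> sec U s ->
  @sec _ _ (pullback M cf) U (fun x => g (f x) (s x)).
Proof.
move=> oU sU x Ux; have [V [t [oV Vx st e]]] := sU x Ux.
exists V, (fun y => g y (t y)); split => //; first exact: mor_sec.
by near=> z; congr (g _ _); near: z.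
Unshelve. all: by end_near. Qed.

Definition pullback_mor (L M : LS Y) (g : hom L M) :
    @hom (LS X) (pullback L cf) (pullback M cf) :=
  @LsHom _ (pullback L cf) (pullback M cf)
    (fun x => g (f x)) (@pullback_mor_sec L M g).

Lemma pullback_mor_id (L : LS Y) :
  pullback_mor (idm L) = @idm (LS X) (pullback L cf).
Proof. exact: ls_hom_eq. Qed.

Lemma pullback_mor_comp (L M N : LS Y) (h : hom M N) (g : hom L M) :
  pullback_mor (comp h g) = comp (pullback_mor h) (pullback_mor g).
Proof. exact: ls_hom_eq. Qed.

Definition pullback_functor : functor (LS Y) (LS X) :=
  @Functor (LS Y) (LS X) (fun L => pullback L cf) pullback_mor
    pullback_mor_id pullback_mor_comp.

End PullbackFunctor.

Section Dual.
Variables (X : topologicalType) (L : local_system R X).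

(* The sheaf Hom(L, C_X): a section takes sections of L to locally constant
   functions. *)
Definition dual_sec (U : set X) (h : forall x, dualsp (stalk L x)) : Prop :=
  forall (V : set X) (t : forall x, stalk L x), open V -> V `<=` U ->
    sec V t -> forall y, V y -> \forall z \near y, h z (t z) = h y (t y).

Lemma dual_restrict (U V : set X) s t : open U -> open V -> V `<=` U ->
  dual_sec U s -> (forall x, V x -> t x = s x) -> dual_sec V t.
Proof.
move=> oU oV VU sU ts W u oW WV su y Wy.
have Wn : nbhs y W by apply: open_nbhs_nbhs.
have := sU W u oW (subset_trans WV VU) su y Wy => E.
rewrite ts; last exact: WV.
by near=> z; rewrite ts; [near: z|apply: WV; near: z].
Unshelve. all: by end_near. Qed.

Lemma dual_glue (U : set X) s : open U ->
  (forall x, U x -> exists V, [/\ open V, V x, V `<=` U & dual_sec V s]) ->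
  dual_sec U s.
Proof.
move=> oU H W u oW WU su y Wy; have [V [oV Vy VU sV]] := H y (WU _ Wy).
have oVW : open (V `&` W) by exact: openI.
have uVW : sec (V `&` W) u.
  by apply: sec_sub su; [exact: oW|exact: oVW|move=> ? []].
by apply: (sV _ u oVW _ uVW) => // ? [].
Qed.

Lemma dual_triv x : exists (U : set X) (V : vectType C)
    (phi : forall y, 'Hom(V, dualsp (stalk L y))),
  [/\ open U, U x, forall y, U y -> bijective (phi y)
    & forall (W : set X) s, open W -> W `<=` U ->
      (dual_sec W s <->
       forall y, W y -> exists v, \forall z \near y, s z = phi z v)].
Proof.
have [U [V [phi [oU Ux phib trivU]]]] := ls_triv L x.
have phiV y : U y -> ((phi y)^-1 \o phi y = \1)%VF.
  by move=> Uy; apply: lfun_bij_Vf; exact: phib.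
exists U, (dualsp V), (fun y => precomp C^o (phi y)^-1); split => //.
  move=> y Uy; apply: precomp_bij; exists (phi y) => v; rewrite -comp_lfunE.
    by rewrite (lfun_bij_fV (phib y Uy)) id_lfunE.
  by rewrite phiV // id_lfunE.
move=> W s oW WU; split=> [sW y Wy|sW A t oA AW tA y Ay].
- pose e := vbasis {:V}; exists (s y \o phi y)%VF.
  have near_e (i : 'I_(\dim {:V})) :
      \forall z \near y, s z (phi z e`_i) = s y (phi y e`_i).
    apply: (sW W (fun z => phi z e`_i)) => //.
    by apply: (trivU W _ oW WU).2 => z Wz; exists e`_i; apply: nearW.
  have Wn : nbhs y W by apply: open_nbhs_nbhs.
  have near_all := @filter_forall _ _ _ _ _ near_e.
  near=> z; have Wz : W z by near: z.
  have E : forall i : 'I_(\dim {:V}), s z (phi z e`_i) = s y (phi y e`_i).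
    by near: z; exact: near_all.
  have -> : (s y \o phi y = s z \o phi z)%VF.
    apply/lfunP => v; rewrite !comp_lfunE (coord_vbasis (memvf v)) !linear_sum.
    by apply: eq_bigr => i _; rewrite !linearZ; congr (_ *: _); exact/esym/E.
  rewrite precompE -comp_lfunA (lfun_bij_fV (phib z (WU _ Wz))).
  by rewrite comp_lfun1r.
- have AU : A `<=` U by exact: subset_trans AW WU.
  have [v tv] := (trivU A t oA AU).1 tA y Ay.
  have [h sh] := sW y (AW _ Ay).
  have E : \forall z \near y, s z (t z) = h v.
    have An : nbhs y A by apply: open_nbhs_nbhs.
    near=> z; have -> : s z = precomp C^o (phi z)^-1 h by near: z.
    have -> : t z = phi z v by near: z.
    rewrite precompE -comp_lfunE -comp_lfunA phiV ?comp_lfun1r //.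
    by apply: AU; near: z.
  by rewrite (nbhs_singleton E).
Unshelve. all: by end_near. Qed.

Definition dual : local_system R X :=
  LocalSystem dual_restrict dual_glue dual_triv.

End Dual.

Section Tensor.
Variables (X : topologicalType) (K L : local_system R X).

(* Sections of the tensor product: locally finite sums of pure tensors of
   sections. *)
Definition tensor_sec (U : set X)
    (s : forall x, tensorsp (stalk K x) (stalk L x)) : Prop :=
  forall x, U x -> exists (V : set X) (m : nat)
      (t : 'I_m -> forall y, stalk K y) (u : 'I_m -> forall y, stalk L y),
    [/\ open V /\ V x, forall i, sec V (t i), forall i, sec V (u i)
      & forall y, V y -> s y = \sum_i pure (t i y) (u i y)].

Lemma tensor_restrict (U V : set X) s t : open U -> open V -> V `<=` U ->
  tensor_sec U s -> (forall x, V x -> t x = s x) -> tensor_sec V t.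
Proof.
move=> oU oV VU sU ts x Vx; have [W [m [a [b [[oW Wx] sa sb e]]]]] := sU x (VU _ Vx).
have oVW : open (V `&` W) by exact: openI.
exists (V `&` W), m, a, b; split => //.
- by move=> i; apply: sec_sub (sa i); [exact: oW|exact: oVW|move=> ? []].
- by move=> i; apply: sec_sub (sb i); [exact: oW|exact: oVW|move=> ? []].
- by move=> y [Vy Wy]; rewrite ts // e.
Qed.

Lemma tensor_glue (U : set X) s : open U ->
  (forall x, U x -> exists V, [/\ open V, V x, V `<=` U & tensor_sec V s]) ->
  tensor_sec U s.
Proof. by move=> oU H x /H[V [oV Vx _ /(_ x Vx)]]. Qed.

Lemma tensor_triv x : exists (U : set X) (V : vectType C)
    (phi : forall y, 'Hom(V, tensorsp (stalk K y) (stalk L y))),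
  [/\ open U, U x, forall y, U y -> bijective (phi y)
    & forall (W : set X) s, open W -> W `<=` U ->
      (tensor_sec W s <->
       forall y, W y -> exists v, \forall z \near y, s z = phi z v)].
Proof.
have [U1 [V1 [f [oU1 Ux1 fb triv1]]]] := ls_triv K x.
have [U2 [V2 [g [oU2 Ux2 gb triv2]]]] := ls_triv L x.
exists (U1 `&` U2), (tensorsp V1 V2), (fun y => tensor_map (f y) (g y)).
split=> //; first exact: openI.
  by move=> y [U1y U2y]; apply: tensor_map_bij; [exact: fb|exact: gb].
move=> W s oW WU; split=> sW y Wy.
- have [A [m [t [u [[oA Ay] tA uA e]]]]] := sW y Wy.
  have oB : open (A `&` W) by exact: openI.
  have By : (A `&` W) y by [].
  have BU1 : A `&` W `<=` U1 by move=> z [_ /WU[]].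
  have BU2 : A `&` W `<=` U2 by move=> z [_ /WU[]].
  have BA : A `&` W `<=` A by move=> z [].
  have [v tv] := fin_all_exists (fun i =>
    (triv1 _ _ oB BU1).1 (sec_sub oA oB BA (tA i)) y By).
  have [w uw] := fin_all_exists (fun i =>
    (triv2 _ _ oB BU2).1 (sec_sub oA oB BA (uA i)) y By).
  exists (\sum_i pure (v i) (w i)).
  have An : nbhs y A by apply: open_nbhs_nbhs.
  have tv' := @filter_forall _ _ _ _ _ tv; have uw' := @filter_forall _ _ _ _ _ uw.
  near=> z; rewrite e; last by near: z.
  have tz : forall i, t i z = f z (v i) by near: z; exact: tv'.
  have uz : forall i, u i z = g z (w i) by near: z; exact: uw'.
  by rewrite tensor_map_sum; apply: eq_bigr => i _; rewrite tz uz.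
- have [T sT] := sW y Wy; have [m [v [w ET]]] := pure_span T.
  have : nbhs y (W `&` [set z | s z = tensor_map (f z) (g z) T]).
    by apply: filterI => //; apply: open_nbhs_nbhs.
  rewrite nbhsE => -[A [oA Ay] AW].
  exists A, m, (fun i z => f z (v i)), (fun i z => g z (w i)); split=> //.
  + move=> i; apply: (triv1 A _ oA _).2 => [z /AW[/WU[]]//|z Az].
    by exists (v i); apply: nearW.
  + move=> i; apply: (triv2 A _ oA _).2 => [z /AW[/WU[]]//|z Az].
    by exists (w i); apply: nearW.
  + by move=> z /AW[_ ->]; rewrite ET tensor_map_sum.
Unshelve. all: by end_near. Qed.

Definition tensor : local_system R X :=
  LocalSystem tensor_restrict tensor_glue tensor_triv.

End Tensor.

Section TensorFunctor.
Variables (X : topologicalType) (K : local_system R X).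

Definition tensor_mor_fun (L M : local_system R X) (f : ls_hom L M) x :
    'Hom(stalk (tensor K L) x, stalk (tensor K M) x) :=
  tensor_map \1%VF (f x).

Lemma tensor_mor_funE L M (f : ls_hom L M) x T :
  tensor_mor_fun f x T = (f x \o T)%VF.
Proof.
apply/lfunP => h; rewrite /tensor_mor_fun tensor_mapE !comp_lfunE precompE.
by rewrite comp_lfun1r.
Qed.

Lemma tensor_mor_sec L M (f : ls_hom L M) (U : set X)
  (s : forall x, stalk (tensor K L) x) :
  open U -> sec U s -> sec U (fun x => tensor_mor_fun f x (s x)).
Proof.
move=> oU sU x Ux; have [V [m [t [u [[oV Vx] tV uV e]]]]] := sU x Ux.
exists V, m, t, (fun i y => f y (u i y)); split=> // [i|y Vy].
  exact: mor_sec.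
rewrite e // /tensor_mor_fun tensor_map_sum.
by apply: eq_bigr => i _; rewrite id_lfunE.
Qed.

Definition tensor_mor (L M : LS X) (f : hom L M) :
    @hom (LS X) (tensor K L) (tensor K M) :=
  @LsHom _ (tensor K L) (tensor K M)
    (tensor_mor_fun f) (@tensor_mor_sec L M f).

Lemma tensor_mor_id (L : LS X) :
  tensor_mor (idm L) = @idm (LS X) (tensor K L).
Proof.
apply: ls_hom_eq => x; apply/lfunP => T.
by rewrite [LHS]tensor_mor_funE /= comp_lfun1l id_lfunE.
Qed.

Lemma tensor_mor_comp (L M N : LS X) (g : hom M N) (f : hom L M) :
  tensor_mor (comp g f) = comp (tensor_mor g) (tensor_mor f).
Proof.
apply: ls_hom_eq => x; apply/lfunP => T.
by rewrite /= comp_lfunE !tensor_mor_funE comp_lfunA.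
Qed.

Definition tensor_functor : functor (LS X) (LS X) :=
  @Functor (LS X) (LS X) (fun L => tensor K L) tensor_mor
    tensor_mor_id tensor_mor_comp.

End TensorFunctor.

Lemma continuous_set_val (S T : topologicalType) (A : set T) (f : S -> A) :
  continuous (fun x => set_val (f x)) -> continuous f.
Proof. exact: (@continuous_comp_initial _ _ _ (@set_val T A)). Qed.

Section Restriction.
Variables (T : topologicalType) (A B : set T) (AB : A `<=` B).

Definition incl (a : A) : B :=
  exist _ (set_val a) (mem_set (AB (set_valP a))).

Lemma incl_continuous : continuous incl.
Proof. by apply: continuous_set_val; exact: initial_continuous. Qed.

Definition restr (L : local_system R B) : local_system R A :=
  pullback L incl_continuous.

End Restriction.

(* Continuation along c, from time 0 to time 1, multiplies by a.  A global
   section of the inverse image by c : R -> X is a continuation along c of its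
   value at time 0; the equality takes place in the total space of the stalks,
   as c 1 and c 0 are only propositionally equal. *)
Definition monodromy_scalar (X : topologicalType) (L : local_system R X)
    (c : R -> X) (a : C) : Prop :=
  forall s : (forall t, stalk L (c t)), along setT s ->
    existT (stalk L) (c 1) (s 1) = existT (stalk L) (c 0) (a *: s 0).

End LocalSystems.

Inductive puncture (l : nat) : Type :=
  p_zero | p_root of 'I_l | p_infty.
Arguments p_zero {l}.
Arguments p_infty {l}.

Section Geometry.
Variables (R : realType) (n k l : nat) (Cf : 'I_l -> Cx R).
Local Notation C := (Cx R).
Local Open Scope complex_scope.

Definition curve_complement : set (C * C) :=
  [set p | p.1 * p.2 * \prod_(i < l) (p.2 ^+ k - Cf i * p.1 ^+ n) != 0].

Definition P1 : topologicalType := one_point_compactification C.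

Definition puncture_pt (j : puncture l) : P1 :=
  match j with
  | p_zero => Some 0
  | p_root i => Some (Cf i)
  | p_infty => None
  end.

Definition punctured_line : set P1 := ~` range puncture_pt.

Definition slope (p : C * C) : C := p.2 ^+ k / p.1 ^+ n.

Lemma curve_complementP (p : C * C) : curve_complement p ->
  [/\ p.1 != 0, p.2 != 0 & forall i, slope p != Cf i].
Proof.
rewrite /curve_complement /= !mulf_eq0 !negb_or => /andP[/andP[x0 y0] pr].
split=> // i; apply: contra pr => /eqP E; apply/prodf_eq0; exists i => //.
by rewrite -E /slope divfK ?subrr // expf_neq0.
Qed.

Lemma slope_punctured (p : C * C) :
  curve_complement p -> punctured_line (Some (slope p)).
Proof.
case/curve_complementP => x0 y0 pr [[|i|] _] //= [E].
- by move/eqP: E; rewrite eq_sym mulf_eq0 invr_eq0 !expf_eq0 (negbTE x0) (negbTE y0) !andbF.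
- by move: (pr i); rewrite E eqxx.
Qed.

Definition gamma (p : curve_complement) : punctured_line :=
  exist _ (Some (slope (set_val p))) (mem_set (slope_punctured (set_valP p))).

Lemma expr_continuous m : continuous (fun z : C => z ^+ m).
Proof.
move=> x; elim: m => [|m IH]; first exact: cst_continuous.
have -> : (fun z : C => z ^+ m.+1) = (fun z => z * z ^+ m).
  by apply/funext => z; rewrite exprS.
by apply: (@cvgM _ _ (nbhs x) _ id (fun z => z ^+ m)); [exact: cvg_id|exact: IH].
Qed.

Lemma gamma_continuous : continuous gamma.
Proof.
apply: continuous_set_val => p /=.
have [x0 _ _] := curve_complementP (set_valP p).
have cv : {for p, continuous (@set_val _ curve_complement)}.
  exact: initial_continuous.
have c1 : (set_val q).1 @[q --> p] --> (set_val p).1.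
  exact: (cvg_comp _ _ cv (@cvg_fst _ _ _ _ _)).
have c2 : (set_val q).2 @[q --> p] --> (set_val p).2.
  exact: (cvg_comp _ _ cv (@cvg_snd _ _ _ _ _)).
have : slope (set_val q) @[q --> p] --> slope (set_val p).
  have p2 : (set_val q).2 ^+ k @[q --> p] --> (set_val p).2 ^+ k.
    exact: (cvg_comp _ _ c2 (@expr_continuous k _)).
  have p1 : (set_val q).1 ^+ n @[q --> p] --> (set_val p).1 ^+ n.
    exact: (cvg_comp _ _ c1 (@expr_continuous n _)).
  by apply: cvgM p2 (cvgV _ p1); rewrite expf_neq0.
by move=> cs; apply: (cvg_comp _ _ cs); exact: one_point_compactification_some_continuous.
Qed.

(* t |-> exp (2 pi i t) *)
Definition unit_loop (t : R) : C := cos (2 * pi * t) +i* sin (2 * pi * t).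

(* The homotopy class delta: the loop t |-> (e(kt) x, e(nt) y) generates the
   fundamental group of the fiber of gamma through (x, y). *)
Definition delta_loop (p : C * C) (t : R) : C * C :=
  (unit_loop (k%:R * t) * p.1, unit_loop (n%:R * t) * p.2).

Definition scalar_along_fibers (eps : C)
    (L : local_system R curve_complement) : Prop :=
  forall (p : curve_complement) (c : R -> curve_complement),
    (forall t, set_val (c t) = delta_loop (set_val p) t) ->
    monodromy_scalar L c eps.

Definition Sigma (eps : C) : category :=
  @full_subcategory (LS R curve_complement) (scalar_along_fibers eps).

(* In the chart z of the affine line, a disc around infinity is the exterior
   of a disc. *)
Definition closed_disc (a : P1) (rho : R) : set P1 :=
  match a with
  | Some w => [set Some z | z in [set z : C | `|z - w| <= rho%:C]]
  | None => [set None] `|` [set Some z | z in [set z : C | rho%:C <= `|z|]]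
  end.

Definition disc_boundary (a : P1) (rho : R) : set P1 :=
  match a with
  | Some w => [set Some z | z in [set z : C | `|z - w| = rho%:C]]
  | None => [set Some z | z in [set z : C | `|z| = rho%:C]]
  end.

Record disc_system := DiscSystem {
  disc_rad : puncture l -> R;
  disc_rad_gt0 : forall j, 0 < disc_rad j;
  disc_disjoint : forall i j, i <> j ->
    closed_disc (puncture_pt i) (disc_rad i) `&`
    closed_disc (puncture_pt j) (disc_rad j) = set0 }.

Definition disc_circle (d : disc_system) (j : puncture l) : set P1 :=
  disc_boundary (puncture_pt j) (disc_rad d j).

Lemma disc_circle_sub d j : disc_circle d j `<=` punctured_line.
Proof.
have bd a rho : disc_boundary a rho `<=` closed_disc a rho.
  case: a => [w|] z [u /= E <-]; first by exists u => //=; rewrite E.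
  by right; exists u => //=; rewrite E.
have center i : closed_disc (puncture_pt i) (disc_rad d i) (puncture_pt i).
  have h : 0 <= (disc_rad d i)%:C by rewrite (lecR 0) ltW // disc_rad_gt0.
  case: i h => [|i|] h /=; [by exists 0; rewrite //= subrr normr0 | |by left].
  by exists (Cf i); rewrite //= subrr normr0.
move=> z Bz [i _ Ei]; have [ij|ij] := pselect (i = j).
- subst i; move: Bz; rewrite -Ei /disc_circle.
  have h : (disc_rad d j)%:C != 0 by rewrite gt_eqF // (ltcR 0) disc_rad_gt0.
  case: j h {Ei} => [|i|] h /= [u /= uE E] //; case: E uE => ->;
    by rewrite subrr normr0 => /esym/eqP; apply/negP.
- have := disc_disjoint d ij; rewrite -subset0; apply; split.
    exact: center.
  by rewrite Ei; exact: bd.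
Qed.

Definition same_data_line (d : disc_system)
    (F G : local_system R punctured_line) : Prop :=
  forall j, @isomorphic (LS R (disc_circle d j))
    (restr (@disc_circle_sub d j) F) (restr (@disc_circle_sub d j) G).

Definition rigid_line (d : disc_system) (F : LS R punctured_line) : Prop :=
  forall G : LS R punctured_line, same_data_line d G F -> isomorphic G F.

Definition semirigid_line (d : disc_system) (F : LS R punctured_line) : Prop :=
  exists (m : nat) (G : 'I_m -> LS R punctured_line),
    forall H : LS R punctured_line, same_data_line d H F ->
      exists i, isomorphic H (G i).

(* The thin tubes are the standard ones: in the torus |x| = rho1, the tube N_0
   is |y| <= rad and, for a root C_i, N_i is the preimage by y^k/x^n of a
   closed disc around C_i.  The value of the radius function at infinity is
   the outer radius rho2, so that N_infty is |x| = rho1, |y| <= rho2. *)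
Definition tube_coord (j : puncture l) (p : C * C) : C :=
  match j with
  | p_root i => slope p - Cf i
  | _ => p.2
  end.

Definition tube (rho1 : R) (rad : puncture l -> R) (j : puncture l) :=
  [set p : C * C | `|p.1| = rho1%:C /\ `|tube_coord j p| <= (rad j)%:C].

Definition tube_interior (rho1 : R) (rad : puncture l -> R) (j : puncture l) :=
  [set p : C * C | `|p.1| = rho1%:C /\ `|tube_coord j p| < (rad j)%:C].

Record tube_system := TubeSystem {
  rho1 : R;
  rad : puncture l -> R;
  rho1_gt0 : 0 < rho1;
  rad_gt0 : forall j, 0 < rad j;
  tube_disjoint : forall i j, i <> p_infty -> j <> p_infty -> i <> j ->
    tube rho1 rad i `&` tube rho1 rad j = set0;
  tube_inside : forall i, i <> p_infty ->
    tube rho1 rad i `<=` tube_interior rho1 rad p_infty }.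

Definition turbine (w : tube_system) : set (C * C) :=
  tube (rho1 w) (rad w) p_infty `\`
  \bigcup_(j in [set j | j <> p_infty]) tube_interior (rho1 w) (rad w) j.

Definition tube_boundary (w : tube_system) (j : puncture l) : set (C * C) :=
  [set p | `|p.1| = (rho1 w)%:C /\ `|tube_coord j p| = (rad w j)%:C].

Lemma turbine_sub w : turbine w `<=` curve_complement.
Proof.
move=> p [[x1 _] H].
have r1 : (rho1 w)%:C != 0 by rewrite gt_eqF // (ltcR 0) rho1_gt0.
have x0 : p.1 != 0 by rewrite -normr_eq0 x1.
have tc j : j <> p_infty -> tube_coord j p != 0.
  move=> jo; apply/negP => /eqP E; apply: H; exists j => //; split => //.
  by rewrite E normr0 (ltcR 0) rad_gt0.
have y0 : p.2 != 0 by exact: (tc p_zero).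
rewrite /curve_complement /= !mulf_neq0 //; apply/prodf_neq0 => i _.
have ti : tube_coord (p_root i) p != 0 by exact: tc.
apply: contra ti; rewrite subr_eq0 => /eqP E.
by rewrite /= /slope E mulfK ?subrr // expf_neq0.
Qed.

Lemma tube_boundary_sub w j : tube_boundary w j `<=` turbine w.
Proof.
move=> p [x1 Ej].
have tj : tube (rho1 w) (rad w) j p by split=> //; rewrite Ej.
have sub i : tube_interior (rho1 w) (rad w) i `<=` tube (rho1 w) (rad w) i.
  by move=> q [? /ltW].
split; last first.
  move=> [i io ti]; have [ij|ij] := pselect (i = j).
    by move: ti => [_]; rewrite ij Ej ltxx.
  have [jo|jo] := pselect (j = p_infty).
    by move: (tube_inside io (sub _ _ ti)) => [_]; rewrite -jo Ej ltxx.
  have := tube_disjoint w io jo ij; rewrite -subset0 => /(_ p); apply.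
  by split; [exact: sub ti|exact: tj].
have [jo|jo] := pselect (j = p_infty); first by rewrite -jo.
exact/sub/(tube_inside jo).
Qed.

Definition same_data_turbine (w : tube_system)
    (L M : local_system R (turbine w)) : Prop :=
  forall j, @isomorphic (LS R (tube_boundary w j))
    (restr (@tube_boundary_sub w j) L) (restr (@tube_boundary_sub w j) M).

Definition to_turbine (w : tube_system) (L : local_system R curve_complement) :
    LS R (turbine w) := restr (@turbine_sub w) L.

Definition rigid_complement (w : tube_system)
    (L : local_system R curve_complement) : Prop :=
  forall M : LS R (turbine w), same_data_turbine M (to_turbine w L) ->
    isomorphic M (to_turbine w L).

Definition semirigid_complement (w : tube_system)
    (L : local_system R curve_complement) : Prop :=
  exists (m : nat) (G : 'I_m -> LS R (turbine w)),
    forall M : LS R (turbine w), same_data_turbine M (to_turbine w L) ->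
      exists i, isomorphic M (G i).

(* A loop on the boundary of N_i in a slice x = const which bounds a meridian
   disc of N_i. *)
Definition alpha_loop (w : tube_system) (i : 'I_l)
    (c : R -> curve_complement) : Prop :=
  [/\ continuous c,
      exists x0, `|x0| = (rho1 w)%:C /\ forall t, (set_val (c t)).1 = x0
    & forall t, slope (set_val (c t)) =
        Cf i + (rad w (p_root i))%:C * unit_loop t].

(* omega_0 = alpha_0^s beta_0^r, where on the boundary torus of N_0 the
   meridian alpha_0 rotates y and the parallel beta_0 rotates x. *)
Definition omega0_loop (r s : int) (w : tube_system)
    (c : R -> curve_complement) : Prop :=
  exists2 p, tube_boundary w p_zero p & forall t,
    set_val (c t) = (unit_loop (r%:~R * t) * p.1, unit_loop (s%:~R * t) * p.2).

(* These conditions hold for the inverse image, by (x, y) |-> y^r / x^s, of the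
   rank one local system on C^* whose monodromy around 0 is eps: when
   r n = k s + 1, that map winds once along delta, and has winding number 0
   along the alpha_i and omega_0. *)
Definition is_Keps (r s : int) (w : tube_system) (eps : C)
    (K : local_system R curve_complement) : Prop :=
  [/\ rank_one K,
      scalar_along_fibers eps K,
      forall i c, alpha_loop w i c -> monodromy_scalar K c 1
    & forall c, omega0_loop r s w c -> monodromy_scalar K c 1].

End Geometry.

(* Main.v *)
(* Transport along paths makes inverse images under homotopic maps naturally
   isomorphic.  The slope map [gamma] has a global section [sigma], because
   [(x, y) |-> (y^k / x^n, y^r / x^s)] has determinant -1; each point of the
   curve complement is reached from [sigma (gamma p)] by first changing [|x|]
   and then rotating by the circle action along the fiber.  If the monodromy
   along the fibers is trivial, continuation along this path does not depend on
   the angle of rotation and identifies a local system [L] with the inverse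
   image of [sigma^* L] under [gamma].  Applied to [K^-1 (x) L], this gives the
   functor, with quasi-inverse [F |-> K (x) gamma^* F].
   The same descent holds on the turbine: there the section is composed with
   the radial retraction of the punctured line onto the complement of the discs.
   The slope maps each boundary torus onto a circle around a puncture, with a
   section, so boundary data correspond.  A local system with the boundary data
   of [L] has monodromy [eps] along all fibers, since every point of the turbine
   can be moved into the boundary, towards the nearest puncture. *)
Require Import Defs.
From HB Require Import structures.
From mathcomp Require Import all_boot all_order all_algebra.
From mathcomp Require Import all_classical all_reals all_analysis.
From mathcomp Require Import complex.
From mathcomp Require Import ring lra.
Import Order.TTheory GRing.Theory Num.Theory.
Import numFieldNormedType.Exports.
Import Defs.
Set Implicit Arguments.
Unset Strict Implicit.
Unset Printing Implicit Defensive.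
Local Open Scope classical_set_scope.
Local Open Scope ring_scope.
Local Open Scope complex_scope.

(** * Sections along maps *)

(** Local systems stay sheaves throughout and no fundamental group appears; every argument is about
    sections along a map ([flat_at]). Two facts drive the transport: whether two such sections agree
    is locally constant ([flat_eq_near]), and intervals admit induction by subdivision
    ([interval_ind]). Together they give unique continuation along paths, jointly continuous in
    parameters. Stalks over points that are only propositionally equal have different types, so the
    two ends of a loop are compared through [castS] or in the total space of the stalks. Rigidity
    quantifies over local systems on the turbine that are not given as restrictions from the curve
    complement. Descent is therefore proved for any rotation-stable subset of the complement
    satisfying a fiberwise condition, and applied twice. The discs of [d] and the images of the
    tubes of [w] share only their centers; radial homotopies in the punctured line absorb the
    difference of radii. *)

Lemma interval_ind (R : realType) (Q : R -> R -> Prop) :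
  (forall t, exists2 e : R, 0 < e & forall a b, t - e < a -> a <= b -> b < t + e -> Q a b) ->
  (forall a b c, a <= b -> b <= c -> Q a b -> Q b c -> Q a c) ->
  forall a b, a <= b -> Q a b.
Proof.
move=> Qloc Qcat a b ab.
have [e0 e0p Qa] := Qloc a.
(* Endpoints reached from [a]. The local hypothesis at [sup S] first shows that the supremum is
   reached, then that it can be exceeded unless it is [b]. *)
pose S := [set t | a <= t <= b /\ Q a t].
have Sa : S a.
  split; first by rewrite lexx.
  by apply: Qa => //; [rewrite ltrBlDr ltrDl|rewrite ltrDl].
have Sb : ubound S b by move=> t [/andP[]].
have hS : has_sup S by split; [exists a|exists b].
have supb : sup S <= b by apply: ge_sup => //; exists a.
have supa : a <= sup S by apply: ub_le_sup => //; exists b.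
have [e ep Qe] := Qloc (sup S).
have [t [/andP[t1 t2] Qt] tS] : exists2 t, S t & sup S - e < t.
  by apply: sup_adherent.
have tsup : t <= sup S by apply: ub_le_sup; [exists b|split=> //; rewrite t1].
have [supb'|bsup] := ltP (sup S) b; last first.
  have E : sup S = b by apply/eqP; rewrite eq_le supb.
  have := Qcat a t b t1 t2 Qt; apply; apply: Qe => //.
  by rewrite E ltrDl.
pose u := Num.min b (sup S + e / 2).
have u1 : sup S < u by rewrite lt_min supb' /= ltrDl divr_gt0.
have Qu : Q a u.
  have tu : t <= u by apply: le_trans tsup (ltW u1).
  apply: (Qcat a t u) => //; apply: Qe => //.
  by rewrite gt_min ltrD2l gtr_pMr // invf_lt1 // (ltr_nat _ 1 2) orbT.
suff : u <= sup S by rewrite leNgt u1.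
apply: ub_le_sup; first by exists b.
split=> //; apply/andP; split; last by rewrite ge_min lexx.
exact: le_trans supa (ltW u1).
Qed.

Lemma near_open (X : topologicalType) (x : X) (P : set X) :
  (\forall y \near x, P y) -> exists A, [/\ open A, A x & A `<=` P].
Proof. by rewrite /prop_near1 nbhsE => -[A [oA Ax] AP]; exists A. Qed.

Section Flat.
Variable R : realType.
Local Notation C := (Cx R).

(* The pointwise form of [along]; no openness is required of the domain. *)
Definition flat_at (Z X : topologicalType) (L : local_system R X) (h : Z -> X)
    (s : forall z, stalk L (h z)) (z : Z) : Prop :=
  exists (V : set X) (t : forall y, stalk L y),
    [/\ open V, V (h z), sec V t & \forall z' \near z, s z' = t (h z')].

Arguments flat_at {Z X} L h s z.

Section Basic.
Variables (X : topologicalType) (L : local_system R X).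

Lemma sec_flat (U : set X) (s : forall x, stalk L x) : open U ->
  sec U s <-> forall x, U x -> flat_at L id s x.
Proof.
move=> oU; split=> [sU x Ux|sU].
  by exists U, s; split=> //; apply: nearW.
apply: sec_glue => // x /[dup] Ux /sU[V [t [oV Vx tV st]]].
have [A [oA Ax AV]] := near_open st.
have oW : open (A `&` V `&` U) by exact/openI/oU/openI.
exists (A `&` V `&` U); split=> //.
have WV : A `&` V `&` U `<=` V by move=> ? [[]].
by apply: (sec_restrict oV oW WV tV) => z [[/AV /= ->]].
Qed.

Lemma section_through (x : X) (v : stalk L x) :
  exists (V : set X) (t : forall y, stalk L y),
    [/\ open V, V x, sec V t & t x = v].
Proof.
have [U [V [phi [oU Ux phib trivU]]]] := ls_triv L x.
have [g phiK gK] := phib _ Ux.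
exists U, (fun y => phi y (g v)); split => //.
by apply: (trivU U _ oU _).2 => // u Uu; exists (g v); apply: nearW.
Qed.

End Basic.

Section FlatMap.
Variables (Z X : topologicalType) (L : local_system R X) (h : Z -> X).
Implicit Types s : forall z, stalk L (h z).

Lemma flat_near s s' z : (\forall z' \near z, s z' = s' z') ->
  flat_at L h s z -> flat_at L h s' z.
Proof.
move=> ss [V [t [oV Vz tV st]]]; exists V, t; split=> //.
by near=> w; transitivity (s w); [apply/esym|]; near: w.
Unshelve. all: by end_near. Qed.

Section At.
Variable z : Z.
Hypothesis ch : {for z, continuous h}.

Lemma flat_trivial s s' : flat_at L h s z -> flat_at L h s' z ->
  exists (V : vectType C) (phi : forall y, 'Hom(V, stalk L y)) (v v' : V),
    \forall w \near z, [/\ bijective (phi (h w)), s w = phi (h w) v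
      & s' w = phi (h w) v'].
Proof.
have [U [V [phi [oU Uz phib trivU]]]] := ls_triv L (h z).
have E u : flat_at L h u z -> exists v, \forall w \near z, u w = phi (h w) v.
  move=> [A [t [oA Az tA ut]]].
  have tAU : sec (A `&` U) t.
    by apply: (sec_sub oA (openI oA oU) _ tA) => ? [].
  have AU : A `&` U `<=` U by move=> ? [].
  have [v tv] := (trivU _ _ (openI oA oU) AU).1 tAU (h z) (conj Az Uz).
  exists v; have tv' : \forall w \near z, t (h w) = phi (h w) v by exact: ch tv.
  by near=> w; transitivity (t (h w)); near: w.
move=> /E[v sv] /E[v' sv']; exists V, phi, v, v'.
have Un : \forall w \near z, U (h w) by apply: ch; exact: open_nbhs_nbhs.
by near=> w; split; [apply: phib|..]; near: w.
Unshelve. all: by end_near. Qed.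

(** In a common trivialization both sections are constant vectors, so near [z] they agree everywhere
    or nowhere. The equivalence lets both equality and inequality spread from a point. *)
Lemma flat_eq_near s s' : flat_at L h s z -> flat_at L h s' z ->
  \forall w \near z, (s w = s' w <-> s z = s' z).
Proof.
move=> fs fs'; have [V [phi [v [v' H]]]] := flat_trivial fs fs'.
have [b1 e1 e2] := nbhs_singleton H.
near=> w; have [b2 e3 e4] : [/\ bijective (phi (h w)), s w = phi (h w) v
      & s' w = phi (h w) v'] by near: w.
rewrite e1 e2 e3 e4; split=> [/(bij_inj b2)|/(bij_inj b1)] -> //.
Unshelve. all: by end_near. Qed.

Lemma flat_lin a s s' : flat_at L h s z -> flat_at L h s' z ->
  flat_at L h (fun w => a *: s w + s' w) z.
Proof.
move=> [A [t [oA Az tA ut]]] [B [t' [oB Bz tB ut']]].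
exists (A `&` B), (fun y => a *: t y + t' y); split=> //; first exact: openI.
  have oAB : open (A `&` B) by exact: openI.
  apply/(sec_flat _ oAB) => x [Ax Bx].
  have [U [V [phi [oU Ux phib trivU]]]] := ls_triv L x.
  have oAU : open (A `&` B `&` U) by exact: openI.
  have AU : A `&` B `&` U `<=` U by move=> ? [].
  exists (A `&` B `&` U), (fun y => a *: t y + t' y); split=> //; last exact: nearW.
  apply/(trivU _ _ oAU AU) => y [[Ay By] Uy].
  have [v tv] : exists v, \forall w \near y, t w = phi w v.
    apply: (trivU _ _ oAU AU).1 => //.
    by apply: (sec_sub oA oAU _ tA) => ? [[]].
  have [v' tv'] : exists v, \forall w \near y, t' w = phi w v.
    apply: (trivU _ _ oAU AU).1 => //.
    by apply: (sec_sub oB oAU _ tB) => ? [[]].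
  exists (a *: v + v'); near=> w; rewrite linearP; congr (_ *: _ + _).
    by near: w.
  by near: w.
by near=> w; congr (_ *: _ + _); near: w.
Unshelve. all: by end_near. Qed.

End At.

Lemma flat_mor (M : local_system R X) (f : ls_hom L M) s z :
  flat_at L h s z -> flat_at M h (fun w => f (h w) (s w)) z.
Proof.
move=> [V [t [oV Vz tV st]]]; exists V, (fun y => f y (t y)); split=> //.
  exact: mor_sec.
by near=> w; congr (f _ _); near: w.
Unshelve. all: by end_near. Qed.

Lemma flat_comp (W : topologicalType) (g : W -> Z) s w :
  {for w, continuous g} -> flat_at L h s (g w) ->
  flat_at L (h \o g) (fun w => s (g w)) w.
Proof.
move=> cg [V [t [oV Vz tV st]]]; exists V, t; split=> //.
by have := cg _ st.
Qed.

End FlatMap.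

(** Iterated inverse images reduce to sections of [L] itself along the composite map, where all the
    local arguments take place. *)
Lemma flat_pullback (W Z X : topologicalType) (L : local_system R X) (h : Z -> X)
  (ch : continuous h) (g : W -> Z) (cg : continuous g) s w :
  flat_at (pullback L ch) g s w <-> flat_at L (h \o g) s w.
Proof.
split=> [[V [t [oV Vw tV st]]]|[V [t [oV Vw tV st]]]].
  apply: (@flat_near _ _ _ (h \o g) (fun w => t (g w))).
    by near=> w'; apply/esym; near: w'.
  by apply: (@flat_comp _ _ _ h); [exact: cg|exact: tV].
exists (h @^-1` V), (fun z => t (h z)); split=> //.
  by apply: open_comp => // ? _; exact: ch.
by move=> z Vz; exists V, t; split=> //; exact: nearW.
Unshelve. all: by end_near. Qed.

Lemma flat_hom (X : topologicalType) (L M : local_system R X)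
  (f : forall x, 'Hom(stalk L x, stalk M x)) :
  (forall s x, flat_at L id s x -> flat_at M id (fun y => f y (s y)) x) ->
  exists g : ls_hom L M, forall x, g x = f x.
Proof.
move=> H.
suff S : forall (U : set X) s, open U -> sec U s -> sec U (fun x => f x (s x)).
  by exists (LsHom S).
move=> U s oU sU; apply/(sec_flat _ oU) => x Ux; apply: H.
by move/(sec_flat _ oU): sU; apply.
Qed.

(** Through the inverse image of [s x] there is a section [t]; its image under [f] agrees with [s]
    at [x], hence near [x], so the inverse image of [s] is [t] there. *)
Lemma ls_bij_inverse (X : topologicalType) (L M : local_system R X)
  (f : ls_hom L M) : (forall x, bijective (f x)) ->
  exists g : ls_hom M L, forall x, g x = (f x)^-1%VF.
Proof.
move=> bf; apply: flat_hom => s x fs.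
have [V [t [oV Vx tV tx]]] := section_through ((f x)^-1%VF (s x)).
have ft : flat_at L id t x by exists V, t; split=> //; exact: nearW.
have E : \forall y \near x, f y (t y) = s y.
  have := @flat_eq_near _ _ _ id x (@cvg_id _ _) _ _ (flat_mor f ft) fs.
  apply: filterS => y -> /=.
  by rewrite tx -comp_lfunE (lfun_bij_fV (bf x)) id_lfunE.
apply: flat_near ft; near=> y.
have <- : f y (t y) = s y by near: y.
by rewrite -comp_lfunE (lfun_bij_Vf (bf y)) id_lfunE.
Unshelve. all: by end_near. Qed.

Lemma ls_bij_iso (X : topologicalType) (L M : LS R X)
  (f : hom L M) : (forall x, bijective (mor f x)) ->
  exists g : hom M L, comp g f = idm L /\ comp f g = idm M.
Proof.
move=> bf; have [g gE] := ls_bij_inverse bf; exists g.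
by split; apply: ls_hom_eq => x /=; rewrite gE ?(lfun_bij_fV (bf x)) ?(lfun_bij_Vf (bf x)).
Qed.

End Flat.
Arguments flat_at {R Z X} L h s z.

(** * Continuation along paths *)

Section Cast.
Variables (R : realType) (X : topologicalType) (L : local_system R X).

(** A loop ends at a point only propositionally equal to its start. This cast compares the two
    stalks linearly, while equality in the total space compares them without mentioning a proof of
    equality. *)
Definition castS x y (e : x = y) : 'Hom(stalk L x, stalk L y) :=
  match e in _ = y return 'Hom(stalk L x, stalk L y) with erefl => \1%VF end.

Lemma castS_id x (e : x = x) v : castS e v = v.
Proof. by rewrite (Prop_irrelevance e erefl) id_lfunE. Qed.

Lemma castS_sec x y (e : x = y) (t : forall x, stalk L x) : castS e (t x) = t y.
Proof. by subst y; rewrite castS_id. Qed.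

Lemma castS_bij x y (e : x = y) : bijective (castS e).
Proof. by subst y; exists id => v; rewrite castS_id. Qed.

Lemma castS_existT x y (e : x = y) u v :
  existT (stalk L) y v = existT (stalk L) x u <-> v = castS e u.
Proof.
split=> [E|->]; last by subst y; rewrite castS_id.
(* The equation can be substituted only when both pairs are variables; the remaining cast along a
   loop is removed by proof irrelevance. *)
have H (p q : {x & stalk L x}) : p = q -> forall e : projT1 p = projT1 q,
    projT2 q = castS e (projT2 p) by move=> -> e'; rewrite castS_id.
exact: (H (existT (stalk L) x u) (existT (stalk L) y v) (esym E)).
Qed.

End Cast.

Lemma castS_mor (R : realType) (X : topologicalType) (L M : local_system R X)
  (f : ls_hom L M) x y (e : x = y) v : f y (castS L e v) = castS M e (f x v).
Proof. by subst y; rewrite !castS_id. Qed.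

Section Paths.
Variables (R : realType) (X : topologicalType) (L : local_system R X).

Lemma flat_path_unique (c : R -> X) (s s' : forall t, stalk L (c t)) a b :
  continuous c -> a <= b ->
  (forall t, a <= t <= b -> flat_at L c s t) ->
  (forall t, a <= t <= b -> flat_at L c s' t) -> s a = s' a <-> s b = s' b.
Proof.
move=> cc ab fs fs'.
pose Q x y := a <= x -> y <= b -> (s x = s' x <-> s y = s' y).
suff : Q a b by apply.
apply: interval_ind ab; last first.
  move=> x y z xy yz Qxy Qyz ax zb.
  by rewrite Qxy ?Qyz // ?(le_trans ax) ?(le_trans yz).
move=> t; have [tab|tab] := boolP (a <= t <= b).
  have := flat_eq_near (cc t) (fs t tab) (fs' t tab).
  move=> /nbhs_ballP[e /= e0 eE]; exists e => // x y tx xy ye _ _.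
  have xb : ball t e x.
    by rewrite /ball /= ltr_norml ltrBlDr ltrBDr; move: tx xy ye; lra.
  have yb : ball t e y.
    by rewrite /ball /= ltr_norml ltrBlDr ltrBDr; move: tx xy ye; lra.
  by rewrite (eE x xb) (eE y yb).
(* At a time outside [[a, b]] the radius is the distance to that interval, which makes [Q]
   vacuous. *)
move: tab; rewrite negb_and -!ltNge => /orP[ta|bt].
  exists (a - t); first lra.
  by move=> x y _ xy yt ax; exfalso; move: xy yt ax; lra.
exists (t - b); first lra.
by move=> x y xt xy _ _ yb; exfalso; move: xt xy yb; lra.
Qed.

Section Box.
Variables (Z : topologicalType) (H : Z -> R -> X).
Hypothesis cH : continuous (fun p : Z * R => H p.1 p.2).
Let hp (p : Z * R) : X := H p.1 p.2.
Let chp p : {for p, continuous hp}. Proof. exact: cH. Qed.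

(** A tube lemma: the neighbourhood [A] of [z0] works for all times in [[a, b]]. The value is
    prescribed at an arbitrary time [t], not at an endpoint, so that concatenation can extend a
    section in either direction. *)
Lemma flat_box z0 a b : a <= b -> forall t (v : stalk L (H z0 t)), a <= t <= b ->
  exists (A : set Z) (s : forall p, stalk L (hp p)),
    [/\ nbhs z0 A, forall z t', A z -> a <= t' <= b -> flat_at L hp s (z, t')
      & s (z0, t) = v].
Proof.
move: a b; apply: interval_ind.
  move=> t0; have [U [V [phi [oU Ux phib trivU]]]] := ls_triv L (H z0 t0).
  have : nbhs (z0, t0) (hp @^-1` U) by apply: cH; exact: open_nbhs_nbhs.
  case=> -[A B] /= [nA nB] AB.
  have [e /= e0 eB] := (nbhs_ballP _ _).1 nB.
  exists e => // a b ta ab bt t v /andP[at_ tb].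
  have inB y : a <= y <= b -> B y.
    move=> /andP[ay yb]; apply: eB.
    by rewrite /ball /= ltr_norml ltrBlDr ltrBDr; move: ta bt ay yb; lra.
  have Ut : U (H z0 t).
    apply: (AB (z0, t)); split=> /=; first exact: nbhs_singleton.
    by apply: inB; rewrite at_.
  have [g phiK gK] := phib _ Ut.
  exists A, (fun p => phi (hp p) (g v)); split => //.
  move=> z t' Az /inB Bt'.
  exists U, (fun x => phi x (g v)); split=> //; first exact: (AB (z, t')).
    by apply: (trivU U _ oU _).2 => // u Uu; exists (g v); apply: nearW.
  by apply: (@filterE _ (nbhs (z, t'))).
move=> a b c ab bc Qab Qbc t v /andP[at_ tc].
have glue A1 s1 A2 s2 : nbhs z0 A1 -> nbhs z0 A2 ->
    (forall z t', A1 z -> a <= t' <= b -> flat_at L hp s1 (z, t')) ->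
    (forall z t', A2 z -> b <= t' <= c -> flat_at L hp s2 (z, t')) ->
    s1 (z0, b) = s2 (z0, b) ->
    exists A, nbhs z0 A /\ forall z t', A z -> a <= t' <= c ->
      flat_at L hp (fun p => if p.2 < b then s1 p else s2 p) (z, t').
  move=> nA1 nA2 f1 f2 e12.
  have bab : a <= b <= b by rewrite ab lexx.
  have bbc : b <= b <= c by rewrite bc lexx.
  have := flat_eq_near (@chp (z0, b)) (f1 z0 b (nbhs_singleton nA1) bab)
    (f2 z0 b (nbhs_singleton nA2) bbc).
  (* The interior is taken so that the two sections agree near each [(z, b)] with [z] in the new
     neighbourhood, not merely at it; this makes the cut at time [b] flat. *)
  move=> /nbhs_interior[[A3 B3] /= [nA3 nB3] AB3].
  exists (A1 `&` A2 `&` A3); split; first exact/filterI/nA3/filterI.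
  move=> z t' [[A1z A2z] A3z] /andP[at' t'c].
  have c2 : {for (z, t'), continuous (@snd Z R)} by apply: cvg_snd.
  have [t'b|bt'|E] := ltgtP t' b.
  - apply: flat_near (f1 z t' A1z _); last by rewrite at' ltW.
    have : \forall p \near (z, t'), p.2 < b by exact: (c2 _ (lt_nbhsl t'b)).
    by apply: filterS => p ->.
  - apply: flat_near (f2 z t' A2z _); last by rewrite t'c ltW.
    have : \forall p \near (z, t'), b < p.2 by exact: (c2 _ (lt_nbhsr bt')).
    by apply: filterS => p pb; rewrite ltNge ltW.
  - subst t'; apply: flat_near (f2 z b A2z bbc).
    have := AB3 (z, b) (conj A3z (nbhs_singleton nB3)); apply: filterS => p pE.
    case: ifP => // _; apply/esym/pE; exact: e12.
(* The section is first built on the half containing [t]; its value at [(z0, b)] is then prescribed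
   for the other half. *)
have [tb|bt] := leP t b.
  have [A1 [s1 [nA1 f1 e1]]] := Qab t v (introT andP (conj at_ tb)).
  have [|A2 [s2 [nA2 f2 e2]]] := Qbc b (s1 (z0, b)); first by rewrite lexx.
  have [A [nA fA]] := glue _ _ _ _ nA1 nA2 f1 f2 (esym e2).
  exists A, (fun p => if p.2 < b then s1 p else s2 p); split=> //=.
  case: ltgtP tb => // E _; first by subst t; rewrite e2.
have [|A2 [s2 [nA2 f2 e2]]] := Qbc t v; first by rewrite (ltW bt).
have [|A1 [s1 [nA1 f1 e1]]] := Qab b (s2 (z0, b)); first by rewrite lexx ab.
have [A [nA fA]] := glue _ _ _ _ nA1 nA2 f1 f2 e1.
exists A, (fun p => if p.2 < b then s1 p else s2 p); split=> //=.
by rewrite ltNge ltW.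
Qed.

End Box.
End Paths.

Lemma continuous_pair (W Y Z : topologicalType) (f : W -> Y) (g : W -> Z) w :
  {for w, continuous f} -> {for w, continuous g} ->
  {for w, continuous (fun w => (f w, g w))}.
Proof. by move=> cf cg; exact: (cvg_pair cf cg). Qed.

Lemma continuous_pairl (Y Z : topologicalType) (t : Z) (w : Y) :
  {for w, continuous (fun w => (w, t))}.
Proof. by apply: continuous_pair; [exact: cvg_id|exact: cvg_cst]. Qed.

Lemma continuous_pairr (Y Z : topologicalType) (t : Y) (w : Z) :
  {for w, continuous (fun w => (t, w))}.
Proof. by apply: continuous_pair; [exact: cvg_cst|exact: cvg_id]. Qed.

Section Transport.
Variables (R : realType) (X : topologicalType) (L : local_system R X).

(** Boxes reach only compact intervals. The section over the whole line takes at [t] the value of a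
    section over an interval around [a] containing [t]; uniqueness makes the choices compatible. *)
Lemma flat_exists (c : R -> X) a (v : stalk L (c a)) : continuous c ->
  exists2 s : forall t, stalk L (c t), (forall t, flat_at L c s t) & s a = v.
Proof.
move=> cc.
have cH : continuous (fun p : R * R => c p.2).
  by move=> p; apply: (cvg_comp snd c); [exact: cvg_snd|exact: cc].
have ex (N : R) : 0 <= N -> exists s : forall t, stalk L (c t),
    (forall t, a - N <= t <= a + N -> flat_at L c s t) /\ s a = v.
  move=> N0.
  have [||A [s [nA fs sv]]] := @flat_box R X L R (fun _ => c) cH 0 (a - N) (a + N) _ a v.
  - lra.
  - by apply/andP; split; lra.
  exists (fun t => s (0, t)); split=> // t tN.
  apply: (@flat_comp _ _ _ L (fun p : R * R => c p.2) R (fun t => (0, t)) s t).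
    exact: continuous_pairr.
  by apply: fs => //; exact: nbhs_singleton.
(* With the margin 1, the interval of radius [N t + 1] contains every time at distance less than 1
   from [t], which gives flatness at [t]. *)
pose N t : R := `|t - a| + 1.
have N0 t : 0 <= N t by rewrite addr_ge0.
pose S t := sval (cid (ex (N t) (N0 t))).
have Sf t : (forall u, a - N t <= u <= a + N t -> flat_at L c (S t) u) /\ S t a = v.
  exact: (svalP (cid (ex (N t) (N0 t)))).
have Seq t M (s : forall t, stalk L (c t)) :
    (forall u, a - M <= u <= a + M -> flat_at L c s u) -> s a = v ->
    a - M <= t <= a + M -> S t t = s t.
  move=> fs sv /andP[tM1 tM2]; have [f1 e1] := Sf t.
  have tN : a - N t <= t <= a + N t.
    have := ler_norm (t - a); have := ler_norm (- (t - a)).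
    by rewrite normrN /N => n1 n2; apply/andP; split; lra.
  case/andP: tN => tN1 tN2.
  have [ta|/ltW at_] := leP t a.
    apply/(@flat_path_unique R X L c (S t) s t a cc ta); last by rewrite e1 sv.
      by move=> u /andP[u1 u2]; apply: f1; apply/andP; split; lra.
    by move=> u /andP[u1 u2]; apply: fs; apply/andP; split; lra.
  apply/(@flat_path_unique R X L c (S t) s a t cc at_); last by rewrite e1 sv.
    by move=> u /andP[u1 u2]; apply: f1; apply/andP; split; lra.
  by move=> u /andP[u1 u2]; apply: fs; apply/andP; split; lra.
exists (fun t => S t t); last by have [] := Sf a.
move=> t; have [|s [fs sv]] := ex (N t + 1); first by rewrite addr_ge0.
have tN : a - N t <= t <= a + N t.
  have := ler_norm (t - a); have := ler_norm (- (t - a)).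
  by rewrite normrN /N => n1 n2; apply/andP; split; lra.
case/andP: tN => tN1 tN2.
have ft : flat_at L c s t by apply: fs; apply/andP; split; lra.
apply: flat_near ft; apply/nbhs_ballP; exists 1 => //= u.
rewrite /ball /= ltr_norml => /andP[u1 u2].
apply/esym/(Seq u (N t + 1)) => //; apply/andP; split; lra.
Qed.

(** Continuation from time [a] to time [b]. The default 0 is never met when [c] is continuous; since
    [c] is arbitrary here, linearity is available only under the continuity hypothesis. *)
Definition trans_fun (c : R -> X) a b (v : stalk L (c a)) : stalk L (c b) :=
  if pselect (exists2 s : forall t, stalk L (c t),
    (forall t, flat_at L c s t) & s a = v) is left h then sval (cid2 h) b else 0.

Definition trans (c : R -> X) a b : 'Hom(stalk L (c a), stalk L (c b)) :=
  linfun (@trans_fun c a b).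

Section Trans.
Variables (c : R -> X).
Hypothesis cc : continuous c.

Lemma flat_unique (s s' : forall t, stalk L (c t)) a b :
  (forall t, flat_at L c s t) -> (forall t, flat_at L c s' t) ->
  s a = s' a -> s b = s' b.
Proof.
move=> fs fs' e; have [ab|/ltW ba] := leP a b.
  by apply/(@flat_path_unique R X L c s s' a b).
by apply/(@flat_path_unique R X L c s s' b a).
Qed.

Lemma trans_funE a b (s : forall t, stalk L (c t)) :
  (forall t, flat_at L c s t) -> trans_fun b (s a) = s b.
Proof.
move=> fs; rewrite /trans_fun; case: pselect => [h|[]]; last by exists s.
by case: (cid2 h) => s' fs' /= e; exact: (flat_unique b fs' fs e).
Qed.

Lemma trans_fun_linear a b : linear (@trans_fun c a b).
Proof.
move=> k u v.
have [s fs <-] := flat_exists u cc; have [s' fs' <-] := flat_exists v cc.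
rewrite (trans_funE a b fs) (trans_funE a b fs').
rewrite (@trans_funE a b (fun t => k *: s t + s' t)) // => t.
by apply: flat_lin; [exact: fs|exact: fs'].
Qed.

Lemma transE a b (s : forall t, stalk L (c t)) :
  (forall t, flat_at L c s t) -> trans c a b (s a) = s b.
Proof.
move=> fs.
(* The linear structure depends on the continuity of [c], so it is packed locally in order to
   evaluate [linfun]. *)
pose f := GRing.isLinear.Build _ _ _ _ (@trans_fun c a b) (@trans_fun_linear a b).
pose F : {linear stalk L (c a) -> stalk L (c b)} := HB.pack (@trans_fun c a b) f.
by rewrite /trans -[@trans_fun c a b]/(F : _ -> _) lfunE; exact: trans_funE.
Qed.

Lemma transK a b v : trans c b a (trans c a b v) = v.
Proof.
have [s fs <-] := flat_exists v cc.
by rewrite !transE.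
Qed.

Lemma trans_bij a b : bijective (trans c a b).
Proof. by exists (trans c b a) => v; exact: transK. Qed.

Lemma trans_flat a v t : flat_at L c (fun t => trans c a t v) t.
Proof.
have [s fs <-] := flat_exists v cc.
by apply: flat_near (fs t); near=> u; rewrite transE.
Unshelve. all: by end_near. Qed.

Lemma trans_id a v : trans c a a v = v.
Proof.
have [s fs <-] := flat_exists v cc.
by rewrite transE.
Qed.

(** Continuation depends only on the segment between the two times, so the sections supplied by
    [flat_box], flat on a compact interval only, compute [trans]. *)
Lemma trans_segment a b (s : forall t, stalk L (c t)) x y :
  x <= a <= y -> x <= b <= y ->
  (forall t, x <= t <= y -> flat_at L c s t) -> trans c a b (s a) = s b.
Proof.
move=> /andP[xa ay] /andP[xb yb] fs.
have fv := trans_flat (s a).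
have [ab|/ltW ba] := leP a b.
  have : trans c a a (s a) = s a by rewrite trans_id.
  move/(@flat_path_unique R X L c (fun t => trans c a t (s a)) s a b cc ab).
  apply=> [t _ //|t /andP[ta tb]]; apply: fs.
  by rewrite (le_trans xa) ?(le_trans tb).
have : trans c a a (s a) = s a by rewrite trans_id.
move/(@flat_path_unique R X L c (fun t => trans c a t (s a)) s b a cc ba).
apply=> [t _ //|t /andP[ta tb]]; apply: fs.
by rewrite (le_trans xb) ?(le_trans tb).
Qed.

End Trans.

Section Family.
Variables (Z : topologicalType) (H : Z -> R -> X).
Hypothesis cH : continuous (fun p : Z * R => H p.1 p.2).

Lemma slice_continuous1 z : continuous (H z).
Proof.
move=> t; apply: (@continuous_comp _ _ _ (fun t => (z, t)) (fun p : Z * R => H p.1 p.2)).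
  exact: continuous_pairr.
exact: cH.
Qed.

Lemma slice_continuous2 t : continuous (fun z => H z t).
Proof.
move=> z; apply: (@continuous_comp _ _ _ (fun z => (z, t)) (fun p : Z * R => H p.1 p.2)).
  exact: continuous_pairl.
exact: cH.
Qed.

(** A box section through [u z0] agrees with [u] at time [a] for all [z] near [z0], hence computes
    the continuation for all these [z] at once. *)
Lemma trans_flat_joint a b (u : forall z, stalk L (H z a)) z0 :
  flat_at L (fun z => H z a) u z0 ->
  flat_at L (fun p : Z * R => H p.1 p.2)
    (fun p => trans (H p.1) a p.2 (u p.1)) (z0, b).
Proof.
(* The margin 1 puts [a] and [b] inside the open interval, so the box is a neighbourhood of
   [(z0, b)]. *)
move=> fu; pose x := Num.min a b - 1; pose y := Num.max a b + 1.
have hx : x < a /\ x < b.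
  by rewrite /x; case: (leP a b) => ?; split; lra.
have hy : a < y /\ b < y.
  by rewrite /y; case: (leP a b) => ?; split; lra.
have [xa xb] := hx; have [ay yb] := hy.
have xay : x <= a <= y by rewrite !ltW.
have xby : x <= b <= y by rewrite !ltW.
have xy : x <= y by rewrite ltW // (lt_trans xa).
have [A [s [nA fs sv]]] := @flat_box R X L Z H cH z0 x y xy a (u z0) xay.
have fsz z t : A z -> x <= t <= y -> flat_at L (H z) (fun t => s (z, t)) t.
  move=> Az tt.
  apply: (@flat_comp _ _ _ L (fun p : Z * R => H p.1 p.2) R (fun t => (z, t)) s t).
    exact: continuous_pairr.
  exact: fs.
have fsa : flat_at L (fun z => H z a) (fun z => s (z, a)) z0.
  apply: (@flat_comp _ _ _ L (fun p : Z * R => H p.1 p.2) Z (fun z => (z, a)) s z0).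
    exact: continuous_pairl.
  by apply: fs => //; exact: nbhs_singleton.
have E := flat_eq_near (@slice_continuous2 a z0) fsa fu.
have f0 : flat_at L (fun p : Z * R => H p.1 p.2) s (z0, b).
  by apply: fs => //; exact: nbhs_singleton.
apply: flat_near f0.
exists (A `&` [set z | s (z, a) = u z], [set` `]x, y[]).
  split => /=; last by apply: near_in_itvoo; rewrite in_itv /= xb yb.
  by apply: filterI => //; apply: filterS E => z [_]; apply.
move=> [z t] /= [[Az <-]]; rewrite in_itv /= => /andP[xt ty].
apply/esym/(@trans_segment (H z) (@slice_continuous1 z) a t (fun t => s (z, t)) x y).
- by [].
- by rewrite !ltW.
- by move=> t' tt'; exact: fsz.
Qed.

End Family.

End Transport.

(** * Homotopies *)

Section Total.
Variables (R : realType) (X : topologicalType) (L : local_system R X).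

Lemma tot_cast x y (e : x = y) u :
  existT (stalk L) y (castS L e u) = existT (stalk L) x u.
Proof. by subst y; rewrite castS_id. Qed.

Lemma tot_inj x u v : existT (stalk L) x u = existT (stalk L) x v -> u = v.
Proof. by move/(castS_existT erefl _ _).1 ->; rewrite castS_id. Qed.

Lemma tot_sec x y v (t : forall x, stalk L x) :
  existT (stalk L) y v = existT (stalk L) x (t x) -> v = t y.
Proof.
move=> E; have e : x = y by have := congr1 (@projT1 _ _) E => /= ->.
by subst y; rewrite (tot_inj E).
Qed.

(** Exchanges maps that agree near [z] only propositionally; phrasing the agreement in the total
    space avoids a cast at each nearby point. *)
Lemma flat_near_tot (Z : topologicalType) (h h' : Z -> X)
    (s : forall z, stalk L (h z)) (s' : forall z, stalk L (h' z)) z :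
  (\forall w \near z, existT (stalk L) (h' w) (s' w) = existT (stalk L) (h w) (s w)) ->
  flat_at L h s z -> flat_at L h' s' z.
Proof.
move=> ss [V [t [oV Vz tV st]]]; exists V, t; split=> //.
  by have /= -> := congr1 (@projT1 _ _) (nbhs_singleton ss).
near=> w; apply: (@tot_sec (h w)).
have -> : existT (stalk L) (h' w) (s' w) = existT (stalk L) (h w) (s w) by near: w.
by congr existT; near: w.
Unshelve. all: by end_near. Qed.

Lemma trans_tot (c c' : R -> X) a b u v : c =1 c' ->
  existT (stalk L) (c a) u = existT (stalk L) (c' a) v ->
  existT (stalk L) (c b) (trans L c a b u) =
  existT (stalk L) (c' b) (trans L c' a b v).
Proof. by move=> /funext E; subst c' => /tot_inj ->. Qed.

(** A section along the loop [H u0] is continued in the direction of [u] to the loop [H u1], where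
    the scalar is known, and brought back. The endpoints of the loops trace the same path, and
    continuation along it is linear, so the scalar is unchanged. *)
Lemma monodromy_homotopy (H : R -> R -> X) a u0 u1 :
  continuous (fun p : R * R => H p.1 p.2) -> (forall u, H u 0 = H u 1) ->
  monodromy_scalar L (H u1) a -> monodromy_scalar L (H u0) a.
Proof.
move=> cH e H1 s fs.
pose K t u := H u t.
have cK : continuous (fun p : R * R => K p.1 p.2).
  move=> p; apply: (@continuous_comp _ _ _ (fun p : R * R => (p.2, p.1))
    (fun p : R * R => H p.1 p.2)); last exact: cH.
  by apply: continuous_pair; [exact: cvg_snd|exact: cvg_fst].
have fS t u : flat_at L (fun p : R * R => K p.1 p.2)
    (fun p => trans L (K p.1) u0 p.2 (s p.1)) (t, u).
  by apply: (@trans_flat_joint R X L R K cK u0 u s t); exact: fs.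
have /H1 E : along setT (fun t => trans L (K t) u0 u1 (s t)).
  move=> t _; apply: (@flat_comp R _ X L (fun p : R * R => K p.1 p.2) R
    (fun t => (t, u1)) _ t (@continuous_pairl _ _ _ _) (fS t u1)).
have ck t : continuous (K t) by exact: slice_continuous1.
have := @trans_tot (K 1) (K 0) u1 u0 (trans L (K 1) u0 u1 (s 1))
  (a *: trans L (K 0) u0 u1 (s 0)) (fun u => esym (e u)) E.
rewrite (transK (ck 1)) => ->; congr existT.
by rewrite linearZ; congr (_ *: _); exact: (transK (ck 0)).
Qed.

End Total.

Section Naturality.
Variables (R : realType) (X : topologicalType) (L M : local_system R X).

Lemma trans_mor (f : ls_hom L M) (c : R -> X) a b v : continuous c ->
  f (c b) (trans L c a b v) = trans M c a b (f (c a) v).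
Proof.
move=> cc; have [s fs <-] := flat_exists v cc.
rewrite (transE cc a b fs).
rewrite (@transE R X M c cc a b (fun t => f (c t) (s t))) // => t.
exact: (flat_mor f (fs t)).
Qed.

End Naturality.

Lemma nat_iso_stalks (R : realType) (X : topologicalType) (Ca : category)
    (F G : functor Ca (LS R X))
    (th : forall A x, 'Hom(stalk (F A) x, stalk (G A) x)) :
  (forall A s x, flat_at (F A) id s x ->
     flat_at (G A) id (fun y => th A y (s y)) x) ->
  (forall A x, bijective (th A x)) ->
  (forall (A B : Ca) (f : hom A B) x v,
     th B x (mor (fmor F f) x v) = mor (fmor G f) x (th A x v)) ->
  nat_isomorphic F G.
Proof.
move=> fth bth nth.
pose a A := sval (cid (flat_hom (fth A))).
have aE A x : mor (a A) x = th A x := svalP (cid (flat_hom (fth A))) x.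
have ab A : exists g : hom (G A) (F A),
    comp g (a A : hom (F A) (G A)) = idm (F A) /\ comp (a A : hom (F A) (G A)) g = idm (G A).
  by apply: ls_bij_iso => x; rewrite aE.
exists a, (fun A => sval (cid (ab A))); split=> [A|A|A B f].
- by have [] := svalP (cid (ab A)).
- by have [] := svalP (cid (ab A)).
- by apply: ls_hom_eq => x /=; apply/lfunP => v; rewrite !comp_lfunE !aE nth.
Qed.

Section Homotopy.
Variables (R : realType) (Z X : topologicalType) (h0 h1 : Z -> X).
Variables (ch0 : continuous h0) (ch1 : continuous h1) (H : Z -> R -> X).
Hypothesis cH : continuous (fun p : Z * R => H p.1 p.2).
Hypotheses (H0 : forall z, H z 0 = h0 z) (H1 : forall z, H z 1 = h1 z).

Lemma homotopy_pullback :
  nat_isomorphic (pullback_functor R ch0) (pullback_functor R ch1).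
Proof.
apply: (@nat_iso_stalks R Z (LS R X) (pullback_functor R ch0) (pullback_functor R ch1)
  (fun (L : local_system R X) z => (castS L (H1 z) \o trans L (H z) 0 1
    \o castS L (esym (H0 z)))%VF)).
- move=> L s z; rewrite !flat_pullback; [|by move=> x; exact: cvg_id..] => fs.
  have f0 : flat_at L (H^~ 0) (fun z => castS L (esym (H0 z)) (s z)) z.
    by apply: flat_near_tot fs; near=> w; rewrite tot_cast.
  have f1 := @flat_comp R _ X L (fun p : Z * R => H p.1 p.2) Z (fun z => (z, 1)) _ z
    (@continuous_pairl _ _ _ _) (trans_flat_joint cH 1 f0).
  by apply: flat_near_tot f1; near=> w; rewrite !comp_lfunE tot_cast.
- move=> L z; apply: (@eq_bij _ _ (castS L (H1 z) \o (trans L (H z) 0 1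
    \o castS L (esym (H0 z))))); last by move=> v; rewrite !comp_lfunE.
  apply: bij_comp; first exact: castS_bij.
  apply: bij_comp; last exact: castS_bij.
  exact/trans_bij/slice_continuous1.
- move=> L M f z v; rewrite !comp_lfunE /= castS_mor trans_mor ?castS_mor //.
  exact: slice_continuous1.
Unshelve. all: by end_near. Qed.

End Homotopy.

(** * Descent along circles *)

Section Descent.
Variables (R : realType) (Z B : topologicalType).
Variables (f : Z -> B) (cf : continuous f) (sg : B -> Z) (csg : continuous sg).
Variables (rot G : Z -> R -> Z).
Hypothesis crot : continuous (fun p : Z * R => rot p.1 p.2).
Hypothesis cG : continuous (fun p : Z * R => G p.1 p.2).
Hypothesis rot0 : forall z, rot z 0 = z.
Hypothesis rotD : forall z t u, rot (rot z t) u = rot z (t + u).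
Hypothesis rot_free : forall z t u, rot z t = rot z u ->
  exists m : int, u = t + m%:~R.
Hypothesis G0 : forall z, G z 0 = sg (f z).
Hypothesis angle : forall z : Z, exists2 tau : Z -> R, continuous tau &
  \forall w \near z, rot (G w 1) (tau w) = w.

(** The angle exists only locally; [tm] evaluates at [z] the branch chosen near [z], and is not
    claimed to be continuous. *)
Let tm z : R := sval (cid2 (angle z)) z.

Let tmE z : rot (G z 1) (tm z) = z.
Proof. exact: (nbhs_singleton (svalP (cid2 (angle z))).2). Qed.

(** Radial motion and rotation run simultaneously, which gives one formula continuous in all
    variables. *)
Let path z t u := rot (G z u) (u * t).

Let cpath (tau : Z -> R) : continuous tau ->
  continuous (fun p : Z * R => path p.1 (tau p.1) p.2).
Proof.
move=> ct p; apply: (@continuous_comp _ _ _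
  (fun p : Z * R => (G p.1 p.2, p.2 * tau p.1)) (fun q => rot q.1 q.2)).
  apply: continuous_pair; first exact: cG.
  apply: cvgM; first exact: cvg_snd.
  by apply: (@continuous_comp _ _ _ fst tau p); [exact: cvg_fst|exact: ct].
exact: crot.
Qed.

Let cpath1 z t : continuous (path z t).
Proof.
have ct : continuous (fun _ : Z => t) by move=> ?; exact: cvg_cst.
exact: (@slice_continuous1 R Z Z (fun z => path z t) (cpath ct) z).
Qed.

Section Monodromy.
Variable L : local_system R Z.
Hypothesis trivL : forall z, monodromy_scalar L (rot z) 1.

(** Triviality of the monodromy is applied at the base point [rot z u] for each [u], which makes
    sections along an orbit periodic in the total space. *)
Lemma flat_shift z (s : forall t, stalk L (rot z t)) t (m : int) :
  (forall t, flat_at L (rot z) s t) ->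
  existT (stalk L) (rot z (t + m%:~R)) (s (t + m%:~R)) =
  existT (stalk L) (rot z t) (s t).
Proof.
move=> fs.
have step u : existT (stalk L) (rot z (u + 1)) (s (u + 1)) =
    existT (stalk L) (rot z u) (s u).
  pose s' v := castS L (esym (rotD z u v)) (s (u + v)).
  have /trivL : along setT s'.
    move=> v _.
    have fuv : flat_at L (rot z \o +%R u) (fun v => s (u + v)) v.
      apply: (@flat_comp R _ _ L (rot z) R (fun v => u + v) s v).
        by apply: cvgD; [exact: cvg_cst|exact: cvg_id].
      exact: fs.
    by apply: flat_near_tot fuv; near=> w; rewrite tot_cast.
  by rewrite scale1r !tot_cast addr0.
have nat_step (k : nat) u : existT (stalk L) (rot z (u + k%:R)) (s (u + k%:R)) =
    existT (stalk L) (rot z u) (s u).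
  by elim: k => [|k IH]; [rewrite addr0|rewrite -natr1 addrA step].
case: m => k; first exact: nat_step.
by rewrite -[in RHS](subrK k.+1%:R t) nat_step NegzE mulrNz.
Unshelve. all: by end_near. Qed.

(* Continuation along [path z t] is read off a flat family on the plane of all
   [rot (G z u) t]; hence it depends on [t] only up to integers. *)
Lemma trans_path z (v : stalk L (sg (f z))) :
  exists2 s : forall u, stalk L (rot (G z 1) u),
    forall u, flat_at L (rot (G z 1)) s u &
    (forall t (e0 : sg (f z) = path z t 0),
      existT (stalk L) (path z t 1) (trans L (path z t) 0 1 (castS L e0 v)) =
      existT (stalk L) (rot (G z 1) t) (s t)).
Proof.
pose H u t := rot (G z u) t.
have cGz : continuous (G z) by exact: slice_continuous1.
have cH : continuous (fun p : R * R => H p.1 p.2).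
  move=> p; apply: (@continuous_comp _ _ _ (fun p : R * R => (G z p.1, p.2))
    (fun q => rot q.1 q.2)); last exact: crot.
  apply: continuous_pair; last exact: cvg_snd.
  by apply: (@continuous_comp _ _ _ fst (G z) p); [exact: cvg_fst|exact: cGz].
have e00 : sg (f z) = H 0 0 by rewrite /H rot0 G0.
(* The vector is continued along [G z] at angle 0; continuing the result in the angle gives a flat
   family on the whole plane. *)
have [s fs s0] := @flat_exists R Z L (H^~ 0) 0 (castS L e00 v)
  (@slice_continuous2 R Z R H cH 0).
have fS u t' : flat_at L (fun p : R * R => H p.1 p.2)
    (fun p => trans L (H p.1) 0 p.2 (s p.1)) (u, t').
  exact: (trans_flat_joint cH t' (fs u)).
exists (fun u => trans L (H 1) 0 u (s 1)) => //.
  move=> u; exact: (flat_comp (@continuous_pairr _ _ _ _) (fS 1 u)).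
move=> t' e'.
(* In this plane, [path z t'] is the image of the line from [(0, 0)] to [(1, t')]. *)
have cline u : {for u, continuous (fun u : R => (u, u * t'))}.
  apply: continuous_pair; first exact: cvg_id.
  by apply: cvgM; [exact: cvg_id|exact: cvg_cst].
have fpath u : flat_at L (path z t') (fun u => trans L (H u) 0 (u * t') (s u)) u.
  exact: (flat_comp (cline u) (fS u (u * t'))).
have := transE (@cpath1 z t') 0 1 fpath.
have -> : trans L (H 0) 0 (0 * t') (s 0) = castS L e' v.
  apply: tot_inj; rewrite tot_cast.
  have -> : existT (stalk L) (path z t' 0) (trans L (H 0) 0 (0 * t') (s 0)) =
      existT (stalk L) (H 0 0) (trans L (H 0) 0 0 (s 0)).
    by rewrite /path mul0r.
  rewrite trans_id ?s0 ?tot_cast //; exact: slice_continuous1.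
by move=> ->; rewrite /path mul1r.
Qed.

End Monodromy.

Let start z : sg (f z) = path z (tm z) 0.
Proof. by rewrite /path mul0r rot0 G0. Qed.

Let finish z : path z (tm z) 1 = z.
Proof. by rewrite /path mul1r tmE. Qed.

(** Continuation along [path w (tm w)] is bijective and natural for general reasons; the difficulty
    is flatness in [w], as [tm] may jump. Near [z] it is compared with a continuous branch [tau]:
    both angles rotate [G w 1] to [w], so they differ by an integer, which [flat_shift] makes
    invisible. *)
Lemma descent_nat_iso (Ca : category) (F : functor Ca (LS R Z)) :
  (forall A z, monodromy_scalar (F A) (rot z) 1) ->
  nat_isomorphic
    (functor_comp (pullback_functor R cf) (functor_comp (pullback_functor R csg) F)) F.
Proof.
move=> trivF.
apply: (@nat_iso_stalks R Z Ca (functor_comp (pullback_functor R cf)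
    (functor_comp (pullback_functor R csg) F)) F
  (fun A z => (castS (F A) (finish z) \o trans (F A) (path z (tm z)) 0 1
    \o castS (F A) (start z))%VF)).
- move=> A s z fs; set L : local_system R Z := F A.
  have {}fs : flat_at L (sg \o f) s z.
    have fid : continuous (@idfun Z) by move=> ?; exact: cvg_id.
    move: fs; rewrite (@flat_pullback R Z Z B (pullback L csg) f cf id fid).
    by rewrite (@flat_pullback R Z B Z L sg csg f cf).
  have [tau ctau ntau] := angle z.
  have start' w : sg (f w) = path w (tau w) 0 by rewrite /path mul0r rot0 G0.
  have f0 : flat_at L (fun w => path w (tau w) 0) (fun w => castS L (start' w) (s w)) z.
    by apply: flat_near_tot fs; near=> w; rewrite tot_cast.
  have f1 := @trans_flat_joint R Z L Z (fun w => path w (tau w)) (cpath ctau) 0 1 _ z f0.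
  have {}f1 := flat_comp (@continuous_pairl _ _ _ _) f1.
  apply: flat_near_tot f1; near=> w; rewrite !comp_lfunE tot_cast /=.
  have [s' fs' E] := trans_path (s w).
  rewrite (E _ (start w)) (E _ (start' w)).
  have : rot (G w 1) (tm w) = rot (G w 1) (tau w) by rewrite tmE; apply/esym; near: w.
  by move=> /rot_free[m ->]; rewrite (flat_shift (trivF A)).
- move=> A z; apply: (@eq_bij _ _ (castS (F A) (finish z) \o
    (trans (F A) (path z (tm z)) 0 1 \o castS (F A) (start z)))); last first.
    by move=> v; rewrite !comp_lfunE.
  apply: bij_comp; first exact: castS_bij.
  apply: bij_comp; last exact: castS_bij.
  exact/trans_bij/cpath1.
- move=> A A' g z v; rewrite !comp_lfunE /= castS_mor trans_mor ?castS_mor //.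
Unshelve. all: by end_near. Qed.

End Descent.

(** * Categories and tensor products *)

Section Categories.
Variables Ca Cb Cc : category.

Lemma isomorphic_sym (A B : Ca) : isomorphic A B -> isomorphic B A.
Proof. by move=> [f [g [gf fg]]]; exists g, f. Qed.

Lemma isomorphic_trans (A B D : Ca) :
  isomorphic A B -> isomorphic B D -> isomorphic A D.
Proof.
move=> [f [g [gf fg]]] [f' [g' [gf' fg']]].
exists (comp f' f), (comp g g'); split.
  by rewrite -comp_assoc (comp_assoc g') gf' comp_idl.
by rewrite -comp_assoc (comp_assoc f) fg comp_idl.
Qed.

Lemma functor_isomorphic (F : functor Ca Cb) (A B : Ca) :
  isomorphic A B -> isomorphic (F A) (F B).
Proof.
move=> [f [g [gf fg]]]; exists (fmor F f), (fmor F g).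
by rewrite -!fmor_comp gf fg !fmor_id.
Qed.

Lemma nat_isomorphic_at (F G : functor Ca Cb) (A : Ca) :
  nat_isomorphic F G -> isomorphic (F A) (G A).
Proof. by move=> [a [b [ba ab _]]]; exists (a A), (b A). Qed.

Lemma nat_isomorphic_sym (F G : functor Ca Cb) :
  nat_isomorphic F G -> nat_isomorphic G F.
Proof.
move=> [a [b [ba ab na]]]; exists b, a; split=> // A B f.
rewrite -[LHS]comp_idr -(ab A) comp_assoc -(comp_assoc (b B)) -na.
by rewrite (comp_assoc (b B)) ba comp_idl.
Qed.

Lemma nat_isomorphic_trans (F G H : functor Ca Cb) :
  nat_isomorphic F G -> nat_isomorphic G H -> nat_isomorphic F H.
Proof.
move=> [a [b [ba ab na]]] [a' [b' [ba' ab' na']]].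
exists (fun A => comp (a' A) (a A)), (fun A => comp (b A) (b' A)); split.
- by move=> A; rewrite -comp_assoc (comp_assoc (b' A)) ba' comp_idl.
- by move=> A; rewrite -comp_assoc (comp_assoc (a A)) ab comp_idl.
- by move=> A B f; rewrite -comp_assoc na comp_assoc na' comp_assoc.
Qed.

Lemma nat_isomorphic_compl (H : functor Cb Cc) (F G : functor Ca Cb) :
  nat_isomorphic F G -> nat_isomorphic (functor_comp H F) (functor_comp H G).
Proof.
move=> [a [b [ba ab na]]].
exists (fun A => fmor H (a A)), (fun A => fmor H (b A)).
by split=> [A|A|A B f] /=; rewrite -!fmor_comp ?ba ?ab ?na ?fmor_id.
Qed.

Lemma nat_isomorphic_compr (F G : functor Cb Cc) (H : functor Ca Cb) :
  nat_isomorphic F G -> nat_isomorphic (functor_comp F H) (functor_comp G H).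
Proof.
move=> [a [b [ba ab na]]].
by exists (fun A => a (H A)), (fun A => b (H A)); split=> [A|A|A B f] /=.
Qed.

End Categories.

Section IsoStalks.
Variables (R : realType) (X : topologicalType).

Lemma isomorphic_stalks (L M : LS R X) (th : forall x, 'Hom(stalk L x, stalk M x)) :
  (forall s x, flat_at L id s x -> flat_at M id (fun y => th y (s y)) x) ->
  (forall x, bijective (th x)) -> isomorphic L M.
Proof.
move=> fth bth; have [g gE] := flat_hom fth.
have [|g' H] := @ls_bij_iso R X L M g; first by move=> x; rewrite gE.
by exists g, g'.
Qed.

Lemma isomorphic_bij (L M : LS R X) : isomorphic L M ->
  exists f : hom L M, forall x, bijective (mor f x).
Proof.
move=> [f [g [gf fg]]]; exists f => x; exists (mor g x) => v.
  have /(congr1 (fun h : hom L L => mor h x v)) /= := gf.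
  by rewrite comp_lfunE id_lfunE.
have /(congr1 (fun h : hom M M => mor h x v)) /= := fg.
by rewrite comp_lfunE id_lfunE.
Qed.

End IsoStalks.

Section Sums.
Variables (R : realType) (Z X : topologicalType) (L : local_system R X) (h : Z -> X).
Variable z : Z.

Lemma flat_zero : flat_at L h (fun=> 0) z.
Proof.
have [V [t [oV Vz tV tz]]] := section_through (0 : stalk L (h z)).
have ft : flat_at L h (fun w => t (h w)) z.
  by exists V, t; split=> //; near=> w.
by apply: flat_near (flat_lin (-1) ft ft); near=> w; rewrite scaleN1r addNr.
Unshelve. all: by end_near. Qed.

Lemma flat_sum (I : Type) (r : seq I) (c : I -> Cx R)
    (s : I -> forall w, stalk L (h w)) :
  (forall i, flat_at L h (s i) z) ->
  flat_at L h (fun w => \sum_(i <- r) c i *: s i w) z.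
Proof.
move=> fs; elim: r => [|i r IH].
  by apply: flat_near flat_zero; near=> w; rewrite big_nil.
by apply: flat_near (flat_lin (c i) (fs i) IH); near=> w; rewrite big_cons.
Unshelve. all: by end_near. Qed.

End Sums.

(** * Tensor products and cancellation of a rank one factor *)

Section TensorFlat.
Variables (R : realType) (X : topologicalType).

Lemma dual_pair_near (Z : topologicalType) (K : local_system R X) (h : Z -> X)
    (a : forall z, dualsp (stalk K (h z))) (t : forall z, stalk K (h z)) z :
  {for z, continuous h} -> flat_at (dual K) h a z -> flat_at K h t z ->
  \forall w \near z, a w (t w) = a z (t z).
Proof.
move=> ch [V [a' [oV Vz aV aa]]] [W [t' [oW Wz tW tt]]].
have oVW : open (V `&` W) by exact: openI.
have tVW : sec (V `&` W) t' by apply: (sec_sub oW oVW _ tW) => ? [].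
have := aV (V `&` W) t' oVW (@subIsetl _ _ _) tVW (h z) (conj Vz Wz).
move=> /ch /= E; near=> w.
rewrite (nbhs_singleton aa) (nbhs_singleton tt).
have -> : a w = a' (h w) by near: w.
have -> : t w = t' (h w) by near: w.
by near: w.
Unshelve. all: by end_near. Qed.

Lemma flat_pure (Z : topologicalType) (K L : local_system R X) (h : Z -> X)
    (a : forall z, stalk K (h z)) (b : forall z, stalk L (h z)) z :
  flat_at K h a z -> flat_at L h b z ->
  flat_at (tensor K L) h (fun w => pure (a w) (b w)) z.
Proof.
move=> [V [a' [oV Vz aV aa]]] [W [b' [oW Wz bW bb]]].
have oVW : open (V `&` W) by exact: openI.
exists (V `&` W), (fun x => pure (a' x) (b' x)); split=> //.
  move=> x VWx; exists (V `&` W), 1, (fun=> a'), (fun=> b'); split=> //.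
  - by move=> _; apply: (sec_sub oV oVW _ aV) => ? [].
  - by move=> _; apply: (sec_sub oW oVW _ bW) => ? [].
  - by move=> y _; rewrite big_ord1.
by near=> w; congr pure; near: w.
Unshelve. all: by end_near. Qed.

Lemma flat_tensor_sum (Z : topologicalType) (K L : local_system R X) (h : Z -> X)
    (T : forall z, tensorsp (stalk K (h z)) (stalk L (h z))) z :
  {for z, continuous h} -> flat_at (tensor K L) h T z ->
  exists m (a : 'I_m -> forall z, stalk K (h z)) (b : 'I_m -> forall z, stalk L (h z)),
    [/\ forall i, flat_at K h (a i) z, forall i, flat_at L h (b i) z &
      \forall w \near z, T w = \sum_i pure (a i w) (b i w)].
Proof.
move=> ch [V [t [oV Vz tV Tt]]].
have [W [m [a [b [[oW Wz] aW bW tE]]]]] := tV (h z) Vz.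
exists m, (fun i w => a i (h w)), (fun i w => b i (h w)); split.
- by move=> i; exists W, (a i); split=> //; near=> w.
- by move=> i; exists W, (b i); split=> //; near=> w.
- have Wn : \forall w \near z, W (h w) by apply: ch; exact: open_nbhs_nbhs.
  near=> w; have -> : T w = t (h w) by near: w.
  by apply: tE; near: w.
Unshelve. all: by end_near. Qed.

(** Near [z] the tensor is a sum of pure tensors of sections, and the pairings of [a] with their
    first factors are constant, so the result is a combination of sections with constant
    coefficients. *)
Lemma flat_apply (Z : topologicalType) (K L : local_system R X) (h : Z -> X)
    (T : forall z, tensorsp (stalk K (h z)) (stalk L (h z)))
    (a : forall z, dualsp (stalk K (h z))) z :
  {for z, continuous h} -> flat_at (tensor K L) h T z -> flat_at (dual K) h a z ->
  flat_at L h (fun w => T w (a w)) z.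
Proof.
move=> ch fT fa; have [m [u [v [fu fv E]]]] := flat_tensor_sum ch fT.
apply: flat_near (flat_sum (index_enum 'I_m) (fun i => a z (u i z) : Cx R) fv).
have E' := @filter_forall _ _ _ _ _ (fun i => dual_pair_near ch fa (fu i)).
near=> w; have -> : T w = \sum_i pure (u i w) (v i w) by near: w.
rewrite sum_lfunE; apply: eq_bigr => i _; rewrite pureE; congr (_ *: _).
have wE : forall i, a w (u i w) = a z (u i z) by near: w; exact: E'.
by rewrite wE.
Unshelve. all: by end_near. Qed.

End TensorFlat.

(** A basis vector with its coordinate form, packed as a pair so that a single choice yields
    both. *)
Lemma line_generator (F : fieldType) (V : vectType F) : \dim {:V} = 1%N ->
  exists ea : V * dualsp V, forall v, v = (ea.2 v : F) *: ea.1.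
Proof.
move=> d1; pose i : 'I_(\dim {:V}) := cast_ord (esym d1) ord0.
exists ((vbasis {:V})`_i, linfun (coord (vbasis {:V}) i : V -> F^o)) => v /=.
rewrite [in LHS](coord_vbasis (memvf v)) lfunE /= (bigD1 i) //= big1 ?addr0 //.
move=> j /eqP[]; apply: val_inj => /=.
by apply/eqP; rewrite -leqn0 -ltnS -[X in (_ < X)%N]d1 ltn_ord.
Qed.

Lemma line_dim (F : fieldType) (V : vectType F) (e : V) :
  e != 0 -> (forall v, exists a : F, v = a *: e) -> \dim {:V} = 1%N.
Proof.
move=> e0 He; have -> : fullv = <[e]>%VS.
  by apply/vspaceP => v; rewrite memvf; have [a ->] := He v; rewrite memvZ ?memv_line.
by rewrite dim_vline e0.
Qed.

Section Contraction.
Variables (R : realType) (X : topologicalType) (A B : local_system R X).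
Variables (al : forall x, dualsp (stalk A x)) (be : forall x, dualsp (stalk B x)).
Hypothesis al_be_flat : forall x, exists (al' : forall x, dualsp (stalk A x))
   (be' : forall x, dualsp (stalk B x)), [/\ flat_at (dual A) id al' x,
    flat_at (dual B) id be' x & \forall y \near x, exists2 c : Cx R, c != 0 &
      al' y = c^-1 *: al y /\ be' y = c *: be y].
Hypothesis al_gen : forall x, exists2 a, al x a = 1 &
  forall phi : dualsp (stalk A x), phi = (phi a : Cx R) *: al x.
Hypothesis be_gen : forall x, exists2 b, be x b = 1 &
  forall psi : dualsp (stalk B x), psi = (psi b : Cx R) *: be x.

Section Fun.
Variable (L : local_system R X) (x : X).

Definition contract_fun (T : tensorsp (stalk A x) (tensorsp (stalk B x) (stalk L x))) :
  stalk L x := T (al x) (be x).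

Lemma contract_linear : linear contract_fun.
Proof. by move=> a S T; rewrite /contract_fun !(add_lfunE, scale_lfunE). Qed.

HB.instance Definition _ := GRing.isLinear.Build (Cx R) _ _ *:%R contract_fun contract_linear.

Definition contract : 'Hom(tensorsp (stalk A x) (tensorsp (stalk B x) (stalk L x)), stalk L x) :=
  linfun contract_fun.

Lemma contractE T : contract T = T (al x) (be x).
Proof. by rewrite lfunE. Qed.

Lemma contract_bij : bijective contract.
Proof.
have [a a1 ha] := al_gen x; have [b b1 hb] := be_gen x.
exists (fun w => pure a (pure b w)) => [T|w]; last first.
  by rewrite contractE pureE a1 scale1r pureE b1 scale1r.
apply/lfunP => phi; apply/lfunP => psi.
rewrite pureE scale_lfunE pureE contractE.
have -> : T phi = (phi a : Cx R) *: T (al x) by rewrite {1}(ha phi) linearZ.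
rewrite scale_lfunE; congr (_ *: _).
by rewrite [in RHS](hb psi) linearZ.
Qed.

End Fun.

(** The forms [al] and [be] are chosen point by point and need not be flat. Near each point flat
    forms differ from them by the factors [c^-1] and [c], which cancel in the double evaluation. *)
Lemma contract_nat_iso :
  nat_isomorphic (functor_comp (tensor_functor A) (tensor_functor B)) (functor_id (LS R X)).
Proof.
apply: (@nat_iso_stalks R X (LS R X) (functor_comp (tensor_functor A) (tensor_functor B))
   (functor_id (LS R X)) contract).
- move=> L s x fs; have [al' [be' [fa fb E]]] := al_be_flat x.
  have f1 := @flat_apply R X X A (tensor B L) id s al' x (@cvg_id _ _) fs fa.
  have f2 := @flat_apply R X X B L id _ be' x (@cvg_id _ _) f1 fb.
  apply: flat_near f2; near=> y.
  have [c c0 [-> ->]] : exists2 c : Cx R, c != 0 &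
      al' y = c^-1 *: al y /\ be' y = c *: be y by near: y.
  have -> : s y (c^-1 *: al y) = c^-1 *: s y (al y) by rewrite linearZ.
  by rewrite contractE scale_lfunE linearZ scalerA mulVf // scale1r.
- by move=> L x; exact: contract_bij.
- move=> L M f x T /=; rewrite !contractE.
  rewrite [LHS](congr1 (fun h : 'Hom(_, _) => h (be x))
    (congr1 (fun h : 'Hom(_, _) => h (al x)) (tensor_mor_funE (tensor_mor B f) T))).
  by rewrite comp_lfunE /= tensor_mor_funE comp_lfunE.
Unshelve. all: by end_near. Qed.

End Contraction.

Section Line.
Variables (R : realType) (X : topologicalType) (K : local_system R X).
Hypothesis K1 : rank_one K.

Let gen x := sval (cid (line_generator (K1 x))).
Let e x : stalk K x := (gen x).1.
Let al x : dualsp (stalk K x) := (gen x).2.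
(** Evaluation at [e x]: the double dual is, by definition, the tensor product with the scalars. *)
Let ev x : dualsp (dualsp (stalk K x)) := pure (e x) (1 : (Cx R)^o).

Let genE x v : v = (al x v : Cx R) *: e x.
Proof. exact: (svalP (cid (line_generator (K1 x)))). Qed.

Let e_neq0 x : e x != 0.
Proof.
apply/eqP => e0; have := K1 x; suff -> : fullv = 0%VS :> {vspace stalk K x} by rewrite dimv0.
by apply/vspaceP => v; rewrite memvf memv0 (genE v) e0 scaler0 eqxx.
Qed.

Let al_e x : al x (e x) = 1.
Proof.
have := genE (e x); rewrite -[in LHS](scale1r (e x)) => /eqP.
rewrite -subr_eq0 -scalerBl scaler_eq0 (negbTE (e_neq0 x)) orbF subr_eq0.
by move=> /eqP.
Qed.

Let evE x (phi : dualsp (stalk K x)) : ev x phi = phi (e x).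
Proof. by rewrite pureE /GRing.scale /= mulr1. Qed.

Let al_gen x (phi : dualsp (stalk K x)) : phi = (phi (e x) : Cx R) *: al x.
Proof.
apply/lfunP => v; rewrite scale_lfunE [in LHS](genE v) linearZ /=.
by rewrite /GRing.scale /= mulrC.
Qed.

Let ev_gen x (psi : dualsp (dualsp (stalk K x))) : psi = (psi (al x) : Cx R) *: ev x.
Proof.
apply/lfunP => phi; rewrite scale_lfunE evE [in LHS](al_gen phi) linearZ /=.
by rewrite /GRing.scale /= mulrC.
Qed.

Lemma dual_rank_one : rank_one (dual K).
Proof.
move=> x; apply: (@line_dim _ _ (al x)).
  apply/eqP => a0; have := al_e x; rewrite a0 lfunE /= => /esym/eqP.
  by rewrite oner_eq0.
by move=> phi; exists (phi (e x)); exact: al_gen.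
Qed.

(** Sections [t] through [e x] and [h] through [al x] pair to 1 near [x]. With [c = al y (t y)], the
    vector [t y] is [c] times [e y], and the pairing forces [h y] to be [c^-1] times [al y]. *)
Let al_ev_flat x : exists (al' : forall x, dualsp (stalk K x))
   (ev' : forall x, dualsp (dualsp (stalk K x))), [/\ flat_at (dual K) id al' x,
    flat_at (dual (dual K)) id ev' x & \forall y \near x, exists2 c : Cx R, c != 0 &
      al' y = c^-1 *: al y /\ ev' y = c *: ev y].
Proof.
have [V [t [oV Vx tV tx]]] := section_through (e x).
have [W [h [oW Wx hW hx]]] := @section_through R X (dual K) x (al x).
have ft : flat_at K id t x by exists V, t; split=> //; near=> y.
have fh : flat_at (dual K) id h x by exists W, h; split=> //; near=> y.
exists h, (fun y => pure (t y) (1 : (Cx R)^o)); split=> //.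
  exists V, (fun y => pure (t y) (1 : (Cx R)^o)); split=> //; last by near=> y.
  move=> U k oU UV kU y Uy.
  have tU : sec U t by apply: (sec_sub oV oU UV tV).
  have := kU U t oU (@subset_refl _ U) tU y Uy; apply: filterS => z kz.
  by rewrite !pureE kz.
have := dual_pair_near (@cvg_id _ _) fh ft; rewrite tx hx al_e; apply: filterS => y h1.
have c0 : (al y (t y) : Cx R) != 0.
  apply/eqP => a0; move: h1; rewrite (genE (t y)) a0 scale0r linear0.
  by move/esym/eqP; rewrite oner_eq0.
exists (al y (t y)) => //; split; last first.
  apply/lfunP => phi; rewrite scale_lfunE evE pureE [in LHS](genE (t y)) linearZ /=.
  by rewrite /GRing.scale /= mulr1.
rewrite (al_gen (h y)); congr (_ *: _).
move: h1; rewrite [in LHS](genE (t y)) linearZ /= /GRing.scale /= => h1.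
by apply: (mulfI c0); rewrite h1 mulfV.
Unshelve. all: by end_near. Qed.

Lemma tensor_dual_nat_iso :
  nat_isomorphic (functor_comp (tensor_functor K) (tensor_functor (dual K)))
    (functor_id (LS R X)).
Proof.
apply: (@contract_nat_iso R X K (dual K) al ev al_ev_flat) => x.
  by exists (e x); [exact: al_e|exact: al_gen].
exists (al x); first by rewrite evE al_e.
exact: ev_gen.
Qed.

Lemma dual_tensor_nat_iso :
  nat_isomorphic (functor_comp (tensor_functor (dual K)) (tensor_functor K))
    (functor_id (LS R X)).
Proof.
apply: (@contract_nat_iso R X (dual K) K ev al) => x.
- have [al' [ev' [fa fe E]]] := al_ev_flat x; exists ev', al'; split=> //.
  apply: filterS E => y [c c0 [-> ->]]; exists c^-1; first by rewrite invr_eq0.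
  by rewrite invrK.
- exists (al x); first by rewrite evE al_e.
  exact: ev_gen.
- by exists (e x); [exact: al_e|exact: al_gen].
Qed.

End Line.

(** * Monodromy *)

Section Monodromy.
Variables (R : realType) (X : topologicalType).
Implicit Types L M K : local_system R X.
Variable c : R -> X.
Hypothesis cc : continuous c.

(** An equality in the total space includes equality of the base points; the continuation of the
    zero vector provides a section to which it applies. *)
Lemma monodromy_closed L a : monodromy_scalar L c a -> c 0 = c 1.
Proof.
have [s fs _] := flat_exists (0 : stalk L (c 0)) cc.
by move=> /(_ s) H; have /(congr1 (@projT1 _ _)) /= := H (fun t _ => fs t).
Qed.

Lemma monodromy_castP L a (e : c 0 = c 1) : monodromy_scalar L c a <->
  forall s : forall t, stalk L (c t), (forall t, flat_at L c s t) ->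
    s 1 = castS L e (a *: s 0).
Proof.
split=> H s fs; first by apply/(castS_existT e); apply: H => t _; exact: fs.
by apply/(castS_existT e); apply: H => t; exact: fs.
Qed.

Lemma monodromy_mono L M (f : ls_hom M L) a :
  (forall x, injective (f x)) -> c 0 = c 1 ->
  monodromy_scalar L c a -> monodromy_scalar M c a.
Proof.
move=> fi e /(monodromy_castP _ _ e) H; apply/(monodromy_castP _ _ e) => s fs.
apply: (fi); rewrite castS_mor linearZ.
by apply: (H (fun t => f (c t) (s t))) => t; exact: flat_mor.
Qed.

Lemma monodromy_isomorphic L M a : @isomorphic (LS R X) M L ->
  monodromy_scalar L c a -> monodromy_scalar M c a.
Proof.
move=> /isomorphic_bij[f bf] H; apply: monodromy_mono (H); last first.
  exact: monodromy_closed H.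
by move=> x; apply: bij_inj; exact: (bf x).
Qed.

Lemma castS_pure K L x y (e : x = y) (a b : Cx R) u v :
  castS (tensor K L) e ((a * b) *: (pure u v : stalk (tensor K L) x)) =
  pure (castS K e (a *: u)) (castS L e (b *: v)).
Proof.
subst y; rewrite !castS_id; apply/lfunP => phi.
have E : phi (a *: u) = (a * phi u : Cx R) by rewrite linearZ.
by rewrite scale_lfunE !pureE E !scalerA mulrAC.
Qed.

(** The initial value is a sum of pure tensors; continuing each factor gives, by uniqueness, the
    continuation of the sum. *)
Lemma monodromy_tensor K L a b : monodromy_scalar K c a ->
  monodromy_scalar L c b -> monodromy_scalar (tensor K L) c (a * b).
Proof.
move=> HK HL; have e := monodromy_closed HK.
move/(monodromy_castP _ _ e): HK => HK; move/(monodromy_castP _ _ e): HL => HL.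
apply/(monodromy_castP _ _ e) => s fs.
have [m [u [v s0]]] := pure_span (s 0).
have [su /all_and2[fu u0]] := fin_all_exists (fun i =>
  let: ex_intro2 s f e := flat_exists (u i) cc in ex_intro _ s (conj f e)).
have [sv /all_and2[fv v0]] := fin_all_exists (fun i =>
  let: ex_intro2 s f e := flat_exists (v i) cc in ex_intro _ s (conj f e)).
pose S t : stalk (tensor K L) (c t) := \sum_i (1 : Cx R) *: pure (su i t) (sv i t).
have fS t : flat_at (tensor K L) c S t.
  by apply: flat_sum => i; apply: flat_pure.
have S0 : s 0 = S 0 by rewrite s0; apply: eq_bigr => i _; rewrite scale1r u0 v0.
rewrite (flat_unique cc 1 fs fS S0) S0 /S scaler_sumr linear_sum.
apply: eq_bigr => i _; rewrite !scale1r (HK _ (fu i)) (HL _ (fv i)).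
exact/esym/castS_pure.
Qed.

(** The pairing of a continued form with a continued vector is constant along the path. As the
    vector is multiplied by [a], the form is multiplied by the inverse. *)
Lemma monodromy_dual K a : a != 0 -> monodromy_scalar K c a ->
  monodromy_scalar (dual K) c a^-1.
Proof.
move=> a0 HK; have e := monodromy_closed HK.
move/(monodromy_castP _ _ e): HK => HK.
apply/(monodromy_castP _ _ e) => s fs.
have castD x y (e' : x = y) (phi : dualsp (stalk K x)) w :
    (castS (dual K) e' phi : dualsp (stalk K y)) (castS K e' w) = phi w.
  by subst y; rewrite !castS_id.
apply/lfunP => w'; have [g gK Kg] := castS_bij K e; rewrite -(Kg w').
set w := g w'; rewrite castD scale_lfunE.
have [t ft <-] := flat_exists w cc.
have E : s 0 (t 0) = s 1 (t 1).
  apply: (@interval_ind R (fun x y => s x (t x) = s y (t y))) ler01.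
    move=> u; have := dual_pair_near (@cc u) (fs u) (ft u).
    move=> /nbhs_ballP[r /= r0 rE]; exists r => // x y ux xy yu.
    rewrite !rE // /ball /= ltr_norml ltrBlDr ltrBDr; move: ux xy yu; lra.
  by move=> x y z _ _ -> ->.
have -> : castS K e (t 0) = a^-1 *: t 1.
  by rewrite (HK t ft) linearZ scalerA mulVf // scale1r.
by rewrite linearZ E.
Qed.

End Monodromy.

Section MonodromyPullback.
Variables (R : realType) (X Y : topologicalType) (L : local_system R Y).
Variables (g : X -> Y) (cg : continuous g) (c : R -> X).
Hypothesis cc : continuous c.

Lemma castS_pullback x y (e : x = y) v :
  castS (pullback L cg) e v = castS L (congr1 g e) v.
Proof. by subst y; rewrite !castS_id. Qed.

Lemma monodromy_pullback a (e : c 0 = c 1) :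
  monodromy_scalar (pullback L cg) c a <-> monodromy_scalar L (g \o c) a.
Proof.
rewrite (monodromy_castP (pullback L cg) a e).
rewrite (monodromy_castP L (c := g \o c) a (congr1 g e)).
split=> H s fs; first rewrite -castS_pullback; last rewrite castS_pullback.
  by apply: H => t; apply/flat_pullback.
by apply: (H s) => t; have := fs t; rewrite (@flat_pullback R R X Y L g cg c cc s t).
Qed.

(** The composite [g \o c] is constant, so a section of [L] through the initial value restricts to a
    constant continuation. *)
Lemma monodromy_fiber : c 0 = c 1 -> (forall t, g (c t) = g (c 0)) ->
  monodromy_scalar (pullback L cg) c 1.
Proof.
move=> e gc; apply/(monodromy_pullback _ e)/(monodromy_castP L (c := g \o c) 1 (congr1 g e)) => s fs.
have cgc : continuous (g \o c) by move=> t; apply: continuous_comp; [exact: cc|exact: cg].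
have fs' t : flat_at L (g \o c) (fun t => castS L (esym (gc t)) (s 0)) t.
  have [V [h [oV Vx hV hx]]] := section_through (s 0).
  exists V, h; split=> //; first by rewrite /= gc.
  by near=> u; rewrite -hx castS_sec.
rewrite (flat_unique cgc (a := 0) 1 fs fs') ?castS_id // scale1r.
by congr (fun_of_lfun (castS _ _) _); exact: Prop_irrelevance.
Unshelve. all: by end_near. Qed.

End MonodromyPullback.

Section PullbackIso.
Variables (R : realType) (X Y : topologicalType) (h : X -> Y) (ch : continuous h).

Let cid_ : continuous (@idfun X). Proof. by move=> x; exact: cvg_id. Qed.

Lemma flat_pullback_id (L : local_system R Y) s x :
  flat_at (pullback L ch) id s x <-> flat_at L h s x.
Proof. exact: (@flat_pullback R X X Y L h ch id cid_ s x). Qed.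

Lemma id_bij (F : fieldType) (V : vectType F) : bijective (\1%VF : 'End(V)).
Proof. by exists id => v; rewrite id_lfunE. Qed.

Lemma pullback_tensor (K L : local_system R Y) : @isomorphic (LS R X)
  (pullback (tensor K L) ch) (tensor (pullback K ch) (pullback L ch)).
Proof.
apply: (@isomorphic_stalks R X (pullback (tensor K L) ch)
  (tensor (pullback K ch) (pullback L ch)) (fun x => \1%VF)) => [s x|x]; last exact: id_bij.
move=> /flat_pullback_id /(flat_tensor_sum (@ch x))[m [u [v [fu fv E]]]].
have f : flat_at (tensor (pullback K ch) (pullback L ch)) id
    (fun y => \sum_(i <- index_enum 'I_m) (1 : Cx R) *:
      (pure (u i y) (v i y) : stalk (tensor (pullback K ch) (pullback L ch)) y)) x.
  apply: flat_sum => i; apply: (@flat_pure R X X (pullback K ch) (pullback L ch) id).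
    by apply/flat_pullback_id; exact: fu.
  by apply/flat_pullback_id; exact: fv.
apply: flat_near f; near=> y; rewrite id_lfunE.
have -> : s y = \sum_i pure (u i y) (v i y) by near: y.
by apply: eq_bigr => i _; rewrite scale1r.
Unshelve. all: by end_near. Qed.

End PullbackIso.

(** * Irreducibility *)

Section LinearMaps.
Variables (F : fieldType) (V W : vectType F).

Lemma dim0P : \dim {:V} = 0%N <-> forall v : V, v = 0.
Proof.
split=> [/eqP|V0]; first rewrite dimv_eq0 => /eqP V0 v.
  by apply/eqP; rewrite -memv0 -V0 memvf.
by apply/eqP; rewrite dimv_eq0; apply/eqP/vspaceP => v; rewrite (V0 v) !mem0v.
Qed.

Lemma inj_dim_bij (f : 'Hom(V, W)) :
  injective f -> \dim {:V} = \dim {:W} -> bijective f.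
Proof.
move=> /lker0P kf dVW.
have lf : limg f = fullv.
  by apply/eqP; rewrite eqEdim subvf -dVW limg_dim_eq ?leqnn // (eqP kf) capv0.
exists (f^-1)%VF => v; first by rewrite lker0_lfunK.
by rewrite limg_lfunVK // lf memvf.
Qed.

Lemma bij_dim (f : 'Hom(V, W)) : bijective f -> \dim {:V} = \dim {:W}.
Proof.
move=> bf; have /lker0P kf := bij_inj bf.
have <- : limg f = fullv.
  apply/vspaceP => w; rewrite memvf; case: bf => g _ gK.
  by rewrite -(gK w) memv_img ?memvf.
by rewrite limg_dim_eq // (eqP kf) capv0.
Qed.

End LinearMaps.

Section Irreducible.
Variable R : realType.

Lemma irreducible_isomorphic (X : topologicalType) (L M : LS R X) :
  isomorphic L M -> irreducible L -> irreducible M.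
Proof.
move=> LM [[x Lx] irrL]; have [f bf] := isomorphic_bij LM.
have [g bg] := isomorphic_bij (isomorphic_sym LM).
split; first by exists x; rewrite -(bij_dim (bf x)).
move=> N h hi; have [|N0|bgh] := irrL N (ls_comp g h); [|by left|right=> x'].
  by move=> x' /= u v; rewrite !comp_lfunE => /(bij_inj (bg x')) /hi.
apply: inj_dim_bij; first exact: hi.
by rewrite (bij_dim (bgh x')) (bij_dim (bf x')).
Qed.

(** A subobject of [L] is tensored with [A]; inserting a generator of [A] and contracting with a
    form that is 1 on it brings the alternative back to [L]. Applied to a system and to its dual,
    this yields both implications. *)
Lemma irreducible_tensor_reflect (X : topologicalType) (A L : local_system R X) :
  rank_one A -> irreducible (tensor A L) -> irreducible L.
Proof.
move=> A1 [[x ALx] irr].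
have gen y : exists (a : stalk A y) (al : dualsp (stalk A y)), al a = 1.
  have [[a al] /= H] := line_generator (A1 y).
  have [a0|a0] := eqVneq a 0.
    have : \dim {:stalk A y} = 0%N.
      by apply/dim0P => v; rewrite (H v) a0 scaler0.
    by rewrite A1.
  exists a, al; apply/eqP; move/eqP: (H a); rewrite -[X in X == _]scale1r -subr_eq0.
  by rewrite -scalerBl scaler_eq0 (negbTE a0) orbF subr_eq0 eq_sym.
split.
  exists x; apply: contra ALx => /eqP/dim0P L0; apply/eqP/dim0P => T.
  by apply/lfunP => v; rewrite (L0 (T v)) (L0 ((0 : 'Hom(_, _)) v)).
move=> M f fi; have [|M0|bf] := irr (tensor A M) (tensor_mor A f).
- move=> y S T; rewrite /= !tensor_mor_funE => E; apply/lfunP => v.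
  by apply: (fi); rewrite -!comp_lfunE E.
- left => y; apply/dim0P => v; have [a [al a1]] := gen y.
  have := (dim0P _).1 (M0 y) (pure a v : stalk (tensor A M) y).
  by move=> /(congr1 (fun T : tensorsp _ _ => T al)); rewrite pureE a1 scale1r zero_lfunE.
- right => y; have [a [al a1]] := gen y; have [g _ Kg] := bf y.
  have K w : f y ((g (pure a w) : tensorsp _ _) al) = w.
    have := Kg (pure a w); rewrite /= tensor_mor_funE.
    move=> /(congr1 (fun T : tensorsp _ _ => T al)).
    by rewrite comp_lfunE pureE a1 scale1r.
  by exists (fun w => (g (pure a w) : tensorsp _ _) al) => // v; apply: (fi); rewrite K.
Qed.

Section Pullback.
Variables (X B : topologicalType) (g : X -> B) (cg : continuous g).
Variables (F : local_system R B).

Lemma irreducible_pullback_reflect : (forall b, exists x, g x = b) ->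
  irreducible (pullback F cg) -> irreducible F.
Proof.
move=> gs [[x Fx] irr]; split; first by exists (g x).
move=> M f fi; have [|M0|bf] := irr (pullback M cg) (pullback_mor cg f).
- by move=> y; exact: fi.
- by left=> b; have [y <-] := gs b; exact: M0 y.
- by right=> b; have [y <-] := gs b; exact: bf y.
Qed.

Variables (sg : B -> X) (csg : continuous sg).
Hypothesis sgF : @isomorphic (LS R B) (pullback (pullback F cg) csg) F.

(** A subobject [M] restricts along the section to a subobject of a system isomorphic to [F]. The
    isomorphisms given by descent enter only through the dimensions of stalks, since an injective
    map between spaces of equal dimension is bijective. *)
Lemma irreducible_pullback :

  (forall (M : LS R X) (f : ls_hom M (pullback F cg)), (forall x, injective (f x)) ->
     @isomorphic (LS R X) (pullback (pullback M csg) cg) M) ->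
  irreducible F -> irreducible (pullback F cg).
Proof.
move=> desc irrF; have [h bh] := isomorphic_bij sgF.
have [[b Fb] irr] := irreducible_isomorphic (isomorphic_sym sgF) irrF.
split; first by exists (sg b).
move=> M f fi; have [k bk] := isomorphic_bij (desc M f fi).
have [|M0|bf] := irr (pullback M csg) (pullback_mor csg f).
- by move=> y; exact: fi.
- by left=> x; rewrite -(bij_dim (bk x)); exact: (M0 (g x)).
- right=> x; apply: inj_dim_bij; first exact: fi.
  rewrite -(bij_dim (bk x)) (bij_dim (bf (g x))).
  exact: bij_dim (bh (g x)).
Qed.

End Pullback.
End Irreducible.

(** * Complex numbers *)

Section PointwiseContinuity.
Variables (T U V : topologicalType) (K : numFieldType) (x : T).

Lemma continuous_at_comp (f : T -> U) (g : U -> V) :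
  {for x, continuous f} -> {for f x, continuous g} ->
  {for x, continuous (fun t => g (f t))}.
Proof. by move=> cf cg; exact: (continuous_comp cf cg). Qed.

Lemma continuous_at_cst (y : U) : {for x, continuous (fun _ : T => y)}.
Proof. exact: cst_continuous. Qed.

Lemma continuous_atD (f g : T -> K) :
  {for x, continuous f} -> {for x, continuous g} ->
  {for x, continuous (fun t => f t + g t)}.
Proof. by move=> cf cg; exact: (cvgD cf cg). Qed.

Lemma continuous_atB (f g : T -> K) :
  {for x, continuous f} -> {for x, continuous g} ->
  {for x, continuous (fun t => f t - g t)}.
Proof. by move=> cf cg; exact: (cvgB cf cg). Qed.

Lemma continuous_atM (f g : T -> K) :
  {for x, continuous f} -> {for x, continuous g} ->
  {for x, continuous (fun t => f t * g t)}.
Proof. by move=> cf cg; exact: (cvgM cf cg). Qed.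

Lemma continuous_atV (f : T -> K) : f x != 0 ->
  {for x, continuous f} -> {for x, continuous (fun t => (f t)^-1)}.
Proof. by move=> f0 cf; exact: (cvgV f0 cf). Qed.

Lemma continuous_at_sum (I : Type) (r : seq I) (f : I -> T -> K) :
  (forall i, {for x, continuous (f i)}) ->
  {for x, continuous (fun t => \sum_(i <- r) f i t)}.
Proof.
move=> cf; elim: r => [|i r IH].
  have -> : (fun t => \sum_(i <- [::]) f i t) = fun=> 0.
    by apply/funext => t; rewrite big_nil.
  exact: cst_continuous.
have -> : (fun t => \sum_(j <- i :: r) f j t) = fun t => f i t + \sum_(j <- r) f j t.
  by apply/funext => t; rewrite big_cons.
exact: continuous_atD.
Qed.

End PointwiseContinuity.

Lemma continuous_at_max (R : realType) (T : topologicalType) (x : T) (f g : T -> R) :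
  {for x, continuous f} -> {for x, continuous g} ->
  {for x, continuous (fun t => Num.max (f t) (g t))}.
Proof. by move=> cf cg; exact: (@continuous_max R T f g x cf cg). Qed.

Lemma continuous_at_min (R : realType) (T : topologicalType) (x : T) (f g : T -> R) :
  {for x, continuous f} -> {for x, continuous g} ->
  {for x, continuous (fun t => Num.min (f t) (g t))}.
Proof. by move=> cf cg; exact: (@continuous_min R T f g x cf cg). Qed.

Lemma continuous_at_id (T : topologicalType) (x : T) : {for x, continuous (fun t : T => t)}.
Proof. exact: cvg_id. Qed.

Lemma continuous_at_fst (Y Z : topologicalType) (x : Y * Z) : {for x, continuous (@fst Y Z)}.
Proof. exact: cvg_fst. Qed.

Lemma continuous_at_snd (Y Z : topologicalType) (x : Y * Z) : {for x, continuous (@snd Y Z)}.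
Proof. exact: cvg_snd. Qed.

Section Modulus.
Variable R : realType.
Local Notation C := (Cx R).
Implicit Types z w : C.

(** The norm on [Cx R] takes values in [Cx R]; real analysis requires its value as a real number. *)
Definition cmod z : R := complex.Re `|z|.

Lemma cmodE z : `|z| = (cmod z)%:C.
Proof. by rewrite /cmod RRe_real // ger0_real. Qed.

Lemma cmod_ge0 z : 0 <= cmod z.
Proof. by rewrite -(lecR 0) -cmodE; exact: normr_ge0. Qed.

Lemma cmod_eq0 z : (cmod z == 0) = (z == 0).
Proof. by rewrite -(inj_eq (@complexI R)) -cmodE normr_eq0. Qed.

Lemma cmod_gt0 z : (0 < cmod z) = (z != 0).
Proof. by rewrite lt_def cmod_ge0 andbT cmod_eq0. Qed.

Lemma cmod0 : cmod 0 = 0.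
Proof. by apply/eqP; rewrite cmod_eq0. Qed.

Lemma cmodM z w : cmod (z * w) = cmod z * cmod w.
Proof. by apply: complexI; rewrite rmorphM -!cmodE normrM. Qed.

Lemma cmodV z : cmod z^-1 = (cmod z)^-1.
Proof. by apply: complexI; rewrite fmorphV -!cmodE normfV. Qed.

Lemma cmodX z m : cmod (z ^+ m) = cmod z ^+ m.
Proof. by apply: complexI; rewrite rmorphXn -!cmodE normrX. Qed.

Lemma cmodB z w : cmod (z - w) = cmod (w - z).
Proof. by apply: complexI; rewrite -!cmodE distrC. Qed.

Lemma cmod_real (x : R) : 0 <= x -> cmod x%:C = x.
Proof. by move=> x0; apply: complexI; rewrite -cmodE ger0_norm // (lecR 0). Qed.

Lemma cmodX_unit z (m : int) : cmod z = 1 -> cmod (z ^ m) = 1.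
Proof.
by move=> z1; case: m => m; rewrite -?exprnP -?exprnN ?cmodV cmodX z1 expr1n ?invr1.
Qed.

Lemma cmod_Re_le z : `|complex.Re z| <= cmod z.
Proof. by rewrite -lecR -cmodE normc_ge_Re. Qed.

Lemma cmod_Im_le z : `|complex.Im z| <= cmod z.
Proof.
by rewrite /cmod normc_def /= -sqrtr_sqr ler_wsqrtr // lerDr sqr_ge0.
Qed.

Lemma nbhs_cmod (z : C) (A : set C) : nbhs z A <->
  exists2 e : R, 0 < e & forall w, cmod (z - w) < e -> A w.
Proof.
split=> [/nbhs_ballP[e /= e0 eA]|[e e0 eA]].
  have er : e = (complex.Re e)%:C by rewrite RRe_real // gtr0_real.
  exists (complex.Re e); first by rewrite -(ltcR 0) -er.
  by move=> w we; apply: eA; rewrite /ball /= er cmodE ltcR.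
apply/nbhs_ballP; exists e%:C => /=; first by rewrite (ltcR 0).
by move=> w; rewrite /ball /= cmodE ltcR; exact: eA.
Qed.

Lemma real_continuous_cmod (f : C -> R) :
  (forall z w, `|f z - f w| <= cmod (z - w)) -> continuous f.
Proof.
move=> fl z A /nbhs_ballP[e /= e0 eA]; apply/nbhs_cmod; exists e => // w we.
by apply: eA; rewrite /ball /=; exact: le_lt_trans (fl z w) we.
Qed.

Lemma Re_continuous : continuous (@complex.Re R : C -> R).
Proof.
by apply: real_continuous_cmod => -[a b] [a' b']; apply: (cmod_Re_le (_ +i* _)).
Qed.

Lemma Im_continuous : continuous (@complex.Im R : C -> R).
Proof.
by apply: real_continuous_cmod => -[a b] [a' b']; apply: (cmod_Im_le (_ +i* _)).
Qed.

Lemma cmod_continuous : continuous cmod.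
Proof.
apply: real_continuous_cmod => z w.
have tri u v : cmod u - cmod v <= cmod (u - v).
  have := lerB_dist u v; rewrite !cmodE -(@raddfB R C (real_complex R)).
  by rewrite lecR.
by rewrite ler_norml tri andbT lerNl opprB cmodB tri.
Qed.

Lemma real_complex_continuous : continuous (fun x : R => x%:C : C).
Proof.
move=> x A /nbhs_cmod[e e0 eA]; apply/nbhs_ballP; exists e => //= y.
rewrite /ball /= => xy; apply: eA; rewrite -rmorphB.
have -> : cmod (x - y)%:C = `|x - y| :> R; last by [].
by rewrite /cmod normc_def /= expr0n addr0 sqrtr_sqr.
Qed.

Lemma exprz_continuous (m : int) z : z != 0 -> {for z, continuous (fun w : C => w ^ m)}.
Proof.
move=> z0; case: m => m; first exact: (@expr_continuous R m z).
apply: (@cvgV _ _ (nbhs z) _ (fun w : C => w ^+ m.+1)); first by rewrite expf_neq0.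
exact: (@expr_continuous R m.+1 z).
Qed.

End Modulus.

(** * The unit circle and local branches of the argument *)

Section UnitLoop.
Variable R : realType.
Local Notation C := (Cx R).
Local Notation e := (@unit_loop R).

Lemma unit_loopD t u : e (t + u) = e t * e u.
Proof.
apply/eqP; rewrite eq_complex /unit_loop /= mulrDr cosD sinD eqxx /=.
by rewrite [X in _ == X]addrC mulrC [X in _ == X + _]mulrC; apply/eqP; ring.
Qed.

Lemma unit_loop0 : e 0 = 1.
Proof. by rewrite /unit_loop mulr0 cos0 sin0. Qed.

Lemma cmod_unit_loop t : cmod (e t) = 1.
Proof. by rewrite /cmod normc_def /= cos2Dsin2 sqrtr1. Qed.

Lemma unit_loop_neq0 t : e t != 0.
Proof. by rewrite -cmod_eq0 cmod_unit_loop oner_eq0. Qed.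

Lemma unit_loopMn (m : nat) t : e (m%:R * t) = e t ^+ m.
Proof.
elim: m => [|m IH]; first by rewrite mul0r unit_loop0.
by rewrite -natr1 mulrDl mul1r unit_loopD IH exprSr.
Qed.

Lemma unit_loopB t u : e (t - u) = e t / e u.
Proof.
by apply: (mulIf (unit_loop_neq0 u)); rewrite -unit_loopD subrK divfK // unit_loop_neq0.
Qed.

Lemma unit_loop1 : e 1 = 1.
Proof. by rewrite /unit_loop mulr1 mulr_natl cos2pi sin2pi. Qed.

Lemma unit_loop_continuous : continuous e.
Proof.
move=> t; have -> : e = fun t => (cos (2 * pi * t))%:C + 'i%C * (sin (2 * pi * t))%:C.
  by apply/funext => u; rewrite {1}/unit_loop [LHS]complexE.
have cl : {for t, continuous (fun t : R => 2 * pi * t)}.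
  by apply: cvgM; [exact: cvg_cst|exact: cvg_id].
apply: (@cvgD C C); last apply: (@cvgM C); [|exact: cvg_cst|].
  apply: (@continuous_comp R R C (fun t => cos (2 * pi * t)) (fun x => x%:C)).
    by apply: (@continuous_comp R R R (fun t => 2 * pi * t) cos) => //; exact: continuous_cos.
  exact: real_complex_continuous.
apply: (@continuous_comp R R C (fun t => sin (2 * pi * t)) (fun x => x%:C)).
  by apply: (@continuous_comp R R R (fun t => 2 * pi * t) sin) => //; exact: continuous_sin.
exact: real_complex_continuous.
Qed.

(** After removal of the integer part, the half-angle formula turns [cos (2 * pi * x) = 1] into
    [sin (pi * x) = 0], which is impossible for [0 < x < 1]. *)
Lemma unit_loop_eq1 t : e t = 1 -> exists m : int, t = m%:~R.
Proof.
move=> et; exists (Num.floor t).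
pose x := t - (Num.floor t)%:~R.
suff : x = 0 by move/eqP; rewrite subr_eq0 => /eqP.
have ez (m : int) : e m%:~R = 1.
  case: m => m; first by rewrite -[_%:~R]mulr1 unit_loopMn unit_loop1 expr1n.
  rewrite NegzE mulrNz -[- _]sub0r unit_loopB unit_loop0.
  by rewrite -[_%:~R]mulr1 unit_loopMn unit_loop1 expr1n divr1.
have ex : e x = 1 by rewrite /x unit_loopB et ez divr1.
have x0 : 0 <= x by rewrite subr_ge0 floor_le.
have x1 : x < 1 by rewrite ltrBlDl -[X in _ + X]/(1%:~R) -intrD floorD1_gt.
apply/eqP; rewrite eq_le x0 andbT leNgt; apply/negP => xp.
have s0 : 0 < sin (pi * x).
  by apply: sin_gt0_pi; rewrite mulr_gt0 ?pi_gt0 //= gtr_pMr // pi_gt0.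
have : cos (2 * pi * x) = 1 by case: ex.
rewrite -mulrA mulr_natl cos_mulr2n cos2sin2 => /eqP; rewrite mulrnBl.
move: s0; set s := sin _ => s0 /eqP E.
have : s ^+ 2 = 0 by move: E; lra.
by move/eqP; rewrite expf_eq0 /= gt_eqF.
Qed.

Lemma unit_loop_surj (v : C) : cmod v = 1 -> exists t, e t = v.
Proof.
case: v => a b v1.
have ab : a ^+ 2 + b ^+ 2 = 1.
  have : cmod (a +i* b) ^+ 2 = 1 by rewrite v1 expr1n.
  by rewrite /cmod normc_def /= sqr_sqrtr // addr_ge0 ?sqr_ge0.
have a1 : -1 <= a <= 1.
  by rewrite -ler_norml -(@ler_pXn2r _ 2) ?nnegrE // expr1n real_normK ?num_real // -ab lerDl sqr_ge0.
have pi2 : 2 * pi != 0 :> R by rewrite mulf_neq0 // gt_eqF // pi_gt0.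
have sa : sin (acos a) = `|b|.
  by rewrite sin_acos // -ab addrC addKr sqrtr_sqr.
have [b0|b0] := leP 0 b.
  exists (acos a / (2 * pi)); rewrite /unit_loop mulrC divfK // acosK ?in_itv //.
  by rewrite sa ger0_norm.
exists (- acos a / (2 * pi)); rewrite /unit_loop mulrC divfK // cosN sinN acosK ?in_itv //.
by rewrite sa ltr0_norm // opprK.
Qed.

Lemma unit_loop_atan (x y : R) : 0 < x -> x ^+ 2 + y ^+ 2 = 1 ->
  e (atan (y / x) / (2 * pi)) = x +i* y.
Proof.
move=> x0 xy.
have pi2 : 2 * pi != 0 :> R by rewrite mulf_neq0 // gt_eqF // pi_gt0.
rewrite /unit_loop mulrC divfK //.
have ca : cos (atan (y / x)) = x.
  rewrite cos_atan; have -> : 1 + (y / x) ^+ 2 = x^-1 ^+ 2.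
    have x0' : x != 0 by rewrite gt_eqF.
    rewrite exprMn exprVn -[X in X + _](@mulfV _ (x ^+ 2)) ?expf_neq0 // -mulrDl xy mul1r.
    by [].
  by rewrite sqrtr_sqr ger0_norm ?invrK // invr_ge0 ltW.
have sa : sin (atan (y / x)) = y.
  have xV : x^-1 != 0 by rewrite invr_eq0 gt_eqF.
  by apply: (mulIf xV); rewrite -[RHS](atanK (y / x)) /tan ca.
by rewrite ca sa.
Qed.

Lemma arg_branch (v0 : C) : cmod v0 = 1 ->
  exists2 A : C -> R, continuous A & \forall v \near v0, cmod v = 1 -> e (A v) = v.
Proof.
move=> v01; have [t0 et0] := unit_loop_surj v01.
have v00 : v0 != 0 by rewrite -cmod_eq0 v01 oner_eq0.
(* Truncating the real part at 1/2 makes the quotient continuous everywhere; near [v0] the real part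
   of [v / v0] exceeds 1/2 and the truncation is inactive. *)
pose h (v : C) : R := Num.max (complex.Re v) (1 / 2).
have h0 v : 0 < h v by rewrite /h lt_max divr_gt0 ?orbT.
pose A (v : C) := t0 + atan (complex.Im (v / v0) / h (v / v0)) / (2 * pi).
have cq v : {for v, continuous (fun v : C => v / v0)}.
  by apply: continuous_atM; [exact: continuous_at_id|exact: continuous_at_cst].
have cA v : {for v, continuous A}.
  rewrite /A; apply: continuous_atD; first exact: continuous_at_cst.
  apply: continuous_atM; last exact: continuous_at_cst.
  apply: (@continuous_at_comp C R R v _ atan); last exact: continuous_atan.
  apply: (@continuous_at_comp C C R v _ (fun v => complex.Im v / h v)) => //.
  apply: continuous_atM; first exact: Im_continuous.
  apply: continuous_atV; first by rewrite gt_eqF.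
  rewrite /h; apply: continuous_at_max; first exact: Re_continuous.
  exact: continuous_at_cst.
exists A; first exact: cA.
have : \forall v \near v0, 1 / 2 < complex.Re (v / v0).
  have c : {for v0, continuous (fun v : C => complex.Re (v / v0))}.
    by apply: (@continuous_at_comp C C R v0) => //; exact: Re_continuous.
  have h1 : 1 / 2 < complex.Re (v0 / v0) by rewrite divff //=; lra.
  exact: (c _ (lt_nbhsr h1)).
apply: filterS => v vr v1.
rewrite /A unit_loopD et0.
have -> : h (v / v0) = complex.Re (v / v0) by apply/max_idPl; exact: ltW.
rewrite unit_loop_atan; [|by apply: lt_trans vr; lra|].
  by case: (v / v0) (divfK v00 v) => a b /= <-; rewrite mulrC.
have : cmod (v / v0) ^+ 2 = 1 by rewrite cmodM cmodV v1 v01 invr1 mulr1 expr1n.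
by rewrite /cmod normc_def /= sqr_sqrtr // addr_ge0 ?sqr_ge0.
Qed.

End UnitLoop.

Section Root.
Variables (R : realType) (k : nat).
Hypothesis k0 : (0 < k)%N.

Definition kroot (a : R) : R := expR (ln a / k%:R).

Lemma krootK a : 0 < a -> kroot a ^+ k = a.
Proof.
move=> a0; rewrite /kroot -expRM_natl mulrC divfK ?lnK //.
by rewrite pnatr_eq0 -lt0n.
Qed.

Lemma kroot_continuous a : 0 < a -> {for a, continuous kroot}.
Proof.
move=> a0; apply: (@continuous_comp _ _ _ (fun a => ln a / k%:R) (@expR R)).
  by apply: cvgM; [exact: continuous_ln|exact: cvg_cst].
exact: continuous_expR.
Qed.

End Root.

(** * Discs around the punctures *)

Lemma convex_gt0 (R : realType) (t a b : R) : 0 <= t -> t <= 1 -> 0 < a -> 0 < b ->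
  0 < (1 - t) * a + t * b.
Proof.
move=> t0 t1 a0 b0; have [t1'|t1'] := ltP t 1.
  by rewrite ltr_pwDl ?mulr_gt0 ?subr_gt0 // mulr_ge0 // ltW.
have -> : t = 1 by apply/eqP; rewrite eq_le t1.
by rewrite subrr mul0r add0r mul1r.
Qed.

Lemma convex_itv (R : realType) (t a b : R) : 0 <= t -> t <= 1 -> a <= b ->
  a <= (1 - t) * a + t * b <= b /\ a <= (1 - t) * b + t * a <= b.
Proof. by move=> t0 t1 ab; split; apply/andP; split; nra. Qed.

Lemma convex_complex (R : realType) (t q : R) :
  (1 - t + t * q)%:C = 1 - t%:C + t%:C * q%:C :> Cx R.
Proof. by rewrite rmorphD rmorphB rmorphM rmorph1. Qed.

Section Discs.
Variables (R : realType) (l : nat) (Cf : 'I_l -> Cx R).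
Local Notation C := (Cx R).
Implicit Types (c : C) (j : puncture l).

(* A disc around infinity is the exterior of a disc centered at 0. *)
Definition disc_center j : C := if j is p_root i then Cf i else 0.

Definition in_disc (rho : puncture l -> R) j c : Prop :=
  match j with
  | p_infty => rho j <= cmod (c - disc_center j)
  | _ => cmod (c - disc_center j) <= rho j
  end.

Definition on_circle (rho : puncture l -> R) j c := cmod (c - disc_center j) = rho j.

Definition disjoint_discs (rho : puncture l -> R) : Prop :=
  (forall j, 0 < rho j) /\ (forall i j c, in_disc rho i c -> in_disc rho j c -> i = j).

Definition off_centers c : Prop := forall j, c != disc_center j.

Lemma on_circle_disc rho j c : on_circle rho j c -> in_disc rho j c.
Proof. by rewrite /on_circle /in_disc; case: j => [|i|] ->. Qed.

(** Any other finite center lies in its own disc, which is disjoint from the j-th. Infinity shares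
    the center 0 with [p_zero] and reduces to that case. *)
Lemma in_disc_off rho j c : disjoint_discs rho -> in_disc rho j c ->
  c != disc_center j -> off_centers c.
Proof.
move=> [rho0 dis] cj nc i; apply/eqP => ci.
have fin i' : i' <> p_infty -> c != disc_center i'.
  move=> ii; apply/eqP => E; have H : in_disc rho i' c.
    by rewrite E; case: i' ii {E} => [|i'|] //= _; rewrite subrr cmod0 ltW.
  by move: E; rewrite (dis i' j c) //; apply/eqP.
case: i ci => [|i|]; [exact/eqP/fin|exact/eqP/fin|].
exact/eqP/(fin p_zero).
Qed.

(** Homotopies are indexed by all of [R]; clamping stops them outside the unit interval. *)
Definition clamp (t : R) : R := Num.max 0 (Num.min t 1).

Lemma clamp_itv t : 0 <= clamp t <= 1.
Proof. by rewrite /clamp le_max lexx ge_max ler01 ge_min lexx orbT. Qed.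

Lemma clamp0 : clamp 0 = 0.
Proof. by rewrite /clamp; apply/max_idPl; rewrite ge_min lexx. Qed.

Lemma clamp1 : clamp 1 = 1.
Proof. by rewrite /clamp minxx; apply/max_idPr. Qed.

Lemma clamp_continuous t : {for t, continuous clamp}.
Proof.
apply: continuous_at_max; first exact: continuous_at_cst.
by apply: continuous_at_min; [exact: continuous_at_id|exact: continuous_at_cst].
Qed.

Definition scale_at (a : C) (m : R) c : C := a + m%:C * (c - a).

Lemma cmod_scale_at a m c : 0 <= m -> cmod (scale_at a m c - a) = m * cmod (c - a).
Proof. by move=> m0; rewrite /scale_at addrC addKr cmodM cmod_real. Qed.

Lemma scale_at_id a c : scale_at a 1 c = c.
Proof. by rewrite /scale_at mul1r addrC subrK. Qed.

Section Radial.
Variables (rho rho' : puncture l -> R).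
Hypotheses (dis : disjoint_discs rho) (dis' : disjoint_discs rho').

(* The path stays in the larger of the two discs, which contains no other
   puncture. *)
Lemma radial_off j c (t : R) : on_circle rho j c ->
  off_centers (scale_at (disc_center j) (1 - clamp t + clamp t * (rho' j / rho j)) c).
Proof.
move=> cj; have r0 := dis.1 j; have r0' := dis'.1 j.
have /andP[t0 t1] := clamp_itv t; move: (clamp t) t0 t1 => {}t t0 t1.
set m := 1 - t + t * _; have m0 : 0 < m.
  by rewrite /m -[1 - t]mulr1 convex_gt0 ?divr_gt0.
have E : cmod (scale_at (disc_center j) m c - disc_center j) = (1 - t) * rho j + t * rho' j.
  rewrite cmod_scale_at ?ltW // cj /m mulrDl -mulrA -(mulrA (rho' j)) mulVf ?gt_eqF //.
  by rewrite mulr1.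
have nc : scale_at (disc_center j) m c != disc_center j.
  by rewrite -subr_eq0 -cmod_eq0 E gt_eqF // convex_gt0.
have [le|le] : in_disc rho j (scale_at (disc_center j) m c) \/ in_disc rho' j (scale_at (disc_center j) m c).
(* The distance to the center stays between the two radii. The larger disc is the one of larger
   radius at a finite puncture and the one of smaller radius at infinity. *)
- have [h|/ltW h] := leP (rho j) (rho' j);
    have [/andP[h1 h2] /andP[h3 h4]] := convex_itv t0 t1 h;
    rewrite /in_disc; move: E h1 h2 h3 h4; case: (j) => [|i|] -> *; by [left|right].
- exact: (in_disc_off dis le nc).
- exact: (in_disc_off dis' le nc).
Qed.

End Radial.

Section Retraction.
Variable rho : puncture l -> R.
Hypothesis dis : disjoint_discs rho.

(** The relative displacement that brings a point of the disc to its circle: outward, hence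
    nonnegative, at a finite puncture, inward at infinity. The truncation at 0 extends it
    continuously by zero outside the disc. *)
Definition excess j c : R :=
  match j with
  | p_infty => Num.min 0 (rho j / cmod (c - disc_center j) - 1)
  | _ => Num.max 0 (rho j / cmod (c - disc_center j) - 1)
  end.

Definition push j c : C := (excess j c)%:C * (c - disc_center j).

(* Pushes each disc radially onto its boundary circle and fixes the rest: since
   the discs are disjoint, at most one of the summands is nonzero. *)
Definition retract c : C :=
  c + (push p_zero c + \sum_(i < l) push (p_root i) c + push p_infty c).

Lemma excess_out j c : off_centers c -> ~ in_disc rho j c -> excess j c = 0.
Proof.
move=> offc; have c0 : 0 < cmod (c - disc_center j) by rewrite cmod_gt0 subr_eq0.
rewrite /in_disc /excess; case: j c0 => [|i|] c0 /negP; rewrite -ltNge => lt;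
  [apply/max_idPl|apply/max_idPl|apply/min_idPl].
- by rewrite subr_le0 ler_pdivrMr // mul1r ltW.
- by rewrite subr_le0 ler_pdivrMr // mul1r ltW.
- by rewrite subr_ge0 ler_pdivlMr // mul1r ltW.
Qed.

Lemma excess_in j c : off_centers c -> in_disc rho j c ->
  excess j c = rho j / cmod (c - disc_center j) - 1.
Proof.
move=> offc; have c0 : 0 < cmod (c - disc_center j) by rewrite cmod_gt0 subr_eq0.
rewrite /in_disc /excess; case: j c0 => [|i|] c0 lt;
  [apply/max_idPr|apply/max_idPr|apply/min_idPr].
- by rewrite subr_ge0 ler_pdivlMr // mul1r.
- by rewrite subr_ge0 ler_pdivlMr // mul1r.
- by rewrite subr_le0 ler_pdivrMr // mul1r.
Qed.

Lemma retract_out c : off_centers c -> (forall j, ~ in_disc rho j c) -> retract c = c.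
Proof.
move=> offc out; have P0 j : push j c = 0 by rewrite /push excess_out // mul0r.
by rewrite /retract !P0 big1 ?addr0.
Qed.

Lemma retract_in j c : off_centers c -> in_disc rho j c ->
  retract c = scale_at (disc_center j) (rho j / cmod (c - disc_center j)) c.
Proof.
move=> offc cj.
have P0 i : i <> j -> push i c = 0.
  move=> ij; rewrite /push excess_out ?mul0r // => ci; apply: ij.
  exact: dis.2 ci cj.
have -> : retract c = c + push j c.
  rewrite /retract; congr (_ + _); case: j cj P0 => [|i|] cj P0.
  - by rewrite big1 ?(P0 p_infty) ?addr0 // => i _; rewrite P0.
  - rewrite (bigD1 i) //= big1 ?(P0 p_zero) ?(P0 p_infty) ?addr0 ?add0r // => i' ii.
    by rewrite P0 // => -[ii']; move: ii; rewrite ii' eqxx.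
  - by rewrite big1 ?(P0 p_zero) ?add0r // => i _; rewrite P0.
rewrite /push excess_in // /scale_at rmorphB /= mulrBl mul1r.
by rewrite addrCA addrC opprB addrCA subrr addr0 addrC.
Qed.

Lemma retract_fix c : off_centers c ->
  (forall j, in_disc rho j c -> on_circle rho j c) -> retract c = c.
Proof.
move=> offc bd; have [[j cj]|nj] := pselect (exists j, in_disc rho j c).
  rewrite (retract_in offc cj) (bd j cj) mulfV ?scale_at_id //.
  by rewrite gt_eqF // dis.1.
by apply: retract_out => // j cj; apply: nj; exists j.
Qed.

Lemma retract_boundary c j : off_centers c -> in_disc rho j (retract c) ->
  on_circle rho j (retract c).
Proof.
move=> offc; have [[i ci]|ni] := pselect (exists i, in_disc rho i c).
  have c0 : 0 < cmod (c - disc_center i) by rewrite cmod_gt0 subr_eq0.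
  have bd : on_circle rho i (retract c).
    rewrite (retract_in offc ci) /on_circle cmod_scale_at ?divfK ?gt_eqF //.
    by rewrite divr_ge0 ?ltW ?dis.1.
  by move=> /(dis.2 _ _ _ (on_circle_disc bd)) <-.
by rewrite retract_out // => [cj|i ci]; case: ni; [exists j|exists i].
Qed.

(** Inside a disc the path is a family of homotheties about the center; the distance stays between
    the initial one and the radius, so the path remains in that disc and off its center. *)
Lemma retract_path_off c t : off_centers c ->
  off_centers (c + (clamp t)%:C * (retract c - c)).
Proof.
move=> offc; have [[j cj]|nj] := pselect (exists j, in_disc rho j c); last first.
  rewrite retract_out // ?subrr ?mulr0 ?addr0 //.
  by move=> j cj; apply: nj; exists j.
have /andP[t0 t1] := clamp_itv t; move: (clamp t) t0 t1 => {}t t0 t1.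
have c0 : 0 < cmod (c - disc_center j) by rewrite cmod_gt0 subr_eq0.
have r0 : 0 < rho j := dis.1 j.
set q := rho j / cmod (c - disc_center j); have q0 : 0 < q by rewrite divr_gt0.
have m0 : 0 < 1 - t + t * q by rewrite -[1 - t]mulr1 convex_gt0.
have -> : c + t%:C * (retract c - c) = scale_at (disc_center j) (1 - t + t * q) c.
  rewrite (retract_in offc cj) -/q /scale_at convex_complex; ring.
have E : cmod (scale_at (disc_center j) (1 - t + t * q) c - disc_center j) =
    (1 - t) * cmod (c - disc_center j) + t * rho j.
  by rewrite cmod_scale_at ?ltW // mulrDl -mulrA divfK ?gt_eqF.
apply: (@in_disc_off rho j) => //; last first.
  by rewrite -subr_eq0 -cmod_eq0 E gt_eqF // convex_gt0.
move: cj; rewrite /in_disc E; case: (j) => [|i|] h;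
  have [/andP[h1 h2] /andP[h3 h4]] := convex_itv t0 t1 h => //.
Qed.

Lemma retract_continuous c : off_centers c -> {for c, continuous retract}.
Proof.
move=> offc.
have cq j : {for c, continuous (fun c => rho j / cmod (c - disc_center j) - 1)}.
  apply: continuous_atB; last exact: continuous_at_cst.
  apply: continuous_atM; first exact: continuous_at_cst.
  apply: continuous_atV; first by rewrite gt_eqF // cmod_gt0 subr_eq0.
  apply: (@continuous_at_comp _ _ _ c (fun c => c - disc_center j)); last exact: cmod_continuous.
  by apply: continuous_atB; [exact: continuous_at_id|exact: continuous_at_cst].
have cp j : {for c, continuous (push j)}.
  apply: continuous_atM; last first.
    by apply: continuous_atB; [exact: continuous_at_id|exact: continuous_at_cst].
  apply: (@continuous_at_comp _ _ _ c (excess j)); last exact: real_complex_continuous.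
  case: j {cq} (cq j) => [|i|] cq; [apply: continuous_at_max|apply: continuous_at_max|
    apply: continuous_at_min] => //; exact: continuous_at_cst.
apply: continuous_atD; first exact: continuous_at_id.
apply: continuous_atD; last exact: cp.
apply: continuous_atD; first exact: cp.
by apply: continuous_at_sum => i; exact: cp.
Qed.

End Retraction.
End Discs.

(** * Fibers of the slope *)

Section Bezout.
Variables (F : fieldType) (n k : nat) (r s : int).
Hypothesis hrs : r * n%:Z = k%:Z * s + 1.
Implicit Types x y : F.

(** The curve [x ^+ n = y ^+ k] is parametrized by [v |-> (v ^+ k, v ^+ n)]; since
    [r * n - k * s = 1], the inverse is [y ^ r * x ^ (- s)]. *)
Lemma bezout_pow x y : x != 0 -> y != 0 -> x ^+ n = y ^+ k ->
  (y ^ r * x ^ (- s)) ^+ k = x /\ (y ^ r * x ^ (- s)) ^+ n = y.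
Proof.
move=> x0 y0 E.
have P z (a : int) m : (z ^ a) ^+ m = (z ^+ m) ^ a by rewrite !exprnP !exprz_exp mulrC.
have e1 : n%:Z * r - k%:Z * s = 1 by rewrite mulrC hrs addrC addKr.
split; rewrite exprMn !P.
  rewrite -E !exprnP !exprz_exp -expfzDr //.
  by rewrite [X in x ^ X](_ : _ = 1) ?expr1z // -e1; ring.
rewrite E !exprnP !exprz_exp -expfzDr //.
by rewrite [X in y ^ X](_ : _ = 1) ?expr1z // -e1; ring.
Qed.

Lemma bezout_pow1 x : x ^+ k = 1 -> x ^+ n = 1 -> x = 1.
Proof.
have [-> /eqP|x0] := eqVneq x 0.
  (* As [0 ^+ 0 = 1], the case [x = 0] survives only for [k = n = 0], which the Bezout relation
     excludes. *)
  rewrite expr0n; case: (k) (hrs) => [|k'] h; last by rewrite eq_sym oner_eq0.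
  case: (n) h => [|n'] h; last by move=> _ /eqP; rewrite expr0n eq_sym oner_eq0.
  by move: h; rewrite mulr0 mul0r.
move=> xk xn.
have [|<- _] := @bezout_pow x 1 x0 (oner_neq0 _); first by rewrite xn expr1n.
by rewrite exp1rz mul1r exprnP exprz_exp mulrC -exprz_exp -exprnP xk exp1rz.
Qed.

End Bezout.

Section Points.
Variables (R : realType) (n k : nat) (r s : int).
Local Notation C := (Cx R).
Hypothesis hk : (0 < k)%N.
Hypothesis hrs : r * n%:Z = k%:Z * s + 1.
Local Notation e := (@unit_loop R).
Local Notation slope := (slope n k).

(* With [u = c / |c|], the slope of this point is [|c| * u ^ (r n - s k)], and
   [r n - s k = 1]. *)
Definition fiber_pt (c : C) (a : R) : C * C :=
  (a%:C * (c / (cmod c)%:C) ^ (- r),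
   (kroot k (cmod c * a ^+ n))%:C * (c / (cmod c)%:C) ^ (- s)).

Lemma cmod_arg (c : C) : c != 0 -> cmod (c / (cmod c)%:C) = 1.
Proof.
move=> c0; rewrite cmodM cmodV cmod_real ?cmod_ge0 // divff //.
by rewrite cmod_eq0.
Qed.

Lemma real_complex_neq0 (a : R) : (a%:C == 0 :> C) = (a == 0).
Proof. by rewrite -(inj_eq (@complexI R)). Qed.

Section FiberPt.
Variables (c : C) (a : R).
Hypotheses (c0 : c != 0) (a0 : 0 < a).

Let u := c / (cmod c)%:C.
Let u0 : u != 0.
Proof. by rewrite -cmod_eq0 cmod_arg // oner_eq0. Qed.

Lemma cmod_fiber_pt1 : cmod (fiber_pt c a).1 = a.
Proof. by rewrite cmodM cmodX_unit ?cmod_arg // mulr1 cmod_real // ltW. Qed.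

Lemma fiber_pt1_neq0 : (fiber_pt c a).1 != 0.
Proof. by rewrite -cmod_eq0 cmod_fiber_pt1 gt_eqF. Qed.

Lemma slope_fiber_pt : slope (fiber_pt c a) = c.
Proof.
rewrite /Defs.slope /= -/u !exprMn -!rmorphXn /= krootK //; last first.
  by rewrite mulr_gt0 ?cmod_gt0 // exprn_gt0.
have an : (a ^+ n)%:C != 0 :> C by rewrite real_complex_neq0 expf_neq0 // gt_eqF.
have cc : (cmod c)%:C != 0 :> C by rewrite real_complex_neq0 cmod_eq0.
have E : (u ^ (- s)) ^+ k / (u ^ (- r)) ^+ n = u.
  rewrite !exprnP !exprz_exp invr_expz -expfzDr //.
  rewrite [X in u ^ X](_ : _ = 1) ?expr1z //.
  have -> : - (- r * n) = r * n by ring.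
  by rewrite hrs; ring.
have b0 : (u ^ (- r)) ^+ n != 0 by rewrite expf_neq0 // expfz_neq0.
rewrite rmorphM /=; move: E b0; set x := (u ^ (- s)) ^+ k; set y := (u ^ (- r)) ^+ n => E b0.
rewrite -mulf_div [X in X * _](_ : _ = (cmod c)%:C); last by rewrite mulfK.
by rewrite E /u mulrC divfK.
Qed.

End FiberPt.

Lemma cmod_slope (p : C * C) : p.1 != 0 ->
  cmod p.2 ^+ k = cmod (slope p) * cmod p.1 ^+ n.
Proof. by move=> p0; rewrite -!cmodX -cmodM divfK // expf_neq0. Qed.

Lemma delta_loopE (p : C * C) t : delta_loop n k p t = (e t ^+ k * p.1, e t ^+ n * p.2).
Proof. by rewrite /delta_loop !unit_loopMn. Qed.

Lemma cmod_delta_loop1 (p : C * C) t : cmod (delta_loop n k p t).1 = cmod p.1.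
Proof. by rewrite delta_loopE cmodM cmodX cmod_unit_loop expr1n mul1r. Qed.

Lemma slope_delta_loop (p : C * C) t : slope (delta_loop n k p t) = slope p.
Proof.
rewrite delta_loopE /Defs.slope /= !exprMn -!exprM mulnC -mulf_div divff ?mul1r //.
by rewrite expf_neq0 // unit_loop_neq0.
Qed.

Lemma delta_loop0 (p : C * C) : delta_loop n k p 0 = p.
Proof. by rewrite delta_loopE unit_loop0 !expr1n !mul1r; case: p. Qed.

Lemma delta_loopD (p : C * C) t u : delta_loop n k (delta_loop n k p t) u = delta_loop n k p (t + u).
Proof. by rewrite !delta_loopE /= unit_loopD ![e t * e u]mulrC !exprMn !mulrA. Qed.

Lemma delta_loop1 (p : C * C) : delta_loop n k p 1 = p.
Proof. by rewrite delta_loopE unit_loop1 !expr1n !mul1r; case: p. Qed.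

Lemma delta_loop_free (p : C * C) t u : p.1 != 0 -> p.2 != 0 ->
  delta_loop n k p t = delta_loop n k p u -> exists m : int, u = t + m%:~R.
Proof.
move=> x0 y0; rewrite !delta_loopE => -[/(mulIf x0) ek /(mulIf y0) en].
have [|m E] := @unit_loop_eq1 R (u - t); last by exists m; rewrite -E addrC subrK.
rewrite unit_loopB; apply: (bezout_pow1 hrs); rewrite expr_div_n ?ek ?en divff //.
  by rewrite -ek expf_neq0 // unit_loop_neq0.
by rewrite -en expf_neq0 // unit_loop_neq0.
Qed.

(** The rotation from the reference point [q] to [p]. Both have the same slope, so the quotients of
    their coordinates lie on the curve of [bezout_pow], whose inverse parametrization this is. *)
Definition fiber_arg (p : C * C) : C :=
  let q := fiber_pt (slope p) (cmod p.1) in (p.2 / q.2) ^ r * (p.1 / q.1) ^ (- s).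

Lemma fiber_pt2_neq0 c a : c != 0 -> 0 < a -> (fiber_pt c a).2 != 0.
Proof.
move=> c0 a0; have := slope_fiber_pt c0 a0; rewrite /Defs.slope => E.
by apply: contraNneq c0 => y0; rewrite -E y0 expr0n gtn_eqF // mul0r.
Qed.

Lemma fiber_argE (p : C * C) : p.1 != 0 -> p.2 != 0 ->
  [/\ cmod (fiber_arg p) = 1, fiber_arg p ^+ k = p.1 / (fiber_pt (slope p) (cmod p.1)).1
    & fiber_arg p ^+ n = p.2 / (fiber_pt (slope p) (cmod p.1)).2].
Proof.
move=> x0 y0; set q := fiber_pt _ _.
have c0 : slope p != 0 by rewrite /Defs.slope mulf_neq0 ?invr_eq0 ?expf_neq0.
have a0 : 0 < cmod p.1 by rewrite cmod_gt0.
have q1 : q.1 != 0 by exact: fiber_pt1_neq0.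
have q2 : q.2 != 0 by exact: fiber_pt2_neq0.
have sq : slope q = slope p by exact: slope_fiber_pt.
have n1 : cmod q.1 = cmod p.1 by exact: cmod_fiber_pt1.
(* The modulus of the second coordinate is determined by the slope and the modulus of the first, [k]
   being positive. *)
have n2 : cmod q.2 = cmod p.2.
  apply/eqP; rewrite -(@eqrXn2 _ k) ?cmod_ge0 //.
  by rewrite !cmod_slope // sq n1.
have [|||e1 e2] := @bezout_pow C n k r s hrs (p.1 / q.1) (p.2 / q.2).
- by rewrite mulf_neq0 ?invr_eq0.
- by rewrite mulf_neq0 ?invr_eq0.
- rewrite !expr_div_n.
  have := sq; rewrite /Defs.slope => /eqP; rewrite eqr_div ?expf_neq0 // => /eqP E.
  by apply/eqP; rewrite eqr_div ?expf_neq0 // mulrC -E mulrC.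
split=> //; rewrite /fiber_arg -/q cmodM !cmodX_unit ?mulr1 // cmodM cmodV.
  by rewrite n1 divff // cmod_eq0.
by rewrite n2 divff // cmod_eq0.
Qed.

Lemma fiber_arg_rot (p : C * C) t : p.1 != 0 -> p.2 != 0 -> e t = fiber_arg p ->
  delta_loop n k (fiber_pt (slope p) (cmod p.1)) t = p.
Proof.
move=> x0 y0 et; have [_ e1 e2] := fiber_argE x0 y0.
have c0 : slope p != 0 by rewrite /Defs.slope mulf_neq0 ?invr_eq0 ?expf_neq0.
have a0 : 0 < cmod p.1 by rewrite cmod_gt0.
rewrite delta_loopE et e1 e2 !divfK ?fiber_pt1_neq0 ?fiber_pt2_neq0 //.
by case: (p).
Qed.

Section Continuity.
Variables (T : topologicalType) (x : T).

Lemma fiber_pt_continuous (f : T -> C) (a : T -> R) :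
  {for x, continuous f} -> {for x, continuous a} -> f x != 0 -> 0 < a x ->
  {for x, continuous (fun t => fiber_pt (f t) (a t))}.
Proof.
move=> cf ca f0 a0.
have creal (g : T -> R) : {for x, continuous g} -> {for x, continuous (fun t => (g t)%:C : C)}.
  by move=> cg; apply: (continuous_at_comp cg); exact: real_complex_continuous.
have cm : {for x, continuous (fun t => cmod (f t))}.
  by apply: (continuous_at_comp cf); exact: cmod_continuous.
have cu : {for x, continuous (fun t => f t / (cmod (f t))%:C)}.
  apply: (continuous_atM cf); apply: continuous_atV; last exact: creal.
  by rewrite real_complex_neq0 cmod_eq0.
have u0 : f x / (cmod (f x))%:C != 0 by rewrite -cmod_eq0 cmod_arg // oner_eq0.
have cz (m : int) : {for x, continuous (fun t => (f t / (cmod (f t))%:C) ^ m)}.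
  exact: (@continuous_at_comp T C C x _ (fun w : C => w ^ m) cu (@exprz_continuous R m _ u0)).
have can : {for x, continuous (fun t => a t ^+ n)}.
  elim: (n) => [|m IH]; first exact: continuous_at_cst.
  have -> : (fun t => a t ^+ m.+1) = (fun t => a t * a t ^+ m) by apply/funext => t; rewrite exprS.
  exact: (continuous_atM ca IH).
apply: continuous_pair; first exact: (continuous_atM (creal _ ca) (cz _)).
apply: (fun h => continuous_atM h (cz _)); apply: creal.
apply: (@continuous_at_comp _ _ _ x (fun t => cmod (f t) * a t ^+ n)).
  exact: (continuous_atM cm can).
have p0 : 0 < cmod (f x) * a x ^+ n by rewrite mulr_gt0 ?cmod_gt0 // exprn_gt0.
exact: (@kroot_continuous R k _ p0).
Qed.

Lemma slope_continuous (p : T -> C * C) : {for x, continuous p} -> (p x).1 != 0 ->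
  {for x, continuous (fun t => slope (p t))}.
Proof.
move=> cp x0.
have c1 : {for x, continuous (fun t => (p t).1)} by apply: (continuous_at_comp cp); exact: cvg_fst.
have c2 : {for x, continuous (fun t => (p t).2)} by apply: (continuous_at_comp cp); exact: cvg_snd.
apply: continuous_atM.
  exact: (@continuous_at_comp T C C x _ (fun w : C => w ^+ k) c2 (@expr_continuous R k _)).
apply: continuous_atV; first by rewrite expf_neq0.
exact: (@continuous_at_comp T C C x _ (fun w : C => w ^+ n) c1 (@expr_continuous R n _)).
Qed.

Lemma fiber_arg_continuous (p : T -> C * C) : {for x, continuous p} ->
  (p x).1 != 0 -> (p x).2 != 0 -> {for x, continuous (fun t => fiber_arg (p t))}.
Proof.
move=> cp x0 y0.
have c1 : {for x, continuous (fun t => (p t).1)} by apply: (continuous_at_comp cp); exact: cvg_fst.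
have c2 : {for x, continuous (fun t => (p t).2)} by apply: (continuous_at_comp cp); exact: cvg_snd.
have c0 : slope (p x) != 0 by rewrite /Defs.slope mulf_neq0 ?invr_eq0 ?expf_neq0.
have a0 : 0 < cmod (p x).1 by rewrite cmod_gt0.
have cq : {for x, continuous (fun t => fiber_pt (slope (p t)) (cmod (p t).1))}.
  have cm := continuous_at_comp c1 (@cmod_continuous R _).
  exact: (fiber_pt_continuous (slope_continuous cp x0) cm c0 a0).
have cq1 : {for x, continuous (fun t => (fiber_pt (slope (p t)) (cmod (p t).1)).1)}.
  by apply: (continuous_at_comp cq); exact: cvg_fst.
have cq2 : {for x, continuous (fun t => (fiber_pt (slope (p t)) (cmod (p t).1)).2)}.
  by apply: (continuous_at_comp cq); exact: cvg_snd.
have q1 := fiber_pt1_neq0 c0 a0; have q2 := fiber_pt2_neq0 c0 a0.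
have cz (g : T -> C) (m : int) : {for x, continuous g} -> g x != 0 ->
    {for x, continuous (fun t => g t ^ m)}.
  by move=> cg g0; exact: (@continuous_at_comp T C C x _ (fun w : C => w ^ m) cg (@exprz_continuous R m _ g0)).
have h2 : (p x).2 / (fiber_pt (slope (p x)) (cmod (p x).1)).2 != 0.
  by rewrite mulf_neq0 ?invr_eq0.
have h1 : (p x).1 / (fiber_pt (slope (p x)) (cmod (p x).1)).1 != 0.
  by rewrite mulf_neq0 ?invr_eq0.
have d2 := continuous_atM c2
  (@continuous_atV _ _ x (fun t => (fiber_pt (slope (p t)) (cmod (p t).1)).2) q2 cq2).
have d1 := continuous_atM c1
  (@continuous_atV _ _ x (fun t => (fiber_pt (slope (p t)) (cmod (p t).1)).1) q1 cq1).
exact: (continuous_atM (cz _ r d2 h2) (cz _ (- s) d1 h1)).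
Qed.

Lemma delta_loop_continuous (p : T -> C * C) (t : T -> R) :
  {for x, continuous p} -> {for x, continuous t} ->
  {for x, continuous (fun w => delta_loop n k (p w) (t w))}.
Proof.
move=> cp ct.
have c1 : {for x, continuous (fun t => (p t).1)} by apply: (continuous_at_comp cp); exact: cvg_fst.
have c2 : {for x, continuous (fun t => (p t).2)} by apply: (continuous_at_comp cp); exact: cvg_snd.
have ce (m : nat) : {for x, continuous (fun w => e (m%:R * t w))}.
  apply: (@continuous_at_comp _ _ _ x (fun w => m%:R * t w)).
    exact: (continuous_atM (@continuous_at_cst _ _ _ _) ct).
  exact: unit_loop_continuous.
by apply: continuous_pair; [exact: (continuous_atM (ce k) c1)|exact: (continuous_atM (ce n) c2)].
Qed.

End Continuity.
End Points.

(** * Composition of inverse images *)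

Lemma pullback_comp_nat (R : realType) (W X Y : topologicalType) (h : X -> Y)
  (ch : continuous h) (g : W -> X) (cg : continuous g) (chg : continuous (h \o g)) :
  nat_isomorphic (functor_comp (pullback_functor R cg) (pullback_functor R ch))
    (pullback_functor R chg).
Proof.
have cidW : continuous (@idfun W) by move=> x; exact: cvg_id.
apply: (@nat_iso_stalks R W (LS R Y) (functor_comp (pullback_functor R cg)
  (pullback_functor R ch)) (pullback_functor R chg) (fun L x => \1%VF)).
- move=> L s x fs.
  apply/(@flat_pullback R W W Y L (h \o g) chg id cidW).
  have {}fs : flat_at (pullback L ch) g s x.
    by move: fs; rewrite (@flat_pullback R W W X (pullback L ch) g cg id cidW).
  have f : flat_at L (h \o g) s x.
    by move: fs; rewrite (@flat_pullback R W X Y L h ch g cg).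
  by apply: flat_near f; near=> y; rewrite id_lfunE.
- by move=> L x; exact: id_bij.
- by move=> L M f x v; rewrite !id_lfunE.
Unshelve. all: by end_near. Qed.

Lemma pullback_id_nat (R : realType) (X : topologicalType) (cid : continuous (@idfun X)) :
  nat_isomorphic (pullback_functor R cid) (functor_id (LS R X)).
Proof.
apply: (@nat_iso_stalks R X (LS R X) (pullback_functor R cid) (functor_id (LS R X))
  (fun L x => \1%VF)).
- move=> L s x fs; have f : flat_at L id s x.
    by move: fs; rewrite (@flat_pullback R X X X L id cid id cid).
  by apply: flat_near f; near=> y; rewrite id_lfunE.
- by move=> L x; exact: id_bij.
- by move=> L M f x v; rewrite !id_lfunE.
Unshelve. all: by end_near. Qed.

(** Only a homotopy between [f \o sg] and the identity is required: on the turbine this composite is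
    a retraction, not the identity. *)
Lemma section_nat (R : realType) (X Y : topologicalType)
  (f : X -> Y) (cf : continuous f) (sg : Y -> X) (csg : continuous sg)
  (H : Y -> R -> Y) : continuous (fun p : Y * R => H p.1 p.2) ->
  (forall y, H y 0 = f (sg y)) -> (forall y, H y 1 = y) ->
  nat_isomorphic (functor_comp (pullback_functor R csg) (pullback_functor R cf))
    (functor_id (LS R Y)).
Proof.
move=> cH H0 H1.
have cfs : continuous (f \o sg).
  by move=> y; apply: continuous_comp; [exact: csg|exact: cf].
have cid : continuous (@idfun Y) by move=> y; exact: cvg_id.
apply: (nat_isomorphic_trans (pullback_comp_nat R cf csg cfs)).
apply: (nat_isomorphic_trans _ (pullback_id_nat R cid)).
exact: (@homotopy_pullback R Y Y (f \o sg) id cfs cid H cH H0 H1).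
Qed.

(** * The affine coordinate on the punctured line *)

Section PuncturedLine.
Variables (R : realType) (l : nat) (Cf : 'I_l -> Cx R).
Local Notation C := (Cx R).
Local Notation P := (punctured_line Cf).
Local Notation off := (off_centers Cf).

Definition pcoord (b : P) : C := odflt 0 (set_val b : option C).

Lemma off_punctured (c : C) : off c -> P (Some c).
Proof.
by move=> offc [[|i|] _] //= [E]; [have := offc p_zero|have := offc (p_root i)];
  rewrite /disc_center E eqxx.
Qed.

Lemma pcoordP (b : P) : set_val b = Some (pcoord b).
Proof.
have H (o : P1 R) : P o -> o = Some (odflt 0 (o : option C)).
  by case: o => [c|] // -[]; exists p_infty.
exact: H (set_valP b).
Qed.

Lemma pcoord_off (b : P) : off (pcoord b).
Proof.
have H : P (Some (pcoord b)) by rewrite -pcoordP; exact: set_valP.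
move=> j; apply/eqP => E; apply: H.
by case: j E => [|i|] E; [exists p_zero|exists (p_root i)|exists p_zero] => //=; rewrite E.
Qed.

Definition mkP (c : C) (offc : off c) : P := exist _ (Some c : P1 R) (mem_set (off_punctured offc)).

Lemma pcoord_inj (b b' : P) : pcoord b = pcoord b' -> b = b'.
Proof. by move=> E; apply: val_inj; rewrite [LHS]pcoordP [RHS]pcoordP E. Qed.

Lemma pcoord_continuous : continuous pcoord.
Proof.
move=> b; have cv : {for b, continuous (@set_val _ P)} by exact: initial_continuous.
apply: (@continuous_comp _ (P1 R) C (@set_val _ P) (odflt 0) b cv).
by rewrite pcoordP => U nU.
Qed.

Lemma continuous_pcoord (Z : topologicalType) (f : Z -> P) :
  continuous (fun z => pcoord (f z)) -> continuous f.
Proof.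
move=> cf; apply: continuous_set_val.
have -> : (fun z => set_val (f z)) = (fun z => Some (pcoord (f z))).
  by apply/funext => z; rewrite pcoordP.
move=> z; exact: (@continuous_at_comp Z C (P1 R) z _ Some (cf z)
  (@one_point_compactification_some_continuous C _)).
Qed.

End PuncturedLine.

(** * The circle action and descent on rotation-stable subsets *)

Section CurveComplement.
Variables (R : realType) (n k l : nat) (Cf : 'I_l -> Cx R) (r s : int).
Hypothesis hk : (0 < k)%N.
Hypothesis hrs : r * n%:Z = k%:Z * s + 1.
Local Notation C := (Cx R).
Local Notation X := (curve_complement n k Cf).
Local Notation P := (punctured_line Cf).
Local Notation slope := (slope n k).
Local Notation fiber_pt := (fiber_pt n k r s).

Lemma slope_off (p : C * C) : X p -> off_centers Cf (slope p).
Proof.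
move=> /curve_complementP[x0 y0 pr] [|i|]; rewrite /disc_center //.
  by rewrite /Defs.slope mulf_neq0 ?invr_eq0 ?expf_neq0.
by rewrite /Defs.slope mulf_neq0 ?invr_eq0 ?expf_neq0.
Qed.

Lemma off_curve (p : C * C) : p.1 != 0 -> off_centers Cf (slope p) -> X p.
Proof.
move=> x0 offp; have y0 : p.2 != 0.
  apply: contraNneq (offp p_zero) => y0.
  by rewrite /Defs.slope y0 expr0n gtn_eqF // mul0r.
rewrite /curve_complement /= !mulf_neq0 //; apply/prodf_neq0 => i _.
apply: contraNneq (offp (p_root i)) => /eqP; rewrite subr_eq0 => /eqP E.
by rewrite /Defs.slope E mulfK // expf_neq0.
Qed.

Lemma fiber_pt_curve (c : C) a : off_centers Cf c -> 0 < a -> X (fiber_pt c a).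
Proof.
move=> offc a0; have c0 := offc p_zero.
by apply: off_curve; rewrite ?slope_fiber_pt // fiber_pt1_neq0.
Qed.

Lemma delta_loop_curve (p : C * C) t : X p -> X (delta_loop n k p t).
Proof.
move=> Xp; apply: off_curve; last by rewrite slope_delta_loop; exact: slope_off.
rewrite -cmod_eq0 cmod_delta_loop1 cmod_eq0.
by have [] := curve_complementP Xp.
Qed.

Section Bundle.
Variables (A : set (C * C)) (AX : A `<=` X).
Hypothesis Arot : forall p t, A p -> A (delta_loop n k p t).

Definition fiber_rot (p : A) (t : R) : A :=
  exist _ (delta_loop n k (set_val p) t) (mem_set (Arot t (set_valP p))).

Lemma continuous_to_sub (T : topologicalType) (f : T -> A) :
  (forall x, {for x, continuous (fun x => set_val (f x))}) -> continuous f.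
Proof. by move=> cf; apply: continuous_set_val => x; exact: cf. Qed.

Lemma set_val_continuous : continuous (@set_val _ A : A -> C * C).
Proof. exact: initial_continuous. Qed.

Lemma fiber_rot_continuous : continuous (fun p : A * R => fiber_rot p.1 p.2).
Proof.
apply: continuous_to_sub => x.
have c1 : {for x, continuous (fun p : A * R => set_val p.1)}.
  exact: (continuous_at_comp (@continuous_at_fst _ _ _) (@set_val_continuous _)).
exact: (delta_loop_continuous c1 (@continuous_at_snd _ _ _)).
Qed.

Lemma fiber_rot0 p : fiber_rot p 0 = p.
Proof. by apply: val_inj; exact: delta_loop0. Qed.

Lemma fiber_rotD p t u : fiber_rot (fiber_rot p t) u = fiber_rot p (t + u).
Proof. by apply: val_inj; exact: delta_loopD. Qed.

Lemma fiber_rot1 p : fiber_rot p 1 = p.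
Proof. by apply: val_inj; exact: delta_loop1. Qed.

Lemma fiber_rot_free p t u : fiber_rot p t = fiber_rot p u -> exists m : int, u = t + m%:~R.
Proof.
move=> /(congr1 (@set_val _ A)); have [x0 y0 _] := curve_complementP (AX (set_valP p)).
exact: (delta_loop_free hrs).
Qed.

Variables (rho : R) (rho0 : 0 < rho).
Hypothesis AG : forall p t, A p ->
  A (fiber_pt (slope p) ((1 - clamp t) * rho + clamp t * cmod p.1)).

(** Moves the modulus of the first coordinate from [rho] to its value at [p], along reference points
    of constant slope. *)
Let G (p : A) (t : R) : A := exist _
  (fiber_pt (slope (set_val p)) ((1 - clamp t) * rho + clamp t * cmod (set_val p).1))
  (mem_set (AG t (set_valP p))).

Let cG : continuous (fun p : A * R => G p.1 p.2).
Proof.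
apply: continuous_to_sub => x.
have [x0 _ _] := curve_complementP (AX (set_valP x.1)).
have c1 : {for x, continuous (fun p : A * R => set_val p.1)}.
  exact: (continuous_at_comp (@continuous_at_fst _ _ _) (@set_val_continuous _)).
have ct : {for x, continuous (fun p : A * R => clamp p.2)}.
  exact: (continuous_at_comp (@continuous_at_snd _ _ _) (@clamp_continuous R _)).
have ca : {for x, continuous (fun p : A * R => cmod (set_val p.1).1)}.
  exact: (continuous_at_comp (continuous_at_comp c1 (@continuous_at_fst _ _ _)) (@cmod_continuous R _)).
have cs := @slope_continuous R n k _ x _ c1 x0.
have cb := continuous_atD
  (continuous_atM (continuous_atB (@continuous_at_cst _ _ x (1 : R)) ct) (@continuous_at_cst _ _ x rho))
  (continuous_atM ct ca).
have /andP[t0 t1] := clamp_itv x.2.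
have a0 : 0 < (1 - clamp x.2) * rho + clamp x.2 * cmod (set_val x.1).1.
  by apply: convex_gt0; rewrite ?cmod_gt0.
exact: (@fiber_pt_continuous R n k r s _ x _ _ cs cb
  (slope_off (AX (set_valP x.1)) p_zero) a0).
Qed.

Let G1 p : set_val (G p 1) = fiber_pt (slope (set_val p)) (cmod (set_val p).1).
Proof.
rewrite -[LHS]/(fiber_pt _ ((1 - clamp 1) * rho + clamp 1 * _)).
by rewrite clamp1 subrr mul0r add0r mul1r.
Qed.

Let angle (z : A) : exists2 tau : A -> R, continuous tau &
  \forall w \near z, fiber_rot (G w 1) (tau w) = w.
Proof.
have nz (w : A) : (set_val w).1 != 0 /\ (set_val w).2 != 0.
  by have [] := curve_complementP (AX (set_valP w)).
have unit_arg (w : A) : cmod (fiber_arg n k r s (set_val w)) = 1.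
  by have [x0 y0] := nz w; have [] := fiber_argE hk hrs x0 y0.
have carg (w : A) : {for w, continuous (fun w : A => fiber_arg n k r s (set_val w))}.
  have [x0 y0] := nz w.
  exact: (@fiber_arg_continuous R n k r s hk hrs A w _ (@set_val_continuous w) x0 y0).
have [tau ctau ntau] := arg_branch (unit_arg z).
exists (fun w => tau (fiber_arg n k r s (set_val w))).
  by move=> w; exact: (@continuous_at_comp A C R w _ tau (carg w) (@ctau _)).
have near_arg : \forall w \near z, let v := fiber_arg n k r s (set_val w) in
    cmod v = 1 -> @unit_loop R (tau v) = v by exact: (carg z _ ntau).
apply: filterS near_arg => w /= /(_ (unit_arg w)) E.
apply: val_inj; have [x0 y0] := nz w.
have := fiber_arg_rot hk hrs x0 y0 E.
by rewrite -G1.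
Qed.

Variables (f : A -> P) (cf : continuous f) (sg : P -> A) (csg : continuous sg).
Hypothesis sgf : forall p, set_val (sg (f p)) = fiber_pt (slope (set_val p)) rho.

Let G0 p : G p 0 = sg (f p).
Proof.
apply: val_inj; rewrite [RHS]sgf -[LHS]/(fiber_pt _ ((1 - clamp 0) * rho + clamp 0 * _)).
by rewrite clamp0 subr0 mul1r mul0r addr0.
Qed.

(** Covers both the curve complement and the turbine; on the latter the modulus of the first
    coordinate is constant, so [G] does not depend on time. *)
Lemma bundle_descent (Ca : category) (F : functor Ca (LS R A)) :
  (forall a p, monodromy_scalar (F a) (fiber_rot p) 1) ->
  nat_isomorphic
    (functor_comp (pullback_functor R cf) (functor_comp (pullback_functor R csg) F)) F.
Proof.
exact: (@descent_nat_iso R A P f cf sg csg fiber_rot G fiber_rot_continuous cG fiber_rot0 fiber_rotD fiber_rot_free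
  G0 angle Ca F).
Qed.

End Bundle.
End CurveComplement.

(** * The turbine *)

Section Turbine.
Variables (R : realType) (n k l : nat) (Cf : 'I_l -> Cx R) (r s : int).
Hypothesis hk : (0 < k)%N.
Hypothesis hrs : r * n%:Z = k%:Z * s + 1.
Local Notation C := (Cx R).
Local Notation X := (curve_complement n k Cf).
Local Notation P := (punctured_line Cf).
Local Notation slope := (slope n k).
Local Notation fiber_pt := (fiber_pt n k r s).
Local Notation off := (off_centers Cf).

Section CurveSection.
Variables (rho : R) (rho0 : 0 < rho).

Lemma curve_fiber_stable (p : C * C) t : X p ->
  X (fiber_pt (slope p) ((1 - clamp t) * rho + clamp t * cmod p.1)).
Proof.
move=> Xp; have [x0 _ _] := curve_complementP Xp; have /andP[t0 t1] := clamp_itv t.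
apply: (fiber_pt_curve hk hrs); first exact: slope_off.
by apply: convex_gt0; rewrite ?cmod_gt0.
Qed.

Definition curve_section (b : P) : X :=
  exist _ (fiber_pt (pcoord b) rho) (mem_set (fiber_pt_curve hk hrs (pcoord_off b) rho0)).

Lemma curve_section_continuous : continuous curve_section.
Proof.
apply: continuous_to_sub => b.
exact: (@fiber_pt_continuous R n k r s _ b _ _ (@pcoord_continuous R l Cf b)
  (@continuous_at_cst _ _ b rho) (pcoord_off b p_zero) rho0).
Qed.

Lemma curve_sectionK b : gamma (curve_section b) = b.
Proof. by apply: pcoord_inj; exact: (slope_fiber_pt hk hrs (pcoord_off b p_zero) rho0). Qed.

Lemma gamma_surj b : exists p : X, gamma p = b.
Proof. by exists (curve_section b); exact: curve_sectionK. Qed.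

Let cg := @gamma_continuous R n k l Cf.

Definition curve_rot : X -> R -> X := fiber_rot (@delta_loop_curve R n k l Cf hk).

Lemma scalar_along_fibersP eps (L : local_system R X) :
  scalar_along_fibers eps L <-> forall p, monodromy_scalar L (curve_rot p) eps.
Proof.
split=> [H p|H p c Hc]; first exact: H.
have -> : c = curve_rot p by apply/funext => t; apply: val_inj; exact: Hc.
exact: H.
Qed.

Lemma curve_descent (Ca : category) (F : functor Ca (LS R X)) :
  (forall a p, monodromy_scalar (F a) (curve_rot p) 1) ->
  nat_isomorphic (functor_comp (pullback_functor R cg)
    (functor_comp (pullback_functor R curve_section_continuous) F)) F.
Proof.
exact: (@bundle_descent R n k l Cf r s hk hrs X (@subset_refl _ X)
  (@delta_loop_curve R n k l Cf hk) rho rho0 curve_fiber_stable (@gamma R n k l Cf) cg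
  curve_section curve_section_continuous (fun p => erefl) Ca F).
Qed.

Lemma curve_section_nat :
  nat_isomorphic (functor_comp (pullback_functor R curve_section_continuous)
    (pullback_functor R cg)) (functor_id (LS R P)).
Proof.
apply: (@section_nat R X P (@gamma R n k l Cf) cg curve_section curve_section_continuous (fun b _ => b)) => //.
  by move=> x; exact: continuous_at_fst.
by move=> b; rewrite curve_sectionK.
Qed.

End CurveSection.

Variable w : tube_system n k Cf.

(** Radii of the images of the tubes under the slope: where the first coordinate has modulus
    [rho1 w], the modulus of [y] to the power [k] is that of the slope times [rho1 w ^+ n]. *)
Definition turbine_rad (j : puncture l) : R :=
  match j with
  | p_root _ => rad w j
  | _ => rad w j ^+ k / rho1 w ^+ n
  end.

Let rho0 : 0 < rho1 w := rho1_gt0 w.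

Lemma turbine_rad_gt0 j : 0 < turbine_rad j.
Proof.
by case: j => [|i|]; rewrite /turbine_rad ?rad_gt0 // divr_gt0 ?exprn_gt0 ?rad_gt0.
Qed.

Lemma tube_coord_le (p : C * C) j : cmod p.1 = rho1 w ->
  [/\ (cmod (tube_coord n k Cf j p) <= rad w j) =
       (cmod (slope p - disc_center Cf j) <= turbine_rad j),
    (rad w j <= cmod (tube_coord n k Cf j p)) =
       (turbine_rad j <= cmod (slope p - disc_center Cf j))
    & (cmod (tube_coord n k Cf j p) == rad w j) =
       (cmod (slope p - disc_center Cf j) == turbine_rad j)].
Proof.
move=> p1.
suff H : (cmod (tube_coord n k Cf j p) <= rad w j) =
       (cmod (slope p - disc_center Cf j) <= turbine_rad j) /\
    (rad w j <= cmod (tube_coord n k Cf j p)) =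
       (turbine_rad j <= cmod (slope p - disc_center Cf j)).
  by have [H1 H2] := H; split=> //; rewrite !eq_le H1 H2.
have x0 : p.1 != 0 by rewrite -cmod_eq0 p1 gt_eqF.
have E := cmod_slope n k x0; rewrite p1 in E.
have rn : 0 < rho1 w ^+ n by rewrite exprn_gt0.
have Y (a : R) : 0 < a -> (cmod p.2 <= a) = (cmod (slope p) <= a ^+ k / rho1 w ^+ n) /\
    (a <= cmod p.2) = (a ^+ k / rho1 w ^+ n <= cmod (slope p)).
  move=> a0; rewrite ler_pdivlMr // ler_pdivrMr // -E.
  by rewrite !ler_pXn2r // nnegrE ?cmod_ge0 // ltW.
by case: j => [|i|] //=; rewrite subr0; apply: Y; exact: rad_gt0.
Qed.

Lemma tubeE (p : C * C) j : cmod p.1 = rho1 w ->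
  tube n k Cf (rho1 w) (rad w) j p <-> cmod (slope p - disc_center Cf j) <= turbine_rad j.
Proof.
move=> p1; have [H _ _] := tube_coord_le j p1.
by rewrite /tube /= !cmodE p1 lecR H; split=> [[]|].
Qed.

Lemma tube_interiorE (p : C * C) j : cmod p.1 = rho1 w ->
  tube_interior n k Cf (rho1 w) (rad w) j p <->
  cmod (slope p - disc_center Cf j) < turbine_rad j.
Proof.
move=> p1; have [_ H _] := tube_coord_le j p1.
by rewrite /tube_interior /= !cmodE p1 ltcR !ltNge H; split=> [[]|].
Qed.

Lemma tube_boundaryP (p : C * C) j :
  tube_boundary w j p <-> cmod p.1 = rho1 w /\ on_circle Cf turbine_rad j (slope p).
Proof.
rewrite /tube_boundary /= !cmodE /on_circle; split=> -[].
  move=> /complexI p1 /complexI /eqP; have [_ _ ->] := tube_coord_le j p1.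
  by move=> /eqP.
move=> p1 /eqP; have [_ _ <-] := tube_coord_le j p1.
by move=> /eqP ->; rewrite p1.
Qed.

Lemma slope_onto (c : C) : exists p : C * C, cmod p.1 = rho1 w /\ slope p = c.
Proof.
have [->|c0] := eqVneq c 0.
  exists ((rho1 w)%:C, 0); rewrite cmod_real ?ltW //; split=> //.
  by rewrite /Defs.slope /= expr0n gtn_eqF // mul0r.
exists (fiber_pt c (rho1 w)); rewrite cmod_fiber_pt1 //.
by rewrite (slope_fiber_pt hk hrs c0).
Qed.

(** Every value of the slope, 0 included, is attained over the circle of radius [rho1 w], so a
    common point of two discs would lift to a common point of two tubes. *)
Lemma turbine_disjoint : disjoint_discs Cf turbine_rad.
Proof.
split=> [j|i j c]; first exact: turbine_rad_gt0.
have [p [p1 pc]] := slope_onto c.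
have fin i' j' : i' <> p_infty -> j' <> p_infty ->
    cmod (c - disc_center Cf i') <= turbine_rad i' ->
    cmod (c - disc_center Cf j') <= turbine_rad j' -> i' = j'.
  move=> i'f j'f; rewrite -pc => /(tubeE _ p1) ti /(tubeE _ p1) tj.
  have [//|ij] := pselect (i' = j').
  have := tube_disjoint w i'f j'f ij; rewrite -subset0 => /(_ p) [].
  by split.
have inf i' : i' <> p_infty -> cmod (c - disc_center Cf i') <= turbine_rad i' ->
    turbine_rad p_infty <= cmod (c - disc_center Cf p_infty) -> False.
  move=> i'f; rewrite -pc => /(tubeE _ p1) ti.
  by have /(tube_interiorE _ p1) := tube_inside i'f ti; rewrite ltNge => /negP.
case: i => [|i|]; case: j => [|j|] // H1 H2.
- exact: (@fin p_zero (p_root j)).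
- by case: (@inf p_zero).
- exact: (@fin (p_root i) p_zero).
- exact: (@fin (p_root i) (p_root j)).
- by case: (@inf (p_root i)).
- by case: (@inf p_zero).
- by case: (@inf (p_root j)).
Qed.

(** Being in a disc only on its circle expresses in one form the removal of the inner tubes and the
    bound given by the outer one. *)
Lemma turbineP (p : C * C) : turbine w p <-> cmod p.1 = rho1 w /\
  forall j, in_disc Cf turbine_rad j (slope p) -> on_circle Cf turbine_rad j (slope p).
Proof.
split=> [[tp ntp]|[p1 H]].
  have p1 : cmod p.1 = rho1 w by case: tp; rewrite cmodE => /complexI.
  split=> // j; have [jf|jf] := pselect (j = p_infty).
    subst j; rewrite /in_disc => h1; apply/eqP; rewrite eq_le h1 andbT.
    exact/(tubeE _ p1).
  have lt : ~ cmod (slope p - disc_center Cf j) < turbine_rad j.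
    by move=> /(tube_interiorE _ p1) ti; apply: ntp; exists j.
  move=> h; apply/eqP; rewrite eq_le; apply/andP; split; last by rewrite leNgt; apply/negP.
  by case: j jf h {lt} => [|i|].
split.
  apply/(tubeE _ p1); rewrite leNgt; apply/negP => lt.
  by have := H p_infty (ltW lt); rewrite /on_circle => E; move: lt; rewrite E ltxx.
move=> [j jf /(tube_interiorE _ p1) lt].
have : in_disc Cf turbine_rad j (slope p) by case: j jf lt => [|i|] //= _ /ltW.
by move=> /H; rewrite /on_circle => E; move: lt; rewrite E ltxx.
Qed.

Local Notation T := (turbine w).
Local Notation ret := (retract Cf turbine_rad).

Lemma turbine_fiber_pt c : off c ->
  (forall j, in_disc Cf turbine_rad j c -> on_circle Cf turbine_rad j c) ->
  T (fiber_pt c (rho1 w)).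
Proof.
move=> offc H; have c0 := offc p_zero; apply/turbineP.
by rewrite cmod_fiber_pt1 // (slope_fiber_pt hk hrs c0).
Qed.

Lemma retract_off c : off c -> off (ret c).
Proof.
move=> offc; have := retract_path_off turbine_disjoint 1 offc.
by rewrite clamp1 mul1r addrC subrK.
Qed.

Lemma turbine_retract c : off c -> T (fiber_pt (ret c) (rho1 w)).
Proof.
move=> offc; apply: turbine_fiber_pt; first exact: retract_off.
by move=> j; exact: (retract_boundary turbine_disjoint).
Qed.

Lemma turbine_delta_loop (p : C * C) t : T p -> T (delta_loop n k p t).
Proof. by move=> /turbineP[p1 H]; apply/turbineP; rewrite cmod_delta_loop1 slope_delta_loop. Qed.

Lemma turbine_fiber_stable (p : C * C) t : T p ->
  T (fiber_pt (slope p) ((1 - clamp t) * rho1 w + clamp t * cmod p.1)).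
Proof.
move=> Tp; have /turbineP[p1 H] := Tp; rewrite p1 -mulrDl subrK mul1r.
by apply: turbine_fiber_pt => //; exact: (slope_off (turbine_sub Tp)).
Qed.

Definition turbine_section (b : P) : T :=
  exist _ (fiber_pt (ret (pcoord b)) (rho1 w)) (mem_set (turbine_retract (pcoord_off b))).

Lemma turbine_section_continuous : continuous turbine_section.
Proof.
apply: continuous_to_sub => b.
have cr := @continuous_at_comp _ _ _ b _ ret (@pcoord_continuous R l Cf b)
  (@retract_continuous _ _ _ turbine_rad _ (pcoord_off b)).
exact: (@fiber_pt_continuous R n k r s _ b _ _ cr
  (@continuous_at_cst _ _ b (rho1 w)) (retract_off (pcoord_off b) p_zero) rho0).
Qed.

Definition turbine_slope (p : T) : P := gamma (incl (@turbine_sub R n k l Cf w) p).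

Lemma turbine_slope_continuous : continuous turbine_slope.
Proof.
move=> p; apply: continuous_comp; first exact: incl_continuous.
exact: gamma_continuous.
Qed.

Definition turbine_rot : T -> R -> T := fiber_rot turbine_delta_loop.

Lemma turbine_sectionE p :
  set_val (turbine_section (turbine_slope p)) = fiber_pt (slope (set_val p)) (rho1 w).
Proof.
have Tp := set_valP p; have /turbineP[_ H] := Tp.
have -> : set_val (turbine_section (turbine_slope p)) =
  fiber_pt (ret (slope (set_val p))) (rho1 w) by [].
by rewrite (retract_fix turbine_disjoint (slope_off (turbine_sub Tp))).
Qed.

Lemma turbine_descent (Ca : category) (F : functor Ca (LS R T)) :
  (forall a p, monodromy_scalar (F a) (turbine_rot p) 1) ->
  nat_isomorphic (functor_comp (pullback_functor R turbine_slope_continuous)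
    (functor_comp (pullback_functor R turbine_section_continuous) F)) F.
Proof.
exact: (@bundle_descent R n k l Cf r s hk hrs T (@turbine_sub R n k l Cf w)
  turbine_delta_loop (rho1 w) rho0 turbine_fiber_stable turbine_slope
  turbine_slope_continuous turbine_section turbine_section_continuous turbine_sectionE
  Ca F).
Qed.

Lemma turbine_section_nat :
  nat_isomorphic (functor_comp (pullback_functor R turbine_section_continuous)
    (pullback_functor R turbine_slope_continuous)) (functor_id (LS R P)).
Proof.
(* Time is reversed: at 0 this is the retraction, which is the slope of the section, and at 1 the
   identity. *)
pose H (b : P) (u : R) : P :=
  mkP (retract_path_off turbine_disjoint (1 - u) (pcoord_off b)).
apply: (@section_nat R T P turbine_slope turbine_slope_continuous turbine_section
  turbine_section_continuous H).
- apply: continuous_pcoord => x.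
  have cc := continuous_at_comp (@continuous_at_fst _ _ x) (@pcoord_continuous R l Cf _).
  have ct := @continuous_at_comp _ _ _ x _ (@clamp R) (continuous_atB
    (@continuous_at_cst _ _ x (1 : R)) (@continuous_at_snd _ _ x)) (@clamp_continuous R _).
  have cr := @continuous_at_comp _ _ _ x _ ret cc
    (@retract_continuous _ _ _ turbine_rad _ (pcoord_off x.1)).
  have cz := @continuous_at_comp _ _ _ x _ (real_complex R : R -> C) ct (@real_complex_continuous R _).
  exact: (continuous_atD cc (continuous_atM cz (continuous_atB cr cc))).
- move=> b; apply: pcoord_inj; rewrite -[LHS]/(pcoord b + (clamp (1 - 0))%:C *
    (ret (pcoord b) - pcoord b)) subr0 clamp1 mul1r addrC subrK.
  exact/esym/(slope_fiber_pt hk hrs (retract_off (pcoord_off b) p_zero) rho0).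
- by move=> b; apply: pcoord_inj; rewrite -[LHS]/(pcoord b + (clamp (1 - 1))%:C *
    (ret (pcoord b) - pcoord b)) subrr clamp0 mul0r addr0.
Qed.

End Turbine.

(** * Boundary data *)

Lemma tensor_cancel (R : realType) (X : topologicalType) (K : local_system R X)
  (A B : LS R X) : rank_one K ->
  @isomorphic (LS R X) (tensor K A) (tensor K B) -> isomorphic A B.
Proof.
move=> K1 /(functor_isomorphic (tensor_functor (dual K))) AB.
have dA := nat_isomorphic_at A (dual_tensor_nat_iso K1).
have dB := nat_isomorphic_at B (dual_tensor_nat_iso K1).
exact: isomorphic_trans (isomorphic_sym dA) (isomorphic_trans AB dB).
Qed.

Section Boundary.
Variables (R : realType) (n k l : nat) (Cf : 'I_l -> Cx R) (r s : int).
Hypothesis hk : (0 < k)%N.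
Hypothesis hrs : r * n%:Z = k%:Z * s + 1.
Local Notation C := (Cx R).
Local Notation P := (punctured_line Cf).
Local Notation slope := (slope n k).
Local Notation fiber_pt := (fiber_pt n k r s).
Variables (w : tube_system n k Cf) (d : disc_system Cf).
Local Notation T := (turbine w).
Local Notation radw := (turbine_rad w).
Local Notation radd := (disc_rad d).

Let disw : disjoint_discs Cf radw := turbine_disjoint hk hrs w.

Lemma disc_system_disjoint : disjoint_discs Cf radd.
Proof.
split=> [j|i j c]; first exact: disc_rad_gt0.
have inD j' : in_disc Cf radd j' c -> closed_disc (puncture_pt Cf j') (radd j') (Some c).
  case: j' => [|j'|]; rewrite /in_disc /disc_center => h.
  - by exists c => //=; rewrite cmodE lecR.
  - by exists c => //=; rewrite cmodE lecR.
  - by right; exists c => //=; rewrite cmodE lecR -[c]subr0.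
move=> /inD ci /inD cj; have [//|ij] := pselect (i = j).
by have := disc_disjoint d ij; rewrite -subset0 => /(_ (Some c)) [].
Qed.

Section Circle.
Variable j : puncture l.
Local Notation circle := (disc_circle d j).
Local Notation torus := (tube_boundary w j).
Local Notation a := (disc_center Cf j).

Let circle_line : circle -> P := incl (@disc_circle_sub R l Cf d j).
Let torus_turbine : torus -> T := incl (@tube_boundary_sub R n k l Cf w j).

Let circle_line_continuous : continuous circle_line :=
  incl_continuous (AB := @disc_circle_sub R l Cf d j).

Let torus_turbine_continuous : continuous torus_turbine :=
  incl_continuous (AB := @tube_boundary_sub R n k l Cf w j).

Lemma on_circle_disc_circle c : on_circle Cf radd j c -> circle (Some c).
Proof.
rewrite /on_circle /disc_circle; case: (j) => [|i|] h.
- by exists c => //=; rewrite cmodE h.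
- by exists c => //=; rewrite cmodE h.
- by exists c => //=; rewrite cmodE -[c]subr0 h.
Qed.

Lemma disc_circle_on_circle (z : circle) : on_circle Cf radd j (pcoord (circle_line z)).
Proof.
have H (o : P1 R) : circle o -> on_circle Cf radd j (odflt 0 (o : option C)).
  rewrite /on_circle /disc_circle; case: (j) => [|i|] [u /= E <-] /=;
  by apply: complexI; rewrite -cmodE ?subr0 //; move: E; rewrite ?subr0.
exact: H (set_valP z).
Qed.

Let torus_circle_on (p : torus) : on_circle Cf radw j (slope (set_val p)).
Proof. by have /(tube_boundaryP hk)[] := set_valP p. Qed.

Let rescale_on (rho rho' : puncture l -> R) c : 0 < rho j -> 0 < rho' j ->
  on_circle Cf rho j c -> on_circle Cf rho' j (scale_at a (rho' j / rho j) c).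
Proof.
move=> r0 r0' h; rewrite /on_circle cmod_scale_at ?h ?divfK ?gt_eqF //.
by rewrite divr_ge0 // ltW.
Qed.

Let scale_at_continuous (Z : topologicalType) (z : Z) (m : Z -> R) (c : Z -> C) :
  {for z, continuous m} -> {for z, continuous c} ->
  {for z, continuous (fun z => scale_at a (m z) (c z))}.
Proof.
move=> cm cc.
have cr := @continuous_at_comp _ _ _ z m (real_complex R : R -> C) cm (@real_complex_continuous R _).
exact: (continuous_atD (@continuous_at_cst _ _ z a)
  (continuous_atM cr (continuous_atB cc (@continuous_at_cst _ _ z a)))).
Qed.

(** The slope maps the torus to a circle with the center of the j-th disc but an unrelated radius,
    hence the homothety about this center. *)
Let torus_to_circle (p : torus) : circle :=
  exist _ (Some (scale_at a (radd j / radw j) (slope (set_val p))) : P1 R)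
    (mem_set (on_circle_disc_circle (rescale_on (disw.1 j) (disc_rad_gt0 d j)
       (torus_circle_on p)))).

Let slope_torus_continuous (p : torus) :
  {for p, continuous (fun p : torus => slope (set_val p))}.
Proof.
have [x0 _ _] := curve_complementP (turbine_sub (tube_boundary_sub (set_valP p))).
exact: (@slope_continuous R n k _ p _ (@set_val_continuous R torus p) x0).
Qed.

Let torus_to_circle_continuous : continuous torus_to_circle.
Proof.
apply: continuous_set_val => p.
have cs := scale_at_continuous (@continuous_at_cst _ _ p (radd j / radw j)) (@slope_torus_continuous p).
exact: (@continuous_at_comp _ C (P1 R) p _ Some cs
  (@one_point_compactification_some_continuous C _)).
Qed.

Let rescaled_on (z : circle) :
  on_circle Cf radw j (scale_at a (radw j / radd j) (pcoord (circle_line z))).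
Proof. exact: (rescale_on (disc_rad_gt0 d j) (disw.1 j) (disc_circle_on_circle z)). Qed.

Let rescaled_off (z : circle) :
  off_centers Cf (scale_at a (radw j / radd j) (pcoord (circle_line z))).
Proof.
apply: (in_disc_off disw (on_circle_disc (rescaled_on z))).
by rewrite -subr_eq0 -cmod_eq0 rescaled_on gt_eqF // disw.1.
Qed.

Let circle_to_torus_proof (z : circle) :
  torus (fiber_pt (scale_at a (radw j / radd j) (pcoord (circle_line z))) (rho1 w)).
Proof.
apply/(tube_boundaryP hk); split.
  exact: (cmod_fiber_pt1 n k r s (rescaled_off z p_zero) (rho1_gt0 w)).
by rewrite (slope_fiber_pt hk hrs (rescaled_off z p_zero)) // rho1_gt0.
Qed.

Let circle_to_torus (z : circle) : torus :=
  exist _ (fiber_pt (scale_at a (radw j / radd j) (pcoord (circle_line z))) (rho1 w))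
    (mem_set (circle_to_torus_proof z)).

Let circle_coord_continuous (z : circle) :
  {for z, continuous (fun z : circle => pcoord (circle_line z))}.
Proof.
exact: (@continuous_at_comp _ _ _ z circle_line (@pcoord R l Cf)
  (@circle_line_continuous z) (@pcoord_continuous R l Cf _)).
Qed.

Let circle_to_torus_continuous : continuous circle_to_torus.
Proof.
apply: continuous_to_sub => z.
have cs := scale_at_continuous (@continuous_at_cst _ _ z (radw j / radd j)) (@circle_coord_continuous z).
exact: (@fiber_pt_continuous R n k r s _ z _ _ cs
  (@continuous_at_cst _ _ z (rho1 w)) (rescaled_off z p_zero) (rho1_gt0 w)).
Qed.

Let torus_line (p : torus) : P := turbine_slope (torus_turbine p).

Let torus_line_continuous : continuous torus_line.
Proof.
move=> p; exact: (@continuous_at_comp _ _ _ p torus_turbine (@turbine_slope R n k l Cf w)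
  (@torus_turbine_continuous p) (@turbine_slope_continuous R n k l Cf w _)).
Qed.

Let radial_continuous (Z : topologicalType) (x : Z * R) (q : R) (c : Z -> C) :
  {for x.1, continuous c} ->
  {for x, continuous (fun x : Z * R => scale_at a (1 - clamp x.2 + clamp x.2 * q) (c x.1))}.
Proof.
move=> cc.
have c1 := @continuous_at_comp _ _ _ x (@fst Z R) c (@continuous_at_fst _ _ x) cc.
have ct := @continuous_at_comp _ _ _ x (@snd Z R) (@clamp R) (@continuous_at_snd _ _ x)
  (@clamp_continuous R _).
have cm := continuous_atD (continuous_atB (@continuous_at_cst _ _ x (1 : R)) ct)
  (continuous_atM ct (@continuous_at_cst _ _ x q)).
exact: (scale_at_continuous cm c1).
Qed.

Let torus_nat (c1 : continuous (circle_line \o torus_to_circle)) :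
  nat_isomorphic (pullback_functor R torus_line_continuous) (pullback_functor R c1).
Proof.
pose H (p : torus) (u : R) : P :=
  mkP (radial_off disw disc_system_disjoint u (torus_circle_on p)).
apply: (@homotopy_pullback R torus P torus_line (circle_line \o torus_to_circle)
  torus_line_continuous c1 H).
- apply: continuous_pcoord => x.
  exact: (@radial_continuous torus x (radd j / radw j) (fun p : torus => slope (set_val p))
    (@slope_torus_continuous x.1)).
- move=> p; apply: pcoord_inj.
  rewrite -[LHS]/(scale_at a (1 - clamp 0 + clamp 0 * (radd j / radw j)) (slope (set_val p))).
  by rewrite clamp0 subr0 mul0r addr0 scale_at_id.
- move=> p; apply: pcoord_inj.
  rewrite -[LHS]/(scale_at a (1 - clamp 1 + clamp 1 * (radd j / radw j)) (slope (set_val p))).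
  by rewrite clamp1 subrr mul1r add0r.
Qed.

Let circle_nat (c1 : continuous (torus_line \o circle_to_torus)) :
  nat_isomorphic (pullback_functor R circle_line_continuous) (pullback_functor R c1).
Proof.
pose H (z : circle) (u : R) : P :=
  mkP (radial_off disc_system_disjoint disw u (disc_circle_on_circle z)).
apply: (@homotopy_pullback R circle P circle_line (torus_line \o circle_to_torus)
  circle_line_continuous c1 H).
- apply: continuous_pcoord => x.
  exact: (@radial_continuous circle x (radw j / radd j) (fun z : circle => pcoord (circle_line z))
    (@circle_coord_continuous x.1)).
- move=> z; apply: pcoord_inj.
  rewrite -[LHS]/(scale_at a (1 - clamp 0 + clamp 0 * (radw j / radd j)) (pcoord (circle_line z))).
  by rewrite clamp0 subr0 mul0r addr0 scale_at_id.
- move=> z; apply: pcoord_inj.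
  rewrite -[LHS]/(scale_at a (1 - clamp 1 + clamp 1 * (radw j / radd j)) (pcoord (circle_line z))).
  rewrite clamp1 subrr mul1r add0r.
  exact/esym/(slope_fiber_pt hk hrs (rescaled_off z p_zero) (rho1_gt0 w)).
Qed.

(* Up to radial homotopies in the punctured line, the slope maps the j-th
   torus to the j-th circle, and this map has a section. *)
Lemma circle_torus_data (F G : LS R P) :
  @isomorphic (LS R circle) (restr (@disc_circle_sub R l Cf d j) F)
    (restr (@disc_circle_sub R l Cf d j) G) <->
  @isomorphic (LS R torus) (pullback F torus_line_continuous)
    (pullback G torus_line_continuous).
Proof.
have ct : continuous (circle_line \o torus_to_circle).
  move=> p; exact: (@continuous_at_comp _ _ _ p torus_to_circle circle_line
    (@torus_to_circle_continuous p) (@circle_line_continuous _)).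
have cc : continuous (torus_line \o circle_to_torus).
  move=> p; exact: (@continuous_at_comp _ _ _ p circle_to_torus torus_line
    (@circle_to_torus_continuous p) (@torus_line_continuous _)).
split=> FG.
  have E (A : LS R P) := isomorphic_trans
    (nat_isomorphic_at A (pullback_comp_nat R circle_line_continuous torus_to_circle_continuous ct))
    (isomorphic_sym (nat_isomorphic_at A (torus_nat ct))).
  apply: isomorphic_trans (isomorphic_sym (E F)) (isomorphic_trans _ (E G)).
  exact: (functor_isomorphic (pullback_functor R torus_to_circle_continuous) FG).
have E (A : LS R P) := isomorphic_trans
  (nat_isomorphic_at A (circle_nat cc))
  (isomorphic_sym (nat_isomorphic_at A
    (pullback_comp_nat R torus_line_continuous circle_to_torus_continuous cc))).
apply: isomorphic_trans (E F) (isomorphic_trans _ (isomorphic_sym (E G))).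
exact: (functor_isomorphic (pullback_functor R circle_to_torus_continuous) FG).
Qed.

Lemma torus_tensor (K : local_system R T) (F : LS R P) :
  @isomorphic (LS R torus)
    (restr (@tube_boundary_sub R n k l Cf w j)
      (tensor K (pullback F (@turbine_slope_continuous R n k l Cf w))))
    (tensor (pullback K torus_turbine_continuous) (pullback F torus_line_continuous)).
Proof.
apply: isomorphic_trans (pullback_tensor torus_turbine_continuous K _) _.
apply: (functor_isomorphic (tensor_functor (pullback K torus_turbine_continuous))).
exact: (nat_isomorphic_at F (pullback_comp_nat R (@turbine_slope_continuous R n k l Cf w)
  torus_turbine_continuous torus_line_continuous)).
Qed.

Lemma circle_torus_tensor (K : local_system R T) (F G : LS R P) : rank_one K ->
  let A H := tensor K (pullback H (@turbine_slope_continuous R n k l Cf w)) in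
  @isomorphic (LS R circle) (restr (@disc_circle_sub R l Cf d j) F)
    (restr (@disc_circle_sub R l Cf d j) G) <->
  @isomorphic (LS R torus) (restr (@tube_boundary_sub R n k l Cf w j) (A F))
    (restr (@tube_boundary_sub R n k l Cf w j) (A G)).
Proof.
move=> K1 A; rewrite circle_torus_data; split=> FG.
  apply: isomorphic_trans (torus_tensor K F) (isomorphic_trans _ (isomorphic_sym (torus_tensor K G))).
  exact: (functor_isomorphic (tensor_functor (pullback K torus_turbine_continuous)) FG).
apply: (@tensor_cancel R torus (pullback K torus_turbine_continuous)).
  by move=> p; exact: K1.
exact: isomorphic_trans (isomorphic_sym (torus_tensor K F)) (isomorphic_trans FG (torus_tensor K G)).
Qed.

End Circle.

Lemma same_data_tensor (K : local_system R T) (F G : LS R P) : rank_one K ->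
  let A H := tensor K (pullback H (@turbine_slope_continuous R n k l Cf w)) in
  same_data_line d F G <-> same_data_turbine (A F) (A G).
Proof.
by move=> K1 A; split=> H j; apply/(circle_torus_tensor j F G K1); exact: H.
Qed.

End Boundary.

(** * Boundary data determine the monodromy along the fibers *)

Section TurbineMonodromy.
Variables (R : realType) (n k l : nat) (Cf : 'I_l -> Cx R) (r s : int).
Hypothesis hk : (0 < k)%N.
Hypothesis hrs : r * n%:Z = k%:Z * s + 1.
Local Notation C := (Cx R).
Local Notation P := (punctured_line Cf).
Local Notation slope := (slope n k).
Variables (w : tube_system n k Cf).
Local Notation T := (turbine w).
Local Notation radw := (turbine_rad w).
Local Notation sect := (turbine_section hk hrs w).
Local Notation rotT := (turbine_rot hk (w := w)).

Let disw : disjoint_discs Cf radw := turbine_disjoint hk hrs w.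

Lemma nearest_center (c : C) : exists2 j, j <> p_infty &
  forall i, cmod (c - disc_center Cf j) <= cmod (c - disc_center Cf i).
Proof.
(* The value [None] stands for the puncture 0 and makes the index set nonempty. *)
pose F (o : option 'I_l) := cmod (c - if o is Some i then Cf i else 0).
have [i0 _ ho] := @Order.TotalTheory.arg_minP _ R _ (None : option 'I_l) xpredT F isT.
exists (if i0 is Some i then p_root i else p_zero); first by case: (i0).
have E : disc_center Cf (if i0 is Some i then p_root i else p_zero) =
    if i0 is Some i then Cf i else 0 by case: (i0).
by move=> i; rewrite E; case: i => [|i|]; [exact: (ho None isT)|exact: (ho (Some i) isT)|exact: (ho None isT)].
Qed.

Lemma rotT_continuous : continuous (fun p : T * R => rotT p.1 p.2).
Proof. exact: fiber_rot_continuous. Qed.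

Lemma rotT_loop p t : rotT p (1 + t) = rotT p t.
Proof. by rewrite /turbine_rot -fiber_rotD fiber_rot1. Qed.

Lemma turbine_section_angle (z : T) : exists t, rotT (sect (turbine_slope z)) t = z.
Proof.
have [x0 y0 _] := curve_complementP (turbine_sub (set_valP z)).
have [e1 _ _] := fiber_argE hk hrs x0 y0.
have [t et] := unit_loop_surj e1; exists t; apply: val_inj.
have := fiber_arg_rot hk hrs x0 y0 et.
have /(turbineP hk)[-> _] := set_valP z.
by rewrite -(turbine_sectionE hk hrs z).
Qed.

Lemma turbine_monodromy_path (M : local_system R T) eps (b : R -> P) (z : T) :
  continuous b -> b 0 = turbine_slope z ->
  monodromy_scalar M (rotT (sect (b 1))) eps -> monodromy_scalar M (rotT z) eps.
Proof.
move=> cb b0 H1; have [t0 zt] := turbine_section_angle z.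
(* The starting angle decreases from [t0] to 0, so that the loop at [u = 0] starts at [z] itself and
   the loop at [u = 1] at the section. *)
pose H (u t : R) : T := rotT (sect (b u)) (t + (1 - u) * t0).
have cH : continuous (fun p : R * R => H p.1 p.2).
  move=> x.
  have c1 := @continuous_at_comp _ _ _ x (@fst R R) b (@continuous_at_fst _ _ x) (@cb _).
  have c2 := @continuous_at_comp _ _ _ x (fun p : R * R => b p.1) sect c1
    (@turbine_section_continuous R n k l Cf r s hk hrs w _).
  have c3 := continuous_atD (@continuous_at_snd _ _ x) (continuous_atM
    (continuous_atB (@continuous_at_cst _ _ x (1 : R)) (@continuous_at_fst _ _ x))
    (@continuous_at_cst _ _ x t0)).
  exact: (@continuous_at_comp _ _ _ x _ (fun p : T * R => rotT p.1 p.2)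
    (continuous_pair c2 c3) (@rotT_continuous _)).
have E0 : H 0 = rotT z.
  apply/funext => t; rewrite /H subr0 mul1r b0 -[in RHS]zt /turbine_rot fiber_rotD.
  by rewrite addrC.
have E1 : H 1 = rotT (sect (b 1)).
  by apply/funext => t; rewrite /H subrr mul0r addr0.
rewrite -E0; apply: (@monodromy_homotopy R T M H eps 0 1 cH); last by rewrite E1.
by move=> u; rewrite /H add0r rotT_loop.
Qed.

(** The slope and the modulus of the first coordinate are constant along the fiber, so the whole
    loop stays in the torus and its monodromy is computed there. *)
Lemma boundary_monodromy (L M : local_system R T) eps j (z : T) :
  (forall p, monodromy_scalar L (rotT p) eps) ->
  @isomorphic (LS R (tube_boundary w j)) (restr (@tube_boundary_sub R n k l Cf w j) M)
    (restr (@tube_boundary_sub R n k l Cf w j) L) ->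
  tube_boundary w j (set_val z) -> monodromy_scalar M (rotT z) eps.
Proof.
move=> HL ML zj.
have brot (p : C * C) t : tube_boundary w j p -> tube_boundary w j (delta_loop n k p t).
  move=> /(tube_boundaryP hk)[p1 h]; apply/(tube_boundaryP hk).
  by rewrite cmod_delta_loop1 slope_delta_loop.
pose q : tube_boundary w j := exist _ (set_val z) (mem_set zj).
pose c := fiber_rot brot q.
have cc : continuous c.
  exact: (slice_continuous1 (H := fiber_rot brot) (@fiber_rot_continuous R n k _ brot)).
have c01 : c 0 = c 1 by rewrite /c fiber_rot0 fiber_rot1.
have Ec : incl (@tube_boundary_sub R n k l Cf w j) \o c = rotT z.
  by apply/funext => t; apply: val_inj.
have cincl := incl_continuous (AB := @tube_boundary_sub R n k l Cf w j).
rewrite -Ec; apply/(monodromy_pullback M cincl cc eps c01).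
(* [restr] carries its own proof of continuity, which is identified with [cincl] by proof
   irrelevance. *)
have cE : cincl = incl_continuous (AB := @tube_boundary_sub R n k l Cf w j).
  exact: Prop_irrelevance.
rewrite cE; apply: (monodromy_isomorphic cc ML).
by apply/(monodromy_pullback L _ cc eps c01); rewrite Ec.
Qed.

(* Every point of the turbine moves, towards the nearest puncture, to a point
   of the boundary, so the boundary data determine the monodromy along the fibers. *)
Lemma turbine_monodromy (L M : local_system R T) eps :
  (forall p, monodromy_scalar L (rotT p) eps) -> same_data_turbine M L ->
  forall p, monodromy_scalar M (rotT p) eps.
Proof.
move=> HL ML z; set c := slope (set_val z).
have offc : off_centers Cf c by exact: slope_off (turbine_sub (set_valP z)).
have [j jf jmin] := nearest_center c.
have x0 : 0 < cmod (c - disc_center Cf j) by rewrite cmod_gt0 subr_eq0.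
have r0 : 0 < radw j := disw.1 j.
have rx : radw j <= cmod (c - disc_center Cf j).
  have /(turbineP hk)[_ /(_ j)] := set_valP z; rewrite -/c => H.
  rewrite leNgt; apply/negP => lt.
  have : in_disc Cf radw j c by case: (j) jf lt => [|i|] //= _ /ltW.
  by move/H; rewrite /on_circle => E; move: lt; rewrite E ltxx.
pose q := radw j / cmod (c - disc_center Cf j).
have q0 : 0 < q by rewrite divr_gt0.
have q1 : q <= 1 by rewrite ler_pdivrMr // mul1r.
(* The ratio goes from 1 to [q], which brings the point onto the circle of [j]. The segment has to
   avoid only the centers: where it crosses another disc, the section applies the retraction. *)
pose m u := 1 - clamp u * (1 - q).
have m01 u : 0 < m u <= 1.
  have /andP[u0 u1] := clamp_itv u; rewrite /m; apply/andP; split.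
    rewrite subr_gt0; apply: le_lt_trans (_ : 1 - q < 1); last by rewrite ltrBlDr ltrDl.
    by rewrite ler_piMl // subr_ge0.
  by rewrite lerBlDr lerDl mulr_ge0 // subr_ge0.
(* If the moving point met the center of [i], the distance from [c] to it would be [1 - m u] times
   the distance to the center of [j], hence strictly smaller than the minimum. *)
have boff u : off_centers Cf (scale_at (disc_center Cf j) (m u) c).
  move=> i; apply/eqP => E; have /andP[m0 m1] := m01 u.
  have : c - disc_center Cf i = (1 - m u)%:C * (c - disc_center Cf j).
    by rewrite -E /scale_at; move: (m u) => v; rewrite rmorphB rmorph1; ring.
  move/(congr1 (@cmod R)); rewrite cmodM cmod_real ?subr_ge0 // => E'.
  have := jmin i; rewrite E' leNgt => /negP; apply.
  by rewrite gtr_pMl // ltrBlDr ltrDl.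
pose b u : P := mkP (boff u).
have cb : continuous b.
  apply: continuous_pcoord => u.
  have cm := continuous_atB (@continuous_at_cst _ _ u (1 : R))
    (continuous_atM (@clamp_continuous R u) (@continuous_at_cst _ _ u (1 - q))).
  have cr := @continuous_at_comp _ _ _ u _ (real_complex R : R -> C) cm
    (@real_complex_continuous R _).
  exact: (continuous_atD (@continuous_at_cst _ _ u (disc_center Cf j))
    (continuous_atM cr (@continuous_at_cst _ _ u (c - disc_center Cf j)))).
have b0 : b 0 = turbine_slope z.
  apply: pcoord_inj; rewrite -[LHS]/(scale_at (disc_center Cf j) (m 0) c).
  by rewrite /m clamp0 mul0r subr0 scale_at_id.
apply: (turbine_monodromy_path cb b0).
apply: (boundary_monodromy HL (ML j)).
have m1 : m 1 = q by rewrite /m clamp1 mul1r opprB addrC subrK.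
have on : on_circle Cf radw j (pcoord (b 1)).
  rewrite -[pcoord _]/(scale_at (disc_center Cf j) (m 1) c) m1 /on_circle.
  by rewrite cmod_scale_at ?ltW // divfK // gt_eqF.
(* The endpoint lies on the circle of [j] and in no other disc, so the section at it has the same
   slope and lies on the j-th torus. *)
have fix1 : retract Cf radw (pcoord (b 1)) = pcoord (b 1).
  apply: (retract_fix disw (pcoord_off _)) => i bi.
  by rewrite -(disw.2 _ _ _ (on_circle_disc on) bi).
apply/(tube_boundaryP hk).
rewrite -[set_val _]/(fiber_pt n k r s (retract Cf radw (pcoord (b 1))) (rho1 w)) fix1.
split; first exact: (cmod_fiber_pt1 n k r s (pcoord_off _ p_zero) (rho1_gt0 w)).
by rewrite (slope_fiber_pt hk hrs (pcoord_off _ p_zero)) // rho1_gt0.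
Qed.

End TurbineMonodromy.

(** * The equivalence *)

Lemma nat_isomorphic_compA (C1 C2 C3 C4 : category) (F : functor C3 C4)
  (G : functor C2 C3) (H : functor C1 C2) :
  nat_isomorphic (functor_comp (functor_comp F G) H) (functor_comp F (functor_comp G H)).
Proof.
exists (fun A => idm _), (fun A => idm _).
by split=> [A|A|A B f]; rewrite ?comp_idl ?comp_idr.
Qed.

Lemma full_nat_isomorphic (Ca Cb : category) (Q : Cb -> Prop)
  (F G : functor Ca (full_subcategory Q)) :
  nat_isomorphic (functor_comp (sub_inclusion Q) F) (functor_comp (sub_inclusion Q) G) ->
  nat_isomorphic F G.
Proof. by move=> [a [b [ba ab na]]]; exists a, b; split. Qed.

Section Main.
Variables (R : realType) (n k l : nat) (Cf : 'I_l -> Cx R) (r s : int).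
Hypothesis hk : (0 < k)%N.
Hypothesis hrs : r * n%:Z = k%:Z * s + 1.
Variables (eps : Cx R) (heps : eps != 0).
Variables (w : tube_system n k Cf) (d : disc_system Cf).
Local Notation X := (curve_complement n k Cf).
Local Notation P := (punctured_line Cf).
Local Notation T := (turbine w).
Variable K : local_system R X.
Hypothesis K1 : rank_one K.
Hypothesis Ksc : scalar_along_fibers eps K.

Local Notation cg := (@gamma_continuous R n k l Cf).
Local Notation csX := (@curve_section_continuous R n k l Cf r s hk hrs (rho1 w) (rho1_gt0 w)).
Local Notation cT := (@turbine_slope_continuous R n k l Cf w).
Local Notation csT := (@turbine_section_continuous R n k l Cf r s hk hrs w).
Local Notation Sig := (Sigma n k Cf eps).
Local Notation rotX := (@curve_rot R n k l Cf hk).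
Local Notation rotT := (@turbine_rot R n k l Cf hk w).

Let rotX_continuous p : continuous (rotX p).
Proof.
exact: (slice_continuous1 (H := rotX) (@fiber_rot_continuous R n k X (@delta_loop_curve R n k l Cf hk))).
Qed.

Let rotX_closed p : rotX p 0 = rotX p 1.
Proof. by rewrite /curve_rot fiber_rot0 fiber_rot1. Qed.

Let rotT_continuous1 p : continuous (rotT p).
Proof. exact: (slice_continuous1 (H := rotT) (@rotT_continuous R n k l Cf hk w)). Qed.

Let rotT_closed p : rotT p 0 = rotT p 1.
Proof. by rewrite /turbine_rot fiber_rot0 fiber_rot1. Qed.

Let gamma_rotX p t : gamma (rotX p t) = gamma (rotX p 0).
Proof.
apply: pcoord_inj; transitivity (slope n k (set_val p)).
  exact: slope_delta_loop.
exact/esym/slope_delta_loop.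
Qed.

Let monoK p : monodromy_scalar K (rotX p) eps.
Proof. exact: (scalar_along_fibersP hk eps K).1 Ksc p. Qed.

Let dual_tensor_trivial (L : local_system R X) p : scalar_along_fibers eps L ->
  monodromy_scalar (tensor (dual K) L) (rotX p) 1.
Proof.
move=> /(scalar_along_fibersP hk) /(_ p) HL.
rewrite -(mulVf heps); apply: (monodromy_tensor (@rotX_continuous p)) => //.
exact: (monodromy_dual (@rotX_continuous p) heps).
Qed.

Let pullback_trivial (F : local_system R P) p : monodromy_scalar (pullback F cg) (rotX p) 1.
Proof. exact: (monodromy_fiber (@rotX_continuous p) (rotX_closed p) (gamma_rotX p)). Qed.

Let tensor_pullback_scalar (F : local_system R P) :
  scalar_along_fibers eps (tensor K (pullback F cg)).
Proof.
apply/(scalar_along_fibersP hk) => p; rewrite -[eps]mulr1.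
by apply: (monodromy_tensor (@rotX_continuous p)).
Qed.

Let TI : functor Sig (LS R X) := functor_comp (tensor_functor (dual K)) (sub_inclusion _).

Let TI_descent : nat_isomorphic
  (functor_comp (pullback_functor R cg) (functor_comp (pullback_functor R csX) TI)) TI.
Proof.
apply: (curve_descent hrs (rho1_gt0 w) (F := TI)) => L p.
exact: dual_tensor_trivial (svalP L).
Qed.

Let sect_nat := curve_section_nat Cf hk hrs (rho1_gt0 w).

(** Uniqueness holds because the inverse image under the section recovers a system on the punctured
    line from its inverse image under [gamma]. *)
Lemma descended_exists (L : Sig) : exists F : LS R P,
  @isomorphic (LS R X) (tensor (dual K) (sval L)) (pullback F cg) /\
  forall F' : LS R P,
    @isomorphic (LS R X) (tensor (dual K) (sval L)) (pullback F' cg) -> isomorphic F' F.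
Proof.
exists (pullback (tensor (dual K) (sval L)) csX); split.
  exact: isomorphic_sym (nat_isomorphic_at L TI_descent).
move=> F' /(functor_isomorphic (pullback_functor R csX)) H.
exact: isomorphic_trans (isomorphic_sym (nat_isomorphic_at F' sect_nat)) (isomorphic_sym H).
Qed.

Lemma descended_functor : exists Phi : functor Sig (LS R P),
  nat_isomorphic TI (functor_comp (pullback_functor R cg) Phi).
Proof.
exists (functor_comp (pullback_functor R csX) TI).
exact: nat_isomorphic_sym TI_descent.
Qed.

Section Phi.
Variable Phi : functor Sig (LS R P).
Hypothesis eta : nat_isomorphic TI (functor_comp (pullback_functor R cg) Phi).

Let KG : functor (LS R P) (LS R X) := functor_comp (tensor_functor K) (pullback_functor R cg).

Let Psi : functor (LS R P) Sig :=
  @Functor (LS R P) Sig (fun F => exist _ (KG F) (@tensor_pullback_scalar F))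
    (fun A B f => fmor KG f) (fmor_id KG) (fmor_comp KG).

Let incl_Psi : nat_isomorphic (functor_comp (sub_inclusion _) Psi) KG.
Proof.
exists (fun A => idm _), (fun A => idm _).
by split=> [A|A|A B f]; rewrite ?comp_idl ?comp_idr.
Qed.

(** By [eta], the composite is tensoring with the dual of [K] and then with [K], which cancel;
    isomorphisms in the full subcategory are those of the ambient one. *)
Let Psi_Phi : nat_isomorphic (functor_comp Psi Phi) (functor_id Sig).
Proof.
apply: full_nat_isomorphic.
apply: nat_isomorphic_trans (nat_isomorphic_sym (nat_isomorphic_compA _ _ _)) _.
apply: nat_isomorphic_trans (nat_isomorphic_compr Phi incl_Psi) _.
apply: nat_isomorphic_trans (nat_isomorphic_compA _ _ _) _.
apply: nat_isomorphic_trans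
  (nat_isomorphic_compl (tensor_functor K) (nat_isomorphic_sym eta)) _.
apply: nat_isomorphic_trans (nat_isomorphic_sym (nat_isomorphic_compA _ _ _)) _.
exact: (nat_isomorphic_compr (sub_inclusion _) (tensor_dual_nat_iso K1)).
Qed.

Let TI_Psi : nat_isomorphic (functor_comp TI Psi) (pullback_functor R cg).
Proof.
apply: nat_isomorphic_trans (nat_isomorphic_compA _ _ _) _.
apply: nat_isomorphic_trans (nat_isomorphic_compl (tensor_functor (dual K)) incl_Psi) _.
apply: nat_isomorphic_trans (nat_isomorphic_sym (nat_isomorphic_compA _ _ _)) _.
exact: (nat_isomorphic_compr (pullback_functor R cg) (dual_tensor_nat_iso K1)).
Qed.

(** The inverse image under [gamma] is inserted in front together with that under the section. Then
    [eta] applies, the factors [K] and its dual cancel, and the two inverse images cancel in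
    turn. *)
Let Phi_Psi : nat_isomorphic (functor_comp Phi Psi) (functor_id (LS R P)).
Proof.
have s1 : nat_isomorphic (functor_comp Phi Psi)
    (functor_comp (functor_comp (pullback_functor R csX) (pullback_functor R cg))
      (functor_comp Phi Psi)).
  exact: nat_isomorphic_sym (nat_isomorphic_compr (functor_comp Phi Psi) sect_nat).
apply: nat_isomorphic_trans s1 _.
apply: nat_isomorphic_trans (nat_isomorphic_compA _ _ _) _.
apply: nat_isomorphic_trans _ sect_nat; apply: nat_isomorphic_compl.
apply: nat_isomorphic_trans (nat_isomorphic_sym (nat_isomorphic_compA _ _ _)) _.
exact: nat_isomorphic_trans (nat_isomorphic_compr Psi (nat_isomorphic_sym eta)) TI_Psi.
Qed.

Lemma descended_equivalence : is_equivalence Phi.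
Proof. by exists Psi. Qed.

Variable L : Sig.
Local Notation F := (Phi L).

Let etaL : @isomorphic (LS R X) (tensor (dual K) (sval L)) (pullback F cg).
Proof. exact: nat_isomorphic_at L eta. Qed.

Lemma descended_irreducible : irreducible (sval L) <-> irreducible F.
Proof.
split=> irr.
  apply: (@irreducible_pullback_reflect R X P (@gamma R n k l Cf) cg).
    exact: (gamma_surj hk hrs (rho1_gt0 w)).
  apply: (irreducible_isomorphic etaL).
  apply: (irreducible_tensor_reflect K1).
  apply: (irreducible_isomorphic _ irr).
  exact: isomorphic_sym (nat_isomorphic_at (sval L) (tensor_dual_nat_iso K1)).
apply: (irreducible_tensor_reflect (dual_rank_one K1)).
apply: (irreducible_isomorphic (isomorphic_sym etaL)).
apply: (@irreducible_pullback R X P (@gamma R n k l Cf) cg F _ csX) => //.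
  exact: (nat_isomorphic_at F sect_nat).
move=> M f fi.
(* Descent is stated for functors, so [M] is treated as an object of the full subcategory of systems
   with trivial monodromy along the fibers; it inherits this triviality as a subobject. *)
pose Q (N : LS R X) := forall p, monodromy_scalar N (rotX p) 1.
have QM : Q M.
  move=> p; have tp := @pullback_trivial F p.
  exact: (monodromy_mono fi (rotX_closed p) tp).
have D := curve_descent hrs (rho1_gt0 w) (F := sub_inclusion Q) (fun N => svalP N).
exact: (nat_isomorphic_at (exist Q M QM : full_subcategory Q) D).
Qed.

Let KT : local_system R T := to_turbine w K.
(** Counterparts on the turbine of the quasi-inverse and of the descended functor. They are mutually
    inverse on isomorphism classes once the monodromy along the fibers is known to be [eps]. *)
Let up (H : LS R P) : LS R T := tensor KT (pullback H cT).
Let down (M : LS R T) : LS R P := pullback (tensor (dual KT) M) csT.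

Let KT1 : rank_one KT. Proof. by move=> p; exact: K1. Qed.

Let turbine_restr_mono (N : local_system R X) a p :
  (forall q, monodromy_scalar N (rotX q) a) ->
  monodromy_scalar (to_turbine w N) (rotT p) a.
Proof.
move=> HN; have ci := incl_continuous (AB := @turbine_sub R n k l Cf w).
have E : ci = incl_continuous (AB := @turbine_sub R n k l Cf w) by exact: Prop_irrelevance.
rewrite /to_turbine /restr -E.
apply/(monodromy_pullback N ci (@rotT_continuous1 p) a (rotT_closed p)).
have -> : incl (@turbine_sub R n k l Cf w) \o rotT p = rotX (incl (@turbine_sub R n k l Cf w) p).
  by apply/funext => t; apply: val_inj.
exact: HN.
Qed.

Let up_down (M : LS R T) : (forall p, monodromy_scalar M (rotT p) eps) ->
  isomorphic (up (down M)) M.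
Proof.
move=> HM; apply: isomorphic_trans (nat_isomorphic_at M (tensor_dual_nat_iso KT1)).
apply: (functor_isomorphic (tensor_functor KT)).
pose Q (N : LS R T) := forall p, monodromy_scalar N (rotT p) 1.
have QM : Q (tensor (dual KT) M).
  move=> p; rewrite -(mulVf heps); apply: (monodromy_tensor (@rotT_continuous1 p)) => //.
  apply: (monodromy_dual (@rotT_continuous1 p) heps).
  exact: turbine_restr_mono monoK.
have D := turbine_descent hrs (F := sub_inclusion Q) (fun N => svalP N).
exact: (nat_isomorphic_at (exist Q _ QM : full_subcategory Q) D).
Qed.

Let down_up (H : LS R P) : isomorphic (down (up H)) H.
Proof.
apply: isomorphic_trans (nat_isomorphic_at H (turbine_section_nat hk hrs w)).
apply: (functor_isomorphic (pullback_functor R csT)).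
exact: (nat_isomorphic_at _ (dual_tensor_nat_iso KT1)).
Qed.

Let up_iso (H H' : LS R P) : isomorphic H H' -> isomorphic (up H) (up H').
Proof.
move=> HH; apply: (functor_isomorphic (tensor_functor KT)).
exact: (functor_isomorphic (pullback_functor R cT)).
Qed.

Let down_iso (M M' : LS R T) : isomorphic M M' -> isomorphic (down M) (down M').
Proof.
move=> HH; apply: (functor_isomorphic (pullback_functor R csT)).
exact: (functor_isomorphic (tensor_functor (dual KT))).
Qed.

Let up_F : isomorphic (up F) (to_turbine w (sval L)).
Proof.
have ci := incl_continuous (AB := @turbine_sub R n k l Cf w).
have e1 : @isomorphic (LS R X) (sval L) (tensor K (pullback F cg)).
  apply: isomorphic_trans (isomorphic_sym (nat_isomorphic_at (sval L) (tensor_dual_nat_iso K1))) _.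
  exact: (functor_isomorphic (tensor_functor K) etaL).
apply: isomorphic_sym.
apply: isomorphic_trans (functor_isomorphic (pullback_functor R
  (incl_continuous (AB := @turbine_sub R n k l Cf w))) e1) _.
apply: isomorphic_trans (pullback_tensor _ _ _) _.
apply: (functor_isomorphic (tensor_functor KT)).
exact: (nat_isomorphic_at F (pullback_comp_nat R cg _ cT)).
Qed.

Let same_iso (M N N' : LS R T) : isomorphic N N' ->
  same_data_turbine M N -> same_data_turbine M N'.
Proof.
move=> NN MN j; apply: isomorphic_trans (MN j) _.
exact: (functor_isomorphic (pullback_functor R
  (incl_continuous (AB := @tube_boundary_sub R n k l Cf w j))) NN).
Qed.

Let same_sym (M N : LS R T) : same_data_turbine M N -> same_data_turbine N M.
Proof. by move=> MN j; exact: isomorphic_sym (MN j). Qed.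

Let same_up (H : LS R P) :
  same_data_line d H F <-> same_data_turbine (up H) (to_turbine w (sval L)).
Proof.
rewrite (same_data_tensor hk hrs d H F KT1); split; apply: same_iso => //.
exact: isomorphic_sym.
Qed.

Let mono_same (M : LS R T) : same_data_turbine M (to_turbine w (sval L)) ->
  forall p, monodromy_scalar M (rotT p) eps.
Proof.
apply: (turbine_monodromy hrs) => p; apply: turbine_restr_mono.
exact: (scalar_along_fibersP hk eps _).1 (svalP L).
Qed.

(** The system [up (down M)] is isomorphic to [M], so it has the boundary data of [L], and the
    comparison of data applies to [down M]. *)
Let same_down (M : LS R T) : same_data_turbine M (to_turbine w (sval L)) ->
  same_data_line d (down M) F.
Proof.
move=> MN; apply/same_up; apply: same_sym; apply: same_iso (same_sym MN).
by apply: isomorphic_sym; apply: up_down; exact: mono_same.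
Qed.

Lemma descended_rigid : rigid_complement w (sval L) <-> rigid_line d F.
Proof.
split=> rig H HF.
  have := rig (up H) ((same_up H).1 HF) => /isomorphic_trans/(_ (isomorphic_sym up_F)) /down_iso E.
  exact: isomorphic_trans (isomorphic_sym (down_up H)) (isomorphic_trans E (down_up F)).
have E := up_down (mono_same HF).
apply: isomorphic_trans (isomorphic_sym E) (isomorphic_trans _ up_F).
by apply: up_iso; apply: rig; exact: same_down.
Qed.

Lemma descended_semirigid : semirigid_complement w (sval L) <-> semirigid_line d F.
Proof.
split=> -[m [G HG]].
  exists m, (fun i => down (G i)) => H /same_up /HG[i Hi]; exists i.
  exact: isomorphic_trans (isomorphic_sym (down_up H)) (down_iso Hi).
exists m, (fun i => up (G i)) => M HM; have [i Hi] := HG _ (same_down HM); exists i.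
exact: isomorphic_trans (isomorphic_sym (up_down (mono_same HM))) (up_iso Hi).
Qed.

End Phi.
End Main.

Theorem lemma3p3 (R : realType) (n k l : nat) (Cf : 'I_l -> Cx R)
  (hk : (1 <= k)%N) (hkn : (k < n)%N) (hnk : coprime n k) (hl : (1 <= l)%N)
  (hCf0 : forall i, Cf i != 0) (hCf : injective Cf)
  (r s : int) (hrs : r * n%:Z = k%:Z * s + 1)
  (eps : Cx R) (heps : eps != 0)
  (w : tube_system n k Cf) (d : disc_system Cf)
  (K : local_system R (curve_complement n k Cf))
  (hK : is_Keps r s w eps K) :
  (forall L : Sigma n k Cf eps,
     exists F : LS R (punctured_line Cf),
       @isomorphic (LS R (curve_complement n k Cf))
         (tensor (dual K) (sval L)) (pullback F (@gamma_continuous R n k l Cf)) /\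
       forall F' : LS R (punctured_line Cf),
         @isomorphic (LS R (curve_complement n k Cf))
           (tensor (dual K) (sval L))
           (pullback F' (@gamma_continuous R n k l Cf)) ->
         isomorphic F' F) /\
  (exists Phi : functor (Sigma n k Cf eps) (LS R (punctured_line Cf)),
     nat_isomorphic
       (functor_comp (tensor_functor (dual K)) (sub_inclusion _))
       (functor_comp (pullback_functor R (@gamma_continuous R n k l Cf)) Phi)) /\
  (forall Phi : functor (Sigma n k Cf eps) (LS R (punctured_line Cf)),
     nat_isomorphic
       (functor_comp (tensor_functor (dual K)) (sub_inclusion _))
       (functor_comp (pullback_functor R (@gamma_continuous R n k l Cf)) Phi) ->
     is_equivalence Phi /\
     forall L : Sigma n k Cf eps,
       [/\ irreducible (sval L) <-> irreducible (Phi L),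
           rigid_complement w (sval L) <-> rigid_line d (Phi L)
         & semirigid_complement w (sval L) <-> semirigid_line d (Phi L)]).
Proof.
have [K1 Ksc _ _] := hK; split; last split.
- exact: (descended_exists hk hrs heps w Ksc).
- exact: (descended_functor hk hrs heps w Ksc).
- move=> Phi eta; split.
    exact: (descended_equivalence hk hrs w K1 Ksc eta).
  move=> L; split.
  + exact: (descended_irreducible hk hrs w K1 eta L).
  + exact: (descended_rigid hk hrs heps w d K1 Ksc eta L).
  + exact: (descended_semirigid hk hrs heps w d K1 Ksc eta L).
Qed.
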